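(* Let $X$ be a centered stationary Gaussian process on $\mathbb{R}$ whose spectral measure $\mu$ is a compactly supported symmetric Borel probability measure on $\mathbb{R}$ having a nontrivial absolutely continuous part with respect to Lebesgue measure. Then: (i) there exist constants $C>1$ and $0<c_1\le c_2<\infty$ (depending only on $\mu$) such that for every $T\ge 1$ and every $n\in\mathbb{N}$ with $n\ge CT$, $$c_1\,n^2\log(n/T)\le -\log\mathbb{P}(\mathscr{N}_T\ge n)\le c_2\,n^2\log(n/T);$$ (ii) there is a constant $\tilde c>0$ (depending only on $\mu$) such that for every $T\ge 1$ and every $m\in\mathbb{N}$, $m\geq 1$, $$\left(\mathbb{E}[\mathscr{N}_T^m]\right)^{1/m}\le \tilde c\,\max\{T,\sqrt{m}\}.$$
   Context: The spectral measure $\mu$ of a centered stationary Gaussian process $X$ on $\mathbb{R}$ is the measure such that $\mathbb{E}[X_tX_0]=\int_{\mathbb{R}}e^{-itx}\,d\mu(x)$; a version with smooth sample paths is taken. For $T>0$, $\mathscr{N}_T:=\#\{x\in[0,T]: X_x=0\}$. ''Symmetric'' means $\mu(-A)=\mu(A)$ for all Borel $A$. *)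

(* Defs.v *)
From mathcomp Require Import all_boot all_order all_algebra.
From mathcomp Require Import all_classical all_reals all_analysis.
From mathcomp Require Import complex.

Set Implicit Arguments.
Unset Strict Implicit.
Unset Printing Implicit Defensive.

Import Order.TTheory GRing.Theory Num.Theory.
Import numFieldNormedType.Exports.

Local Open Scope classical_set_scope.
Local Open Scope ring_scope.

Section borel_measures.
Context {R : realType}.
Implicit Types mu nu : {measure set (measurableTypeR R) -> \bar R}.

Definition symmetric_measure mu : Prop :=
  forall A : set (measurableTypeR R), measurable A ->
    mu [set - x | x in A] = mu A.

Definition measure_support mu : set R :=
  [set x | forall U : set R, open U -> U x -> (0 < mu U)%E].

Definition compactly_supported mu : Prop := compact (measure_support mu).

Definition mutually_singular mu nu : Prop :=
  exists2 N : set (measurableTypeR R), measurable N &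
    mu (~` N) = 0%E /\ nu N = 0%E.

(* Stated on a Lebesgue decomposition [mu = mu_ac + mu_s]; it is unique when
   [mu] is finite, so [mu_ac] is the absolutely continuous part of [mu]. *)
Definition has_ac_part mu : Prop :=
  exists mu_ac mu_s : {measure set (measurableTypeR R) -> \bar R},
    [/\ forall A : set (measurableTypeR R), measurable A ->
          mu A = (mu_ac A + mu_s A)%E,
        mu_ac `<< (@lebesgue_measure R),
        mutually_singular mu_s (@lebesgue_measure R)
      & mu_ac setT != 0%E].

Definition expi (x : R) : R[i] := Complex (cos x) (sin x).

Definition complex_integral mu (f : R -> R[i]) : R[i] :=
  Complex (\int[mu]_x complex.Re (f x))
          (\int[mu]_x complex.Im (f x)).

End borel_measures.

(* Normal law with mean [m] and standard deviation [s]; [normal_prob m 0] is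
   not the point mass at [m], so the degenerate case is treated apart. *)
Definition gaussian_law {R : realType} (m s : R) (A : set R) : \bar R :=
  if s == 0 then dirac m A else normal_prob m s A.

Section processes.
Context d {Omega : measurableType d} {R : realType}.
Variable P : probability Omega R.
Implicit Type X : R -> {RV P >-> R}.

Definition gaussian_process X : Prop :=
  forall (n : nat) (t a : 'I_n -> R), exists m s : R,
    forall A : set (measurableTypeR R), measurable A ->
      P [set w | A (\sum_(i < n) a i * X (t i) w)] = gaussian_law m s A.

Definition centered X : Prop := forall t, ('E_P[X t] = 0)%E.

Definition stationary X : Prop :=
  forall (n : nat) (t : n.-tuple R) (h : R)
      (A : set (n.-tuple (measurableTypeR R))), measurable A ->
    P [set w | A [tuple X (tnth t i + h) w | i < n]] =
    P [set w | A [tuple X (tnth t i) w | i < n]].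

(* For a Gaussian process the expectation below is finite, so [fine] loses no
   information. *)
Definition spectral_measure_of X
    (mu : {measure set (measurableTypeR R) -> \bar R}) : Prop :=
  forall t : R,
    (fine 'E_P[(X t \* X 0)%R]%E)%:C%C =
    complex_integral mu (fun x => expi (- (t * x))).

Definition smooth_paths X : Prop :=
  forall (w : Omega) (k : nat) (x : R),
    derivable ((fun t => X t w)^`(k))%classic x 1.

(* [+oo] when the zero set is infinite. *)
Definition zero_count X (T : R) (w : Omega) : \bar R :=
  counting [set x : R | 0 <= x <= T /\ X x w = 0].

Definition smooth_stationary_gaussian X
    (mu : {measure set (measurableTypeR R) -> \bar R}) : Prop :=
  [/\ gaussian_process X, centered X, stationary X, spectral_measure_of X mu
    & smooth_paths X].

End processes.

(* Main.v *)
From HB Require Import structures.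
Require Import Defs.
From mathcomp Require Import all_boot all_order all_algebra.
From mathcomp Require Import all_classical all_reals all_analysis.
From mathcomp Require Import complex measurable_realfun ring lra.
Import Order.TTheory GRing.Theory Num.Theory.
Import numFieldNormedType.Exports.
Local Open Scope classical_set_scope.
Local Open Scope ring_scope.

(** Write [r = n / T]. Both tail bounds rest on a lower bound for the covariance
    of the process on a grid: for [N] points of small mesh [h], the covariance
    matrix is at least [K^-1 (h / K)^(2 (N - 1))] ([spectral_form_lower]): its
    quadratic form is the integral of [|p (e^(i h x))|^2] against [mu], where
    [p] is the polynomial whose coefficients are the entries of the vector. If
    this integral is small, then [p] is small at [N] points separated by a
    constant times [1 / N], because the absolutely continuous part of [mu]
    does not fit into a set of small Lebesgue measure ([separated_points]);
    Lagrange interpolation then bounds the coefficients of [p]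
    ([coef_le_of_values]), with a loss that is only exponential in [N].

    Upper bound. A function with [n] zeros in [[0, T]] whose Newton
    coefficients, at a dense sequence of nodes, decay like [B^j / j!] is of order
    at most [(B T)^n e^(B T) / n!] on all of [[0, T]] ([small_of_zeros]). For
    the process, the [j]-th Newton coefficient is a centered Gaussian variable,
    and since [mu] lives on some [[-A, A]] its standard deviation is of order at
    most [A^j e^(A T) / j!] ([newton_coef_tail]); so the decay holds with
    [B = 2 A] outside an event of negligible probability. Hence [n] zeros make
    the process smaller than [r^(- n / 2)], up to exponential factors, at
    about [n / 8] grid points. By the covariance bound, a Gaussian vector of
    [k] such values lies in so small a cube with probability [r^(- c k n)] at
    most ([small_ball], [upper_tail]).

    Lower bound. Under the same covariance bound the signs of the process
    alternate at [n + 1] equally spaced points with probability at least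
    [r^(- c n^2)] ([alternating_signs]), and then there are [n] zeros by the
    intermediate value theorem ([lower_tail]).

    Probabilities of boxes are computed without densities: a linear change of
    variables makes the coordinates standard and uncorrelated, and the
    expectation of a product of Gaussian bumps is read off from the
    characteristic function ([bump_product]).

    Moments. For [n >= C T] the upper bound gives a Gaussian tail
    [exp (- c n^2)] with [c] depending on [mu] only, and the sum over the
    levels of [zero_count] yields the growth [max T (sqrt m)]
    ([moment_growth]). *)

Set Implicit Arguments.
Unset Strict Implicit.
Unset Printing Implicit Defensive.

(** * Divided differences *)

Section DividedDifferences.
Context {F : fieldType}.
Implicit Types (s u : seq F) (f g : F -> F) (a y : F).

(** Lagrange's symmetric form of the divided difference, at pairwise distinct
    nodes. *)
Definition divdiff s f : F :=
  \sum_(y <- s) f y / \prod_(z <- s | z != y) (y - z).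

Lemma eq_divdiff s f g : {in s, f =1 g} -> divdiff s f = divdiff s g.
Proof. by move=> fg; apply: eq_big_seq => y /fg ->. Qed.

Lemma perm_divdiff s t f : perm_eq s t -> divdiff s f = divdiff t f.
Proof.
move=> st; rewrite /divdiff (perm_big _ st).
by apply: eq_bigr => y _; rewrite (perm_big _ st).
Qed.

Lemma divdiffD s f g :
  divdiff s (fun y => f y + g y) = divdiff s f + divdiff s g.
Proof. by rewrite /divdiff -big_split; apply: eq_bigr => y _; rewrite mulrDl. Qed.

Lemma divdiffZ s a f : divdiff s (fun y => a * f y) = a * divdiff s f.
Proof. by rewrite /divdiff mulr_sumr; apply: eq_bigr => y _; rewrite mulrA. Qed.

Lemma divdiff_sum (I : Type) (r : seq I) (P : pred I) s (f : I -> F -> F) :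
  divdiff s (fun y => \sum_(i <- r | P i) f i y) =
  \sum_(i <- r | P i) divdiff s (f i).
Proof.
rewrite /divdiff exchange_big; apply: eq_bigr => y _.
by rewrite mulr_suml.
Qed.

Lemma divdiff_mull s f a : uniq s -> a \in s ->
  divdiff s (fun y => (y - a) * f y) = divdiff (rem a s) f.
Proof.
move=> us sa; rewrite /divdiff (perm_big _ (perm_to_rem sa)) big_cons /= subrr.
rewrite !mul0r add0r; apply: eq_big_seq => y yr.
have ya : y != a by apply: contraTneq yr => ->; rewrite mem_rem_uniq// inE eqxx.
rewrite (perm_big _ (perm_to_rem sa)) big_cons /= eq_sym ya.
have d0 : y - a != 0 by rewrite subr_eq0.
by rewrite invfM [X in X * _]mulrC -mulrA mulVKf.
Qed.

(** The Leibniz rule for multiplication by a linear factor. *)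
Lemma divdiff_linear s f a b : uniq s -> a \in s ->
  divdiff s (fun y => (y - b) * f y) =
  divdiff (rem a s) f + (a - b) * divdiff s f.
Proof.
move=> us sa; rewrite -divdiff_mull// -divdiffZ -divdiffD.
by apply: eq_divdiff => y _; rewrite -mulrDl addrA subrK.
Qed.

Lemma divdiff_cst s : uniq s -> (1 < size s)%N -> divdiff s (fun=> 1) = 0.
Proof.
have [n] := ubnP (size s); elim: n s => // n IHn [|y [|z s]] // sn us _.
have /andP[/= yzs zs] := us; rewrite inE negb_or in yzs.
have {yzs}[yz ys] := andP yzs.
have zy : z - y != 0 by rewrite subr_eq0 eq_sym.
apply: (mulfI zy); rewrite mulr0 -divdiffZ.
rewrite (@eq_divdiff _ _ (fun x => (x - y) * 1 + (- 1) * ((x - z) * 1))); last first.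
  by move=> x _; ring.
rewrite divdiffD divdiffZ !divdiff_mull ?inE ?eqxx ?orbT//= eqxx.
rewrite (negbTE yz) eqxx.
case: s sn us ys zs => [|w s] sn us ys zs.
  by rewrite /divdiff !big_seq1 !big_cons !big_nil !eqxx; ring.
rewrite !IHn// ?mulr0 ?addr0//.
by rewrite cons_uniq ys; case/andP: zs.
Qed.

End DividedDifferences.

Section DividedDifferenceBound.
Context {R : realFieldType}.

(** Induction on the factors: by the Leibniz rule each of them either removes a
    node or contributes at most [T], and the two cases add up by Pascal's
    rule. *)
Lemma normr_divdiff_prod (T : R) (s u : seq R) n :
    uniq s -> size s = n.+1 ->
    {in s, forall y, 0 <= y <= T} -> {in u, forall y, 0 <= y <= T} ->
  `|divdiff s (fun y => \prod_(a <- u) (y - a))|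
    <= 'C(size u, n)%:R * T ^+ (size u - n).
Proof.
elim: u s n => [|b u IHu] s n us ss sT uT.
  case: s ss us sT => // y [|z s] [<-] us sT /=.
    by rewrite /divdiff big_seq1 big_nil big_cons big_nil eqxx invr1 mulr1 normr1.
  rewrite (_ : divdiff _ _ = divdiff [:: y, z & s] (fun=> 1)).
    by rewrite divdiff_cst// normr0 bin_small// mul0r.
  by apply: eq_divdiff => x _; rewrite big_nil.
have T0 : 0 <= T by have /andP[] := uT b (mem_head _ _); apply: le_trans.
case: s ss us sT => // y s [ss] us sT.
have yT := sT y (mem_head _ _); have bT := uT b (mem_head _ _).
have uT' : {in u, forall y, 0 <= y <= T} by move=> x xu; apply: uT; rewrite inE xu orbT.
have -> : divdiff (y :: s) (fun y0 => \prod_(a <- b :: u) (y0 - a)) =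
   divdiff (y :: s) (fun y0 => (y0 - b) * \prod_(a <- u) (y0 - a)).
  by apply: eq_divdiff => x _; rewrite big_cons.
rewrite (@divdiff_linear _ _ _ y) ?mem_head//= eqxx.
have h1 := IHu _ _ us (congr1 S ss) sT uT'.
have yb : `|y - b| <= T by rewrite ler_norml; apply/andP; split; lra.
have h2 : `|(y - b) * divdiff (y :: s) (fun y0 => \prod_(a <- u) (y0 - a))| <=
    T * ('C(size u, n)%:R * T ^+ (size u - n)) by rewrite normrM ler_pM.
case: n ss h1 h2 => [|n] ss h1 h2.
  rewrite (size0nil ss) in h2 *.
  rewrite {1}/divdiff big_nil add0r bin0 subn0 mul1r exprS.
  by rewrite bin0 subn0 mul1r in h2.
have us' : uniq s by case/andP: us.
have sT' : {in s, forall y, 0 <= y <= T} by move=> x xu; apply: sT; rewrite inE xu orbT.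
have h3 := IHu _ _ us' ss sT' uT'.
apply: (le_trans (ler_normD _ _)).
apply: (le_trans (lerD h3 h2)).
rewrite binS natrD mulrDl addrC subSS lerD2r.
have [un|un] := ltnP n (size u); last by rewrite bin_small// !mul0r mulr0.
by rewrite mulrCA -exprS -subSn.
Qed.

End DividedDifferenceBound.

(** * Newton interpolation at a dense sequence of nodes *)

Section NewtonInterpolation.
Context {R : realType}.
Implicit Types (tau : nat -> R) (f : R -> R).

Definition newton_coef tau f j : R := divdiff (mkseq tau j.+1) f.

Definition newton_basis tau j (x : R) : R := \prod_(a <- mkseq tau j) (x - a).

Lemma newton_remainder tau f m x : injective tau -> x \notin mkseq tau m ->
  f x = \sum_(j < m) newton_coef tau f j * newton_basis tau j x
        + newton_basis tau m x * divdiff (x :: mkseq tau m) f.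
Proof.
move=> ti; elim: m => [|m IHm] xm.
  rewrite big_ord0 /newton_basis big_nil /divdiff big_seq1.
  by rewrite big_cons eqxx /= big_nil divr1 add0r mul1r.
move: xm; rewrite mkseqS mem_rcons inE negb_or => /andP[xtm xm].
rewrite (IHm xm) big_ord_recr /= -addrA; congr (_ + _).
set s := x :: rcons (mkseq tau m) (tau m).
have us : uniq s by rewrite /s -mkseqS cons_uniq mkseqS mem_rcons inE negb_or xtm xm -mkseqS mkseq_uniq.
have tms : tau m \in s by rewrite /s inE mem_rcons mem_head orbT.
have /eqP := divdiff_linear f (tau m) us (mem_head x _).
rewrite divdiff_mull//= eqxx.
have -> : divdiff (if x == tau m then rcons (mkseq tau m) (tau m)
      else x :: rem (tau m) (rcons (mkseq tau m) (tau m))) f =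
   divdiff (x :: mkseq tau m) f.
  rewrite (negbTE xtm); apply: perm_divdiff; rewrite perm_cons.
  rewrite -(perm_cons (tau m)) -perm_rcons perm_sym -perm_rcons perm_sym.
  by rewrite perm_rcons perm_sym perm_to_rem// mem_rcons mem_head.
move=> /eqP ->; rewrite /newton_coef /newton_basis mkseqS big_rcons /=.
by ring.
Qed.

Lemma newton_interp tau f i m : injective tau -> (i < m)%N ->
  f (tau i) = \sum_(j < m) newton_coef tau f j * newton_basis tau j (tau i).
Proof.
move=> ti; elim: m => // m IHm; rewrite ltnS leq_eqVlt => /orP[/eqP ->|im].
  rewrite big_ord_recr /= {1}(@newton_remainder tau f m)//; last first.
    apply/negP => /mapP[k]; rewrite mem_iota add0n /= => km /ti mk.
    by rewrite mk ltnn in km.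
  congr (_ + _); rewrite mulrC /newton_coef; congr (_ * _).
  by apply: perm_divdiff; rewrite mkseqS perm_sym perm_rcons.
rewrite big_ord_recr /= -IHm//.
suff -> : newton_basis tau m (tau i) = 0 by rewrite mulr0 addr0.
apply/eqP; rewrite /newton_basis prodf_seq_eq0; apply/hasP; exists (tau i).
  by apply/mapP; exists i => //; rewrite mem_iota.
by rewrite /= subrr.
Qed.

Lemma series_exp_coeff_le (x : R) m : 0 <= x -> series (exp_coeff x) m <= expR x.
Proof.
move=> x0; apply: (nondecreasing_cvgn_le _ (is_cvg_series_exp_coeff x)).
apply/nondecreasing_seqP => k; rewrite /series /= big_nat_recr//= lerDl.
exact: exp_coeff_ge0.
Qed.

(** The binomial coefficient cancels against the factorial and leaves the
    exponential series of [B * T]. *)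
Lemma sum_bin_exp_le (B T : R) n m : 0 <= B -> 0 <= T ->
  \sum_(n <= j < m) B ^+ j / j`!%:R * ('C(j, n)%:R * T ^+ (j - n)%N) <=
  B ^+ n / n`!%:R * expR (B * T).
Proof.
move=> B0 T0; have BT0 : 0 <= B * T by rewrite mulr_ge0.
apply: (@le_trans _ _ (B ^+ n / n`!%:R * series (exp_coeff (B * T)) (m - n)%N)).
  rewrite /series /= mulr_sumr -{1}(add0n n) big_addn.
  apply: ler_sum_nat => j _; rewrite addnK /exp_coeff /=.
  have := bin_fact (leq_addl j n); rewrite addnK => /(congr1 (fun k => k%:R : R)).
  rewrite !natrM => binE.
  have nf : n`!%:R != 0 :> R by rewrite pnatr_eq0 -lt0n fact_gt0.
  have jf : j`!%:R != 0 :> R by rewrite pnatr_eq0 -lt0n fact_gt0.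
  have njf : (j + n)`!%:R != 0 :> R by rewrite pnatr_eq0 -lt0n fact_gt0.
  rewrite le_eqVlt; apply/orP; left; apply/eqP.
  rewrite exprD exprMn.
  have -> : 'C(j + n, n)%:R = (j + n)`!%:R / (n`!%:R * j`!%:R) :> R.
    by rewrite -binE; field; rewrite nf jf.
  by field; rewrite nf jf njf.
by rewrite ler_wpM2l ?series_exp_coeff_le// mulr_ge0 ?exprn_ge0.
Qed.

Lemma dist_itv_le (T x y : R) : 0 <= x <= T -> 0 <= y <= T -> `|x - y| <= T.
Proof.
by move=> /andP[? ?] /andP[? ?]; rewrite ler_norml; apply/andP; split; lra.
Qed.

Lemma normr_newton_basis (tau : nat -> R) (T x : R) j :
  (forall i, 0 <= tau i <= T) -> 0 <= x <= T -> `|newton_basis tau j x| <= T ^+ j.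
Proof.
move=> tT xT; rewrite /newton_basis.
elim: j => [|j IHj]; first by rewrite big_nil normr1 expr0.
by rewrite mkseqS big_rcons /= normrM exprSr; apply: ler_pM => //; exact: dist_itv_le.
Qed.

Lemma continuous_newton_basis tau j : continuous (newton_basis tau j).
Proof.
elim: j => [|j IHj] x.
  rewrite (_ : newton_basis tau 0 = cst 1); first exact: cvg_cst.
  by apply/funext => y; rewrite /newton_basis big_nil.
rewrite (_ : newton_basis tau j.+1 = fun y => newton_basis tau j y * (y - tau j)).
  apply: cvgM; first exact: IHj.
  by apply: cvgB; [exact: cvg_id|exact: cvg_cst].
by apply/funext => y; rewrite /newton_basis mkseqS big_rcons /= mulrC.
Qed.

(** The interpolation polynomials of degree [m] at a dense sequence of nodes
    agree with [f] at the nodes of index below [m]; the decay of the Newton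
    coefficients makes them a Cauchy sequence for the uniform norm, so that
    they converge to [f] at every point by continuity. *)
Lemma newton_approx tau f (T B K x : R) n m : injective tau -> continuous f ->
    (forall i, 0 <= tau i <= T) ->
    (forall y e : R, 0 <= y <= T -> 0 < e -> exists i, `|y - tau i| < e) ->
    0 <= B -> 0 <= K ->
    (forall j, (n <= j)%N -> `|newton_coef tau f j| <= K * (B ^+ j / j`!%:R)) ->
    (n <= m)%N -> 0 <= x <= T ->
  `|f x - \sum_(j < m) newton_coef tau f j * newton_basis tau j x|
    <= K * (expR (B * T) - series (exp_coeff (B * T)) m).
Proof.
move=> ti cf tT td B0 K0 xiK nm xT.
have T0 : 0 <= T by case/andP: (tT 0%N); apply: le_trans.
set Q := fun y => \sum_(j < m) newton_coef tau f j * newton_basis tau j y.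
have cQ : continuous Q.
  rewrite /Q; elim: {nm}m {Q} => [|k IHk].
    rewrite (_ : (fun _ => _) = cst 0); first exact: cst_continuous.
    by apply/funext => z; rewrite big_ord0.
  rewrite (_ : (fun _ => _) = fun y => \sum_(j < k) newton_coef tau f j * newton_basis tau j y
     + newton_coef tau f k * newton_basis tau k y).
    move=> y; apply: cvgD; first exact: IHk.
    apply: cvgM; first exact: cvg_cst.
    exact: continuous_newton_basis.
  by apply/funext => z; rewrite big_ord_recr.
rewrite -/(Q x).
have node i : `|f (tau i) - Q (tau i)| <=
    K * (expR (B * T) - series (exp_coeff (B * T)) m).
  rewrite (newton_interp f (m := maxn i.+1 m) ti) ?leq_max ?ltnSn//.
  set M := maxn i.+1 m; have mM : (m <= M)%N by rewrite leq_maxr.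
  have -> : \sum_(j < M) newton_coef tau f j * newton_basis tau j (tau i) - Q (tau i)
     = \sum_(m <= j < M) newton_coef tau f j * newton_basis tau j (tau i).
    rewrite /Q -(big_mkord xpredT (fun j => newton_coef tau f j * newton_basis tau j (tau i))).
    rewrite -(big_mkord xpredT (fun j => newton_coef tau f j * newton_basis tau j (tau i))).
    by rewrite (big_cat_nat (leq0n m) mM)//= addrAC subrr add0r.
  apply: (le_trans (ler_norm_sum _ _ _)).
  apply: (@le_trans _ _ (K * \sum_(m <= j < M) exp_coeff (B * T) j)); last first.
    rewrite ler_wpM2l// lerBrDl.
    have -> : series (exp_coeff (B * T)) m + \sum_(m <= j < M) exp_coeff (B * T) j
       = series (exp_coeff (B * T)) M by rewrite /series /= (big_cat_nat (leq0n m) mM).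
    by rewrite series_exp_coeff_le// mulr_ge0.
  rewrite mulr_sumr; apply: ler_sum_nat => j /andP[mj _].
  rewrite normrM /exp_coeff /= exprMn mulrAC mulrA.
  by rewrite ler_pM// ?xiK ?(leq_trans nm)// normr_newton_basis.
apply/ler_addgt0Pr => e e0.
have cg : continuous (fun y => f y - Q y).
  by move=> y; apply: cvgB; [exact: cf|exact: cQ].
have /cvgrPdist_lt /(_ _ e0) /nbhs_ballP[d /= d0 dP] := cg x.
have [i xi] := td x d xT d0.
have /= h := dP (tau i) xi.
rewrite -[f x - Q x](subrK (f (tau i) - Q (tau i))).
by rewrite addrC (le_trans (ler_normD _ _))// lerD ?node// ltW.
Qed.

(** With [n] zeros in [[0, T]], the value of [f] at a further point is a divided
    difference of order [n], which the Newton series controls. *)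
Lemma small_of_zeros tau f (T B K : R) n (z : seq R) (t : R) : injective tau -> continuous f ->
    (forall i, 0 <= tau i <= T) ->
    (forall y e : R, 0 <= y <= T -> 0 < e -> exists i, `|y - tau i| < e) ->
    0 <= B -> 0 <= K ->
    (forall j, (n <= j)%N -> `|newton_coef tau f j| <= K * (B ^+ j / j`!%:R)) ->
    uniq z -> size z = n -> {in z, forall y, 0 <= y <= T /\ f y = 0} ->
    0 <= t <= T ->
  `|f t| <= K * (T ^+ n * (B ^+ n / n`!%:R * expR (B * T))).
Proof.
move=> ti cf tT td B0 K0 xiK uz sz zz tT'.
have T0 : 0 <= T by case/andP: (tT 0%N); apply: le_trans.
have [/zz[_ ->]|tz] := boolP (t \in z).
  by rewrite normr0 !mulr_ge0 ?expR_ge0 ?exprn_ge0// invr_ge0.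
have us : uniq (t :: z) by rewrite /= tz uz.
have sT : {in t :: z, forall y, 0 <= y <= T}.
  by move=> y; rewrite inE => /orP[/eqP ->//|/zz[]].
pose Q m y := \sum_(j < m) newton_coef tau f j * newton_basis tau j y.
pose r m := expR (B * T) - series (exp_coeff (B * T)) m.
pose W := \sum_(y <- t :: z) `|\prod_(w <- t :: z | w != y) (y - w)|^-1.
have W0 : 0 <= W by rewrite sumr_ge0.
have key m : (n <= m)%N ->
    `|f t| <= T ^+ n * (K * (B ^+ n / n`!%:R * expR (B * T)) + (K * W) * r m).
  move=> nm.
  have -> : f t = \prod_(w <- z) (t - w) * divdiff (t :: z) f.
    rewrite /divdiff big_cons [X in _ + X]big1_seq; last first.
      by move=> y /andP[_ /zz[_ ->]]; rewrite mul0r.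
    rewrite addr0 big_cons eqxx mulrC.
    rewrite (_ : \prod_(j <- z | j != t) (t - j) = \prod_(w <- z) (t - w)).
      rewrite divfK// prodf_seq_neq0; apply/allP => w wz /=.
      by rewrite subr_eq0; apply: contraNneq tz => ->.
    rewrite big_seq_cond [RHS]big_seq; apply: eq_bigl => w.
    by rewrite andb_idr//; apply: contraTneq => ->.
  rewrite normrM ler_pM//.
    rewrite -sz; elim: z {uz sz us W W0 sT} zz tz => [|y z IHz] zz tz.
      by rewrite big_nil normr1 expr0.
    rewrite big_cons normrM exprS ler_pM//.
      have [yT _] := zz y (mem_head y z).
      by rewrite dist_itv_le.
    apply: IHz; first by move=> w wz; apply: zz; rewrite inE wz orbT.
    by move: tz; rewrite inE negb_or => /andP[].
  have -> : divdiff (t :: z) f = divdiff (t :: z) (Q m) + divdiff (t :: z) (fun y => f y - Q m y).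
    by rewrite -divdiffD; apply: eq_divdiff => y _; ring.
  rewrite (le_trans (ler_normD _ _))// lerD//.
    rewrite /Q divdiff_sum (le_trans (ler_norm_sum _ _ _))//.
    apply: (le_trans _ (ler_wpM2l K0 (sum_bin_exp_le n m B0 T0))).
    rewrite mulr_sumr.
    rewrite -(big_mkord xpredT (fun j => `|divdiff (t :: z) (fun y => newton_coef tau f j * newton_basis tau j y)|)).
    rewrite (big_cat_nat (leq0n n) nm)//= big_nat_cond big1 ?add0r; last first.
      move=> j /andP[/andP[_ jn] _]; rewrite divdiffZ.
      have := @normr_divdiff_prod _ T (t :: z) (mkseq tau j) n us (congr1 S sz) sT.
      rewrite size_mkseq bin_small// mul0r => h.
      rewrite (_ : divdiff _ (newton_basis tau j) = 0) ?mulr0 ?normr0//.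
      apply/eqP; rewrite -normr_le0; apply: h.
      by move=> y /mapP[i _ ->].
    apply: ler_sum_nat => j /andP[nj _].
    rewrite divdiffZ normrM [leRHS]mulrA; apply: ler_pM => //; first exact: xiK.
    have := @normr_divdiff_prod _ T (t :: z) (mkseq tau j) n us (congr1 S sz) sT.
    by rewrite size_mkseq; apply => y /mapP[i _ ->].
  rewrite /divdiff (le_trans (ler_norm_sum _ _ _))//.
  rewrite mulrAC /W mulr_sumr big_seq [leRHS]big_seq; apply: ler_sum => y ys.
  rewrite normrM normfV ler_wpM2r ?invr_ge0//.
  exact: (newton_approx ti cf tT td B0 K0 xiK nm (sT _ ys)).
have rc : r m @[m --> \oo] --> 0.
  rewrite -(subrr (expR (B * T))); apply: cvgB; first exact: cvg_cst.
  exact: is_cvg_series_exp_coeff.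
have : T ^+ n * (K * (B ^+ n / n`!%:R * expR (B * T)) + (K * W) * r m) @[m --> \oo] -->
   T ^+ n * (K * (B ^+ n / n`!%:R * expR (B * T)) + (K * W) * 0).
  apply: cvgM; first exact: cvg_cst.
  apply: cvgD; first exact: cvg_cst.
  by apply: cvgM => //; exact: cvg_cst.
rewrite mulr0 addr0 => h.
rewrite mulrCA -(cvg_lim (@Rhausdorff R) h).
apply: limr_ge; first exact: cvgP h.
by exists n => // m /= nm; exact: key.
Qed.

End NewtonInterpolation.

(** * Divided differences of cosines and sines *)

Section TrigonometricDividedDifferences.
Context {R : realType}.

Lemma divdiff_monomial (T : R) (s : seq R) n l : 0 <= T ->
    uniq s -> size s = n.+1 -> {in s, forall y, 0 <= y <= T} ->
  `|divdiff s (fun y => y ^+ l)| <= 'C(l, n)%:R * T ^+ (l - n)%N.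
Proof.
move=> T0 us ss sT.
have := @normr_divdiff_prod _ T s (nseq l 0) n us ss sT; rewrite size_nseq.
rewrite (_ : divdiff s (fun y => \prod_(a <- nseq l 0) (y - a)) = divdiff s (fun y => y ^+ l)).
  by apply => y; rewrite mem_nseq => /andP[_ /eqP ->]; rewrite lexx.
by apply: eq_divdiff => y _; rewrite big_nseq subr0 iter_mulr_1.
Qed.

(** Entire functions of exponential type have divided differences that decay
    like the Taylor coefficients of the exponential. *)
Lemma divdiff_exp_type (T B : R) (s : seq R) n (c : nat -> R) (g : R -> R) :
    0 <= T -> 0 <= B -> uniq s -> size s = n.+1 ->
    {in s, forall y, 0 <= y <= T} ->
    (forall l, `|c l| <= B ^+ l / l`!%:R) ->
    (forall y, (\sum_(0 <= l < k) c l * y ^+ l) @[k --> \oo] --> g y) ->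
  `|divdiff s g| <= B ^+ n / n`!%:R * expR (B * T).
Proof.
move=> T0 B0 us ss sT cB cg.
have key k : (n <= k)%N -> `|divdiff s (fun y => \sum_(0 <= l < k) c l * y ^+ l)|
    <= B ^+ n / n`!%:R * expR (B * T).
  move=> nk; rewrite divdiff_sum (le_trans (ler_norm_sum _ _ _))//.
  apply: (le_trans _ (sum_bin_exp_le n k B0 T0)).
  rewrite (big_cat_nat (leq0n n) nk)//= big_nat_cond big1 ?add0r; last first.
    move=> l /andP[/andP[_ ln] _]; rewrite divdiffZ.
    have := divdiff_monomial l T0 us ss sT.
    by rewrite bin_small// mul0r normr_le0 => /eqP ->; rewrite mulr0 normr0.
  apply: ler_sum_nat => l /andP[nl _].
  by rewrite divdiffZ normrM ler_pM// divdiff_monomial.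
have h : divdiff s (fun y => \sum_(0 <= l < k) c l * y ^+ l) @[k --> \oo] --> divdiff s g.
  rewrite /divdiff; elim: {1 3}s => [|y r IHr].
    rewrite big_nil (_ : (fun _ => _) = cst 0); first exact: cvg_cst.
    by apply/funext => k; rewrite big_nil.
  rewrite big_cons; under eq_fun do rewrite big_cons.
  by apply: cvgD => //; apply: cvgM => //; exact: cvg_cst.
have {}h : `|divdiff s (fun y => \sum_(0 <= l < k) c l * y ^+ l)| @[k --> \oo] --> `|divdiff s g| by exact: cvg_norm.
rewrite -(cvg_lim (@Rhausdorff R) h).
apply: limr_le; first exact: cvgP h.
by exists n => // k /= nk; exact: key.
Qed.

Lemma divdiff_cos (T x : R) (s : seq R) n : 0 <= T -> uniq s -> size s = n.+1 ->
    {in s, forall y, 0 <= y <= T} ->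
  `|divdiff s (fun y => cos (y * x))| <= `|x| ^+ n / n`!%:R * expR (`|x| * T).
Proof.
move=> T0 us ss sT.
apply: (@divdiff_exp_type _ _ _ _ (cos_coeff x) _ T0 _ us ss sT) => //.
  move=> l; rewrite /cos_coeff /= !normrM !normrX normfV normrN1 expr1n.
  by case: (~~ odd l); rewrite ?normr0 ?normr1 ?mul1r ?mul0r ?normr_nat// mulr_ge0.
move=> y; have := @is_cvg_series_cos_coeff R (y * x); rewrite cos.unlock.
suff -> : (fun k => \sum_(0 <= l < k) cos_coeff x l * y ^+ l) = series (cos_coeff (y * x)) by [].
apply/funext => k; apply: eq_bigr => l _; rewrite /cos_coeff /= exprMn.
by ring.
Qed.

Lemma divdiff_sin (T x : R) (s : seq R) n : 0 <= T -> uniq s -> size s = n.+1 ->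
    {in s, forall y, 0 <= y <= T} ->
  `|divdiff s (fun y => sin (y * x))| <= `|x| ^+ n / n`!%:R * expR (`|x| * T).
Proof.
move=> T0 us ss sT.
apply: (@divdiff_exp_type _ _ _ _ (sin_coeff x) _ T0 _ us ss sT) => //.
  move=> l; rewrite /sin_coeff /= !normrM !normrX normfV normrN1 expr1n.
  by case: (odd l); rewrite ?normr0 ?normr1 ?mul1r ?mul0r ?normr_nat// mulr_ge0.
move=> y; have := @is_cvg_series_sin_coeff R (y * x); rewrite sin.unlock.
suff -> : (fun k => \sum_(0 <= l < k) sin_coeff x l * y ^+ l) = series (sin_coeff (y * x)) by [].
apply/funext => k; apply: eq_bigr => l _; rewrite /sin_coeff /= exprMn.
by ring.
Qed.

End TrigonometricDividedDifferences.

(** * Gaussian integrals *)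

Section GaussianIntegrals.
Context {R : realType}.
Notation leb := (@lebesgue_measure R).

(** Cutting off at height [k] and the fundamental theorem of calculus on
    [[-k, k]]. *)
Lemma integral_derivative_eq0 (g h : R -> R) :
    (forall x : R, is_derive x 1 g (h x)) -> continuous h ->
    leb.-integrable setT (EFin \o h) ->
    (g k%:R @[k --> \oo] --> 0) -> (g (- k%:R) @[k --> \oo] --> 0) ->
  \int[leb]_x h x = 0.
Proof.
move=> gh ch ih g0 g0'.
pose F k x := (h x * \1_(`[- (k.+1)%:R, (k.+1)%:R]%classic : set R) x)%:E.
have mh : measurable_fun setT h by exact: continuous_measurable_fun.
have mF k : measurable_fun setT (F k).
  by apply/measurable_EFinP/measurable_funM => //; exact: measurable_indic.
have [] := @dominated_convergence _ _ _ leb setT measurableT F (EFin \o h) (EFin \o (fun x => `|h x|)).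
- exact: mF.
- exact/measurable_EFinP.
- apply: aeW => x _.
  apply: cvg_near_cst.
  exists (Num.truncn `|x|) => // k /= xk.
  rewrite /F indicE mem_set ?mulr1//= in_itv /= -ler_norml.
  apply: ltW; apply: (lt_le_trans (truncnS_gt _)).
  by rewrite ler_nat ltnS.
- by apply: integrable_norm.
- apply: aeW => x k _; rewrite /F /= lee_fin normrM.
  rewrite ler_piMr// indicE; case: (_ \in _); by rewrite ?normr0 ?normr1.
move=> _ _.
have -> : [sequence (\int[leb]_x F k x)%E]_k = fun k => ((g k.+1%:R - g (- k.+1%:R))%:E).
  apply/funext => k /=.
  rewrite /F.
  have -> : (\int[leb]_x (h x * \1_`[(- k.+1%:R)%R, k.+1%:R] x)%:E)%E =
     (\int[leb]_(x in `[(- k.+1%:R)%R, k.+1%:R]) (h x)%:E)%E.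
    rewrite [RHS]integral_mkcond; apply: eq_integral => x _.
    by rewrite patchE indicE; case: ifP => _; rewrite ?mulr1 ?mulr0.
  rewrite (@continuous_FTC2 _ h g)//.
  - by rewrite -subr_gt0 opprK addr_gt0.
  - exact: continuous_subspaceT.
  - have cg : continuous g.
      by move=> x; apply: differentiable_continuous; apply/derivable1_diffP; have [] := gh x.
    split.
    + by move=> x _; have [] := gh x.
    + by apply: cvg_at_right_filter; exact: cg.
    + by apply: cvg_at_left_filter; exact: cg.
  - by move=> x _; rewrite derive1E; have := @derive_val _ _ _ _ _ _ _ (gh x).
move=> hc.
have hc0 : (g k.+1%:R - g (- k.+1%:R))%:E @[k --> \oo] --> 0%:E.
  apply: cvg_EFin; first exact: nearW.
  rewrite -[in X in _ --> X](subr0 0); apply: cvgB.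
    by have := g0; rewrite -(cvg_shiftn 1); under eq_fun do rewrite addn1.
  by have := g0'; rewrite -(cvg_shiftn 1); under eq_fun do rewrite addn1.
by rewrite /Rintegral (cvg_unique _ hc hc0).
Qed.

Variables (m s : R).
Hypothesis s0 : s != 0.
Let p := normal_pdf m s.

Let pE x : p x = normal_peak s * expR (- (x - m) ^+ 2 / (s ^+ 2 *+ 2)).
Proof. by rewrite /p normal_pdfE. Qed.

Lemma is_derive_normal_pdf (x : R) : is_derive x 1 (normal_pdf m s) (- (x - m) / s ^+ 2 * normal_pdf m s x).
Proof.
have -> : normal_pdf m s = fun x => normal_peak s * expR (- (x - m) ^+ 2 / (s ^+ 2 *+ 2)).
  by apply/funext => y; exact: pE.
have h : is_derive x 1 (fun x : R => - (x - m) ^+ 2 / (s ^+ 2 *+ 2)) (- (x - m) / s ^+ 2).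
  apply: is_derive_eq; rewrite /= !scaler0 !add0r /GRing.scale /=.
  by rewrite -[_ *+ 2]mulr_natl; field.
have h2 := @is_derive1_comp R expR _ x _ _ (is_derive_expR _) h.
have h3 : is_derive x 1 (fun x : R => normal_peak s * expR (- (x - m) ^+ 2 / (s ^+ 2 *+ 2)))
    (normal_peak s * (expR (- (x - m) ^+ 2 / (s ^+ 2 *+ 2)) * (- (x - m) / s ^+ 2))).
  exact: (is_deriveZ (normal_peak s) h2).
by apply: is_derive_eq; ring.
Qed.

(** Doubling the standard deviation absorbs a quadratic factor. *)
Lemma normal_pdf_poly_le : exists2 C : R, 0 <= C &
  forall x, (1 + (x - m) ^+ 2) * normal_pdf m s x <= C * normal_pdf m (2 * s) x.
Proof.
have s20 : 2 * s != 0 by rewrite mulf_neq0.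
have s2 : 0 < s ^+ 2 by rewrite exprn_even_gt0.
exists ((1 + 8 / 3 * s ^+ 2) * (normal_peak s / normal_peak (2 * s))).
  by apply: mulr_ge0; [nra|rewrite divr_ge0 ?normal_peak_ge0].
move=> x; rewrite !normal_pdfE// /normal_fun.
set y := (x - m) ^+ 2; have y0 : 0 <= y by rewrite sqr_ge0.
have p20 : normal_peak (2 * s) != 0 by rewrite gt_eqF// normal_peak_gt0.
set u := 3 * y / (8 * s ^+ 2).
have u0 : 0 <= u by rewrite /u; apply: divr_ge0; nra.
have -> : expR (- y / (s ^+ 2 *+ 2)) = expR (- u) * expR (- y / ((2 * s) ^+ 2 *+ 2)).
  by rewrite -expRD; congr expR; rewrite /u; field.
have -> : (1 + 8 / 3 * s ^+ 2) * (normal_peak s / normal_peak (2 * s)) *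
   (normal_peak (2 * s) * expR (- y / ((2 * s) ^+ 2 *+ 2))) =
   normal_peak s * ((1 + 8 / 3 * s ^+ 2) * expR (- y / ((2 * s) ^+ 2 *+ 2))).
  by field.
rewrite mulrCA ler_wpM2l ?normal_peak_ge0// mulrA ler_wpM2r ?expR_ge0//.
have -> : y = 8 / 3 * s ^+ 2 * u by rewrite /u; field.
have h1 : expR (- u) <= 1 by rewrite -expR0 ler_expR oppr_le0.
have h2 : u * expR (- u) <= 1.
  rewrite expRN ler_pdivrMr ?expR_gt0// mul1r (le_trans _ (expR_ge1Dx u))//.
  by rewrite lerDr.
by have := ltW s2; nra.
Qed.

Lemma integrable_mul_normal_pdf (h : R -> R) K : 0 <= K -> continuous h ->
    (forall x, `|h x| <= K * (1 + (x - m) ^+ 2)) ->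
  leb.-integrable setT (EFin \o (fun x => h x * normal_pdf m s x)).
Proof.
move=> K0 ch hx; have [C C0 hC] := normal_pdf_poly_le.
apply: (@le_integrable _ _ _ leb setT measurableT _ (fun x => (K * C * normal_pdf m (2 * s) x)%:E)).
- apply/measurable_EFinP/measurable_funM; first exact: continuous_measurable_fun.
  exact: measurable_normal_pdf.
- move=> x _ /=; rewrite lee_fin normrM (ger0_norm (normal_pdf_ge0 _ _ _)).
  apply: (@le_trans _ _ (K * (1 + (x - m) ^+ 2) * normal_pdf m s x)).
    by rewrite ler_wpM2r ?normal_pdf_ge0.
  rewrite -mulrA; apply: (le_trans (ler_wpM2l K0 (hC x))).
  by rewrite mulrA; exact: ler_norm.
- by apply: (@integrableZl _ _ _ leb setT measurableT (K * C) (fun x => (normal_pdf m (2 * s) x)%:E));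
    exact: integrable_normal_pdf.
Qed.

End GaussianIntegrals.

Section GaussianMoments.
Context {R : realType}.
Notation leb := (@lebesgue_measure R).
Variables (m s : R).
Hypothesis s0 : s != 0.

(** The boolean [e] selects the end of the line. *)
Lemma normal_pdf_decay (h : R -> R) K (e : bool) : 0 <= K ->
    (forall x, `|h x| <= K * (1 + (x - m) ^+ 2)) ->
  h ((-1) ^+ e * k%:R) * normal_pdf m s ((-1) ^+ e * k%:R) @[k --> \oo] --> 0.
Proof.
move=> K0 hh; have [C C0 hC] := normal_pdf_poly_le m s0.
have s20 : 2 * s != 0 by rewrite mulf_neq0.
have [D D0 hD] := normal_pdf_poly_le m s20.
set M := normal_peak (2 * (2 * s)).
have M0 : 0 <= M by rewrite normal_peak_ge0.
apply/cvgr0Pnorm_le.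
have hz : (K * C * D * M * (2 * (1 + m ^+ 2))) * harmonic k @[k --> \oo] --> (0 : R).
  rewrite -[in X in _ --> X](mulr0 (K * C * D * M * (2 * (1 + m ^+ 2)))).
  by apply: cvgM; [exact: cvg_cst|exact: cvg_harmonic].
move=> eps eps0; have /cvgr0_norm_le/(_ _ eps0) := hz.
apply: filterS => k /=; apply: le_trans.
set x := (-1) ^+ e * k%:R.
rewrite (@ger0_norm _ (_ * _ * harmonic k)); last first.
  by rewrite !mulr_ge0 ?addr_ge0 ?sqr_ge0 ?invr_ge0.
rewrite normrM (ger0_norm (normal_pdf_ge0 _ _ _)).
apply: (@le_trans _ _ (K * (1 + (x - m) ^+ 2) * normal_pdf m s x)).
  by rewrite ler_wpM2r ?normal_pdf_ge0.
rewrite -mulrA; apply: (le_trans (ler_wpM2l K0 (hC x))).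
rewrite -!mulrA !ler_wpM2l//.
have y0 : 0 < 1 + (x - m) ^+ 2 by rewrite ltr_pwDl ?sqr_ge0.
have h1 : normal_pdf m (2 * s) x <= D * M / (1 + (x - m) ^+ 2).
  rewrite ler_pdivlMr// mulrC; apply: (le_trans (hD x)).
  by rewrite ler_wpM2l// /M normal_pdf_ub// mulf_neq0.
apply: (le_trans h1); rewrite -!mulrA !ler_wpM2l//.
rewrite mulrA /harmonic /= ler_pdivlMr ?ltr0n// mulrC ler_pdivrMr//.
have xk : x ^+ 2 = k%:R ^+ 2 by rewrite /x exprMn sqrr_sign mul1r.
have kk : k.+1%:R <= 2 + k%:R ^+ 2 :> R by rewrite -natr1; nra.
apply: (le_trans kk); rewrite -xk.
have := sqr_ge0 (m * (x - m)); have := sqr_ge0 (x - 2 * m); nra.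
Qed.

Let dec_eq (f : R -> R) (e : bool) : f ((-1) ^+ e * k%:R) @[k --> \oo] --> 0 ->
  f (if e then - k%:R else k%:R) @[k --> \oo] --> 0.
Proof.
suff -> : (fun k : nat => f ((-1) ^+ e * k%:R)) = fun k => f (if e then - k%:R else k%:R) by [].
by apply/funext => k; case: e; rewrite ?expr0 ?expr1 ?mul1r ?mulN1r.
Qed.

(** Stein's identity. *)
Lemma normal_integration_by_parts (h h' : R -> R) K : 0 <= K ->
    (forall x : R, is_derive x 1 h (h' x)) -> continuous h' ->
    (forall x, `|h x| <= K * (1 + (x - m) ^+ 2)) ->
    (forall x, `|h' x| <= K * (1 + (x - m) ^+ 2)) ->
    (forall x, `|(x - m) * h x| <= K * (1 + (x - m) ^+ 2)) ->
  \int[leb]_x ((x - m) * h x * normal_pdf m s x) =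
  s ^+ 2 * \int[leb]_x (h' x * normal_pdf m s x).
Proof.
move=> K0 dh ch' hb h'b xhb.
have ch : continuous h.
  by move=> x; apply: differentiable_continuous; apply/derivable1_diffP; have [] := dh x.
have i1 := integrable_mul_normal_pdf s0 K0 ch' h'b.
have cxh : continuous (fun x => (x - m) * h x).
  move=> x; apply: cvgM; last exact: ch.
  by apply: cvgB; [exact: cvg_id|exact: cvg_cst].
have i2 := integrable_mul_normal_pdf s0 K0 cxh xhb.
have i3 : leb.-integrable setT (EFin \o (fun x => - (s ^+ 2)^-1 * ((x - m) * h x * normal_pdf m s x))).
  by apply: (@integrableZl _ _ _ leb setT measurableT (- (s ^+ 2)^-1)%R (fun x => ((x - m) * h x * normal_pdf m s x)%:E)).
have := @integral_derivative_eq0 R (fun x => h x * normal_pdf m s x)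
  (fun x => h' x * normal_pdf m s x + - (s ^+ 2)^-1 * ((x - m) * h x * normal_pdf m s x)).
rewrite RintegralD// RintegralZl// => H.
have s2 : s ^+ 2 != 0 by rewrite expf_neq0.
apply: (mulfI (invr_neq0 s2)); rewrite mulKf//.
apply/eqP; rewrite -subr_eq0 -oppr_eq0 opprB -mulNr; apply/eqP; apply: H.
- move=> x; have d1 := dh x; have d2 := is_derive_normal_pdf m s0 x.
  by apply: is_derive_eq; rewrite /GRing.scale /=; ring.
- have cp := @continuous_normal_pdf R m s s0.
  move=> x; apply: cvgD; first by apply: cvgM; [exact: ch'|exact: cp].
  apply: cvgM; first exact: cvg_cst.
  by apply: cvgM; [exact: cxh|exact: cp].
- by have := integrableD measurableT i1 i3.
- by have := @dec_eq (fun x => h x * normal_pdf m s x) false (normal_pdf_decay false K0 hb).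
- by have := @dec_eq (fun x => h x * normal_pdf m s x) true (normal_pdf_decay true K0 hb).
Qed.

Lemma normal_mass : \int[leb]_x normal_pdf m s x = 1.
Proof. by rewrite /Rintegral integral_normal_pdf. Qed.

Lemma normal_mean : \int[leb]_x ((x - m) * normal_pdf m s x) = 0.
Proof.
have := @normal_integration_by_parts (cst 1) (cst 0) 1 ler01.
under eq_Rintegral do rewrite mulr1.
under [X in _ = _ * X]eq_Rintegral do rewrite mul0r.
have -> : \int[leb]_x (0 : R) = 0 by rewrite /Rintegral integral0.
rewrite mulr0; apply.
- exact: cst_continuous.
- by move=> x; rewrite /= mul1r normr1 lerDl sqr_ge0.
- by move=> x; rewrite /= mul1r normr0 addr_ge0 ?sqr_ge0.
- move=> x; rewrite /= mulr1 mul1r; have := sqr_ge0 (`|x - m| - 1).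
  by have := real_normK (num_real (x - m)); have := normr_ge0 (x - m); nra.
Qed.

Lemma normal_variance : \int[leb]_x ((x - m) ^+ 2 * normal_pdf m s x) = s ^+ 2.
Proof.
have := @normal_integration_by_parts (fun x => x - m) (cst 1) 1 ler01.
under eq_Rintegral do rewrite -expr2.
under [X in _ = _ * X]eq_Rintegral do rewrite mul1r.
rewrite normal_mass mulr1; apply.
- by move=> x; apply: is_derive_eq; rewrite subr0.
- exact: cst_continuous.
- move=> x; rewrite /= mul1r; have := sqr_ge0 (`|x - m| - 1).
  by have := real_normK (num_real (x - m)); have := normr_ge0 (x - m); nra.
- by move=> x; rewrite /= mul1r normr1 lerDl sqr_ge0.
- by move=> x; rewrite /= mul1r -expr2 ger0_norm ?sqr_ge0// lerDr.
Qed.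

(** The integral [H t] of [cos (th + t (x - m))] satisfies [H' = - s^2 t H]. *)
Lemma normal_char (th t : R) :
  \int[leb]_x (cos (th + t * (x - m)) * normal_pdf m s x) =
  cos th * expR (- (s ^+ 2 * t ^+ 2 / 2)).
Proof.
have cp := @continuous_normal_pdf R m s s0.
have ca (u : R) : continuous (fun x => th + u * (x - m)).
  move=> x; apply: cvgD; first exact: cvg_cst.
  apply: cvgM; first exact: cvg_cst.
  by apply: cvgB; [exact: cvg_id|exact: cvg_cst].
have cc (u : R) : continuous (fun x => cos (th + u * (x - m))).
  by move=> x; apply: continuous_comp; [exact: ca|exact: continuous_cos].
have cs (u : R) : continuous (fun x => sin (th + u * (x - m))).
  by move=> x; apply: continuous_comp; [exact: ca|exact: continuous_sin].
have cx : continuous (fun x : R => x - m).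
  by move=> x; apply: cvgB; [exact: cvg_id|exact: cvg_cst].
pose f (u x : R) := cos (th + u * (x - m)) * normal_pdf m s x.
pose H (u : R) := \int[leb]_x f u x.
have bound1 (a : R) : `|a| <= 1 + a ^+ 2.
  by have := sqr_ge0 (`|a| - 1); have := real_normK (num_real a); have := normr_ge0 a; nra.
have df u x : is_derive u (1 : R) (f ^~ x) (- sin (th + u * (x - m)) * (x - m) * normal_pdf m s x).
  have d1 : is_derive u (1 : R) (fun u => th + u * (x - m)) (x - m).
    by apply: is_derive_eq; rewrite /GRing.scale /=; ring.
  have d2 := @is_derive1_comp R cos _ u _ _ (is_derive_cos _) d1.
  have d3 : is_derive u (1 : R) (f ^~ x) (normal_pdf m s x * (- sin (th + u * (x - m)) * (x - m))).
    rewrite (_ : f ^~ x = fun u => normal_pdf m s x * cos (th + u * (x - m))).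
      exact: (is_deriveZ (normal_pdf m s x) d2).
    by apply/funext => v; rewrite /f mulrC.
  by apply: is_derive_eq; ring.
have int1 (u : R) : leb.-integrable setT (EFin \o f u).
  apply: (@integrable_mul_normal_pdf _ m s s0 _ 1 ler01 (cc u)) => x.
  by rewrite mul1r (le_trans (_ : _ <= 1))// ?ler_norml ?cos_geN1 ?cos_le1// lerDl sqr_ge0.
have stein u : \int[leb]_x (- sin (th + u * (x - m)) * (x - m) * normal_pdf m s x) = - (s ^+ 2 * u) * H u.
  have := @normal_integration_by_parts (fun x => - sin (th + u * (x - m)))
      (fun x => - cos (th + u * (x - m)) * u) (1 + `|u|).
  have -> : \int[leb]_x (- cos (th + u * (x - m)) * u * normal_pdf m s x) = - u * H u.
    rewrite /H -RintegralZl//; apply: eq_Rintegral => x _; rewrite /f; ring.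
  under eq_Rintegral => x _ do rewrite (mulrC (x - m)).
  have ds x : is_derive x (1 : R) (fun x => - sin (th + u * (x - m))) (- cos (th + u * (x - m)) * u).
    have d1 : is_derive x (1 : R) (fun x => th + u * (x - m)) u.
      by apply: is_derive_eq; rewrite /GRing.scale /=; ring.
    have d2 := @is_derive1_comp R sin _ x _ _ (is_derive_sin _) d1.
    by have d3 := is_deriveN d2; rewrite -mulNr in d3.
  have s1 x : `|sin (th + u * (x - m))| <= 1 by rewrite ler_norml sin_geN1 sin_le1.
  have c1 x : `|cos (th + u * (x - m))| <= 1 by rewrite ler_norml cos_geN1 cos_le1.
  move=> st; rewrite st; first by ring.
  - by rewrite addr_ge0.
  - move=> x; apply: cvgM; last exact: cvg_cst.
    by apply: cvgN; exact: cc.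
  - move=> x; rewrite normrN; apply: (le_trans (s1 x)).
    by have := normr_ge0 u; have := sqr_ge0 (x - m); nra.
  - move=> x; rewrite normrM normrN.
    have := c1 x.
    by have := normr_ge0 u; have := sqr_ge0 (x - m); have := normr_ge0 (cos (th + u * (x - m))); nra.
  - move=> x; rewrite normrM normrN.
    apply: (@le_trans _ _ (1 + (x - m) ^+ 2)).
      by apply: (le_trans (ler_piMr _ (s1 x))).
    by rewrite ler_peMl ?addr_ge0 ?sqr_ge0// lerDl.
have dH u : is_derive u (1 : R) H (- (s ^+ 2 * u) * H u).
  have uI : `]u - 1, u + 1[%classic u by rewrite /= in_itv /=; apply/andP; split; lra.
  pose G x := `|x - m| * normal_pdf m s x.
  have G0 x : 0 <= G x by rewrite mulr_ge0 ?normal_pdf_ge0.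
  have iG : leb.-integrable setT (EFin \o G).
    apply: (@integrable_mul_normal_pdf _ m s s0 _ 1 ler01).
      by move=> x; apply: cvg_norm; exact: cx.
    by move=> x; rewrite mul1r normr_id.
  have dE v x : partial1of2 f v x = - sin (th + v * (x - m)) * (x - m) * normal_pdf m s x.
    by rewrite /partial1of2 derive1E (@derive_val _ _ _ _ _ _ _ (df v x)).
  have Gb v x : `]u - 1, u + 1[%classic v -> setT x -> `|partial1of2 f v x| <= G x.
    move=> _ _; rewrite dE !normrM normrN (ger0_norm (normal_pdf_ge0 _ _ _)).
    rewrite ler_wpM2r ?normal_pdf_ge0// ler_piMl//.
    by rewrite ler_norml sin_geN1 sin_le1.
  have dif v x : `]u - 1, u + 1[%classic v -> setT x -> derivable (f ^~ x) v 1.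
    by move=> _ _; have [] := df v x.
  apply: DeriveDef.
    exact: (@derivable_under_integral R _ _ leb f setT measurableT u _ _ uI (fun x _ => int1 x) dif G G0 iG Gb).
  rewrite -derive1E.
  rewrite (@differentiation_under_integral R _ _ leb f setT measurableT u _ _ uI (fun x _ => int1 x) dif G G0 iG Gb).
  rewrite -stein; apply: eq_Rintegral => x _; exact: dE.
pose E (u : R) := H u * expR (s ^+ 2 * u ^+ 2 / 2).
have dE u : is_derive u (1 : R) E 0.
  have d0 := dH u.
  have d1 : is_derive u (1 : R) (fun u : R => s ^+ 2 * u ^+ 2 / 2) (s ^+ 2 * u).
    have -> : (fun u : R => s ^+ 2 * u ^+ 2 / 2) = (fun u : R => (s ^+ 2 / 2) * u ^+ 2).
      by apply/funext => v; ring.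
    by apply: is_derive_eq; rewrite /GRing.scale /=; field.
  have d2 := @is_derive1_comp R expR _ u _ _ (is_derive_expR _) d1.
  have d3 := is_deriveM d0 d2.
  rewrite (_ : 0 = H u *: (expR (s ^+ 2 * u ^+ 2 / 2) * (s ^+ 2 * u)) +
       (expR \o (fun u : R => s ^+ 2 * u ^+ 2 / 2)) u *: (- (s ^+ 2 * u) * H u)) //.
  by rewrite /GRing.scale /=; ring.
have := is_derive_0_is_cst t 0 dE.
rewrite /E expr0n /= mulr0 mul0r expR0 mulr1 {2}/H.
have -> : \int[leb]_x f 0 x = cos th.
  rewrite -[RHS]mulr1 -normal_mass -RintegralZl//; last exact: integrable_normal_pdf.
  by apply: eq_Rintegral => x _; rewrite /f mul0r addr0.
by move=> h; rewrite expRN -h mulfK ?gt_eqF ?expR_gt0.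
Qed.

End GaussianMoments.

(** * Variables with a Gaussian law *)

Section GaussianLaw.
Context {R : realType}.
Notation leb := (@lebesgue_measure R).
Local Open Scope ereal_scope.

Lemma ge0_integral_normal_prob (m s : R) (f : measurableTypeR R -> \bar R) :
    measurable_fun setT f -> (forall x, 0 <= f x) ->
  \int[normal_prob m s]_x f x = \int[leb]_x (f x * (normal_pdf m s x)%:E).
Proof.
move=> mf f0; have dom := normal_prob_dominates m s.
rewrite -(Radon_Nikodym_SigmaFinite.change_of_variables dom f0 measurableT mf).
have mp : measurable_fun setT (fun x => (normal_pdf m s x)%:E).
  by apply/measurable_EFinP; exact: measurable_normal_pdf.
have mrn : measurable_fun setT (Radon_Nikodym_SigmaFinite.f (normal_prob m s) leb).
  exact: measurable_int (Radon_Nikodym_SigmaFinite.f_integrable dom).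
apply: ae_eq_integral => //; [exact: emeasurable_funM|exact: emeasurable_funM|].
have : ae_eq leb setT (Radon_Nikodym_SigmaFinite.f (normal_prob m s) leb)
    (fun x => (normal_pdf m s x)%:E).
  apply: integral_ae_eq => //.
    exact: Radon_Nikodym_SigmaFinite.f_integrable.
  by move=> E _ mE; rewrite -Radon_Nikodym_SigmaFinite.f_integral.
by apply: filterS => x /= h xT; rewrite h.
Qed.

Context d (Om : measurableType d) (P : probability Om R).
Variables (Y : Om -> R) (m s : R).
Hypothesis mY : measurable_fun setT Y.
Hypothesis lawY : forall A : set (measurableTypeR R), measurable A ->
  P [set w | A (Y w)] = gaussian_law m s A.

Let Y' : {RV P >-> measurableTypeR R} := @mfun_Sub _ _ Om (measurableTypeR R) Y (mem_set mY).

Lemma ge0_integral_law (f : measurableTypeR R -> \bar R) :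
    measurable_fun setT f -> (forall x, 0 <= f x) ->
  \int[P]_w f (Y w) =
  if s == 0%R then f m else \int[leb]_x (f x * (normal_pdf m s x)%:E).
Proof.
move=> mf f0.
have <- : \int[distribution P Y']_x f x = \int[P]_w f (Y w).
  by rewrite ge0_integral_distribution.
have [s0|s0] := eqVneq s 0%R.
  rewrite (@eq_measure_integral _ _ _ _ (dirac (m : measurableTypeR R))).
    by rewrite integral_dirac//= diracT mul1e.
  move=> A mA _; rewrite -[LHS]/(P [set w | A (Y w)]) lawY//.
  by rewrite /gaussian_law s0 eqxx.
rewrite -ge0_integral_normal_prob//.
apply: eq_measure_integral => A mA _.
rewrite -[LHS]/(P [set w | A (Y w)]) lawY//.
by rewrite /gaussian_law (negbTE s0).
Qed.

Lemma integral_law (f : measurableTypeR R -> R) : measurable_fun setT f ->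
  \int[P]_w (f (Y w))%:E =
  if s == 0%R then (f m)%:E else \int[leb]_x (f x * normal_pdf m s x)%:E.
Proof.
move=> mf; have mf' : measurable_fun setT (EFin \o f) by apply/measurable_EFinP.
rewrite integralE.
have e1 : \int[P]_w ((fun w => (f (Y w))%:E)^\+ w) = \int[P]_w ((EFin \o f)^\+ (Y w)).
  by apply: eq_integral => w _; rewrite !funeposE.
have e2 : \int[P]_w ((fun w => (f (Y w))%:E)^\- w) = \int[P]_w ((EFin \o f)^\- (Y w)).
  by apply: eq_integral => w _; rewrite !funenegE.
rewrite e1 e2 !ge0_integral_law//; [|exact: measurable_funeneg|exact: measurable_funepos].
have [s0|s0] := eqVneq s 0%R.
  by rewrite -[RHS]/((EFin \o f) m) {3}(funeposneg (EFin \o f)).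
rewrite [RHS]integralE; congr (_ - _); apply: eq_integral => x _.
  rewrite !funeposE /= -!EFin_max -EFinM; congr (_%:E).
  by rewrite maxr_pMl ?mul0r ?normal_pdf_ge0.
rewrite !funenegE /= -!EFin_max -EFinM; congr (_%:E).
by rewrite maxr_pMl ?mul0r ?normal_pdf_ge0// mulNr.
Qed.

Lemma Rintegral_law (f : measurableTypeR R -> R) : measurable_fun setT f ->
  (\int[P]_w f (Y w) =
  if s == 0 then f m else \int[leb]_x (f x * normal_pdf m s x))%R.
Proof.
by move=> mf; rewrite /Rintegral integral_law//; case: ifP.
Qed.

Lemma integrable_law (f : measurableTypeR R -> R) : measurable_fun setT f ->
    (s != 0%R -> leb.-integrable setT (EFin \o (fun x => f x * normal_pdf m s x)%R)) ->
  P.-integrable setT (EFin \o (fun w => f (Y w))).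
Proof.
move=> mf fi; apply/integrableP; split.
  by apply/measurable_EFinP; exact: measurableT_comp mf mY.
rewrite (_ : \int[P]_x _ = \int[P]_w (`|f (Y w)|%R)%:E)//.
rewrite (@integral_law (fun x => `|f x|%R)); last exact: measurableT_comp.
have [s0|s0] := eqVneq s 0%R; first by rewrite ltry.
have /integrableP[_] := fi s0.
rewrite (_ : \int[leb]_x (`|f x| * normal_pdf m s x)%:E =
   \int[leb]_x `|(EFin \o (fun x0 : R => f x0 * normal_pdf m s x0)%R) x|)//.
by apply: eq_integral => x _ /=; rewrite normrM (ger0_norm (normal_pdf_ge0 _ _ _)).
Qed.

Lemma integrable_law_linear : P.-integrable setT (EFin \o (fun w => Y w - m)%R).
Proof.
have cx : continuous (fun x : R => x - m)%R.
  by move=> x; apply: cvgB; [exact: cvg_id|exact: cvg_cst].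
apply: (@integrable_law (fun x => x - m)%R); first exact: continuous_measurable_fun.
move=> s0; apply: (@integrable_mul_normal_pdf R m s s0 (fun x => x - m)%R 1%R ler01 cx) => x.
rewrite mul1r; have := sqr_ge0 (`|x - m| - 1)%R.
by have := real_normK (num_real (x - m)); have := normr_ge0 (x - m)%R; nra.
Qed.

Lemma law_mean : (\int[P]_w (Y w - m) = 0)%R.
Proof.
have cx : continuous (fun x : R => x - m)%R.
  by move=> x; apply: cvgB; [exact: cvg_id|exact: cvg_cst].
rewrite (@Rintegral_law (fun x => x - m)%R); last exact: continuous_measurable_fun.
by have [s0|s0] := eqVneq s 0%R; [rewrite subrr|rewrite normal_mean].
Qed.

Lemma integrable_law_sqr : P.-integrable setT (EFin \o (fun w => (Y w - m) ^+ 2)%R).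
Proof.
have cx : continuous (fun x : R => (x - m) ^+ 2)%R.
  move=> x; apply: (@continuous_comp _ _ _ (fun x => x - m)%R (fun x => x ^+ 2)%R).
    by apply: cvgB; [exact: cvg_id|exact: cvg_cst].
  exact: sqr_continuous.
apply: (@integrable_law (fun x => (x - m) ^+ 2)%R); first exact: continuous_measurable_fun.
move=> s0; apply: (@integrable_mul_normal_pdf R m s s0 (fun x => (x - m) ^+ 2)%R 1%R ler01 cx) => x.
by rewrite mul1r ger0_norm ?sqr_ge0// lerDr.
Qed.

Lemma law_variance : (\int[P]_w ((Y w - m) ^+ 2) = s ^+ 2)%R.
Proof.
have cx : continuous (fun x : R => (x - m) ^+ 2)%R.
  move=> x; apply: (@continuous_comp _ _ _ (fun x => x - m)%R (fun x => x ^+ 2)%R).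
    by apply: cvgB; [exact: cvg_id|exact: cvg_cst].
  exact: sqr_continuous.
rewrite (@Rintegral_law (fun x => (x - m) ^+ 2)%R); last exact: continuous_measurable_fun.
by have [->|s0] := eqVneq s 0%R; [rewrite subrr|rewrite normal_variance].
Qed.

Lemma law_char (th t : R) :
  (\int[P]_w cos (th + t * (Y w - m)) = cos th * expR (- (s ^+ 2 * t ^+ 2 / 2)))%R.
Proof.
have ca : continuous (fun x => cos (th + t * (x - m)))%R.
  move=> x; apply: continuous_comp; last exact: continuous_cos.
  apply: cvgD; first exact: cvg_cst.
  apply: cvgM; first exact: cvg_cst.
  by apply: cvgB; [exact: cvg_id|exact: cvg_cst].
rewrite (@Rintegral_law (fun x => cos (th + t * (x - m)))%R); last exact: continuous_measurable_fun.
have [->|s0] := eqVneq s 0%R; last by rewrite normal_char.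
by rewrite subrr mulr0 addr0 expr0n /= !mul0r oppr0 expR0 mulr1.
Qed.

Lemma normal_peakE (a : R) : (normal_peak a = (`|a| * Num.sqrt (pi *+ 2))^-1)%R.
Proof. by rewrite /normal_peak -mulrnAr sqrtrM ?sqr_ge0// sqrtr_sqr. Qed.

Lemma normal_peak_double (a : R) : (normal_peak a = 2 * normal_peak (2 * a))%R.
Proof.
rewrite !normal_peakE normrM ger0_norm// -mulrA [in RHS]invfM.
by rewrite mulVKf.
Qed.

(** Outside [[m - v, m + v]], the density of standard deviation [s] is at most
    [2 exp (- 3 v^2 / (8 s^2))] times the density of standard deviation
    [2 s]. *)
Lemma law_tail (v sg : R) : (0 <= v)%R -> (0 < sg)%R -> (s ^+ 2 <= sg ^+ 2)%R ->
  P [set w | v < `|Y w - m|]%R <= (2 * expR (- (v / sg) ^+ 2 / 4))%:E.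
Proof.
move=> v0 sg0 ssg; set A := [set x : measurableTypeR R | (v < `|x - m|)%R].
have mA : measurable A.
  have mf : measurable_fun setT (fun x : measurableTypeR R => `|x - m|%R).
    apply: measurableT_comp => //; exact: measurable_funB.
  by have := mf measurableT _ (measurable_itv `]v, +oo[); rewrite setTI; congr measurable;
     apply/seteqP; split => x; rewrite /A /= in_itv /= andbT.
rewrite (lawY mA) /gaussian_law.
have [s0|s0] := eqVneq s 0%R.
  rewrite diracE; have -> : (m \in A) = false.
    by apply/negbTE; rewrite notin_setE /A /= subrr normr0; apply/negP; rewrite -leNgt.
  by rewrite lee_fin mulr_ge0 ?expR_ge0.
have s20 : (2 * s != 0)%R by rewrite mulf_neq0.
rewrite /normal_prob.
have mp a b : measurable_fun setT (fun x : R => (normal_pdf a b x)%:E).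
  by apply/measurable_EFinP; exact: measurable_normal_pdf.
apply: (@le_trans _ _ (\int[leb]_(x in A) ((2 * expR (- (v / sg) ^+ 2 / 4)) * normal_pdf m (2 * s) x)%:E)).
  apply: ge0_le_integral => //.
  - by move=> x _; rewrite lee_fin normal_pdf_ge0.
  - by apply: measurable_funTS; exact: mp.
  - apply: measurable_funTS; apply/measurable_EFinP/measurable_funM => //.
    exact: measurable_normal_pdf.
  - move=> x Ax; rewrite lee_fin !normal_pdfE// /normal_fun (normal_peak_double s).
    rewrite -!mulrA ler_wpM2l// mulrCA ler_wpM2l ?normal_peak_ge0// -expRD ler_expR.
    have s2 : (0 < s ^+ 2)%R by rewrite exprn_even_gt0.
    have sg2 : (0 < sg ^+ 2)%R by rewrite exprn_gt0.
    have vx : (v ^+ 2 <= (x - m) ^+ 2)%R.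
      by rewrite -[leRHS]real_normK ?num_real// ler_pXn2r ?nnegrE// ltW.
    have -> : (- (x - m) ^+ 2 / (s ^+ 2 *+ 2) = - (3 / 8 * ((x - m) ^+ 2 / s ^+ 2)) +
       - (x - m) ^+ 2 / ((2 * s) ^+ 2 *+ 2))%R by field.
    rewrite lerD2r mulNr lerN2 expr_div_n.
    have h1 : (v ^+ 2 / sg ^+ 2 <= (x - m) ^+ 2 / s ^+ 2)%R.
      by rewrite ler_pM ?sqr_ge0 ?invr_ge0 ?(ltW sg2)// lef_pV2.
    have : (0 <= v ^+ 2 / sg ^+ 2)%R by rewrite divr_ge0 ?sqr_ge0.
    by lra.
under eq_integral do rewrite EFinM.
rewrite integralZl//; last exact: (integrableS measurableT) (integrable_normal_pdf _ _).
rewrite -[leRHS]mule1 lee_wpmul2l ?lee_fin ?mulr_ge0 ?expR_ge0//.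
rewrite -(integral_normal_pdf m (2 * s)).
apply: (@ge0_subset_integral _ _ _ leb A setT) => //; first exact: mp.
by move=> x _; rewrite lee_fin normal_pdf_ge0.
Qed.

End GaussianLaw.

(** * Integrals of bounded functions *)

Section RintegralSum.
Context {R : realType} d (T : measurableType d) (mu : {measure set T -> \bar R}).

Lemma integrable_sumR (I : Type) (r : seq I) (f : I -> T -> R) :
    (forall i, mu.-integrable setT (EFin \o f i)) ->
  mu.-integrable setT (EFin \o (fun x => \sum_(i <- r) f i x)).
Proof.
move=> fi; rewrite (_ : EFin \o _ = fun x => (\sum_(i <- r) (f i x)%:E)%E); last first.
  by apply/funext => x /=; rewrite sumEFin.
by apply: integrable_sum => // i _; exact: fi.
Qed.

Lemma Rintegral_sum (I : Type) (r : seq I) (f : I -> T -> R) :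
    (forall i, mu.-integrable setT (EFin \o f i)) ->
  \int[mu]_x (\sum_(i <- r) f i x) = \sum_(i <- r) \int[mu]_x f i x.
Proof.
move=> fi; elim: r => [|i r IHr].
  rewrite big_nil; under eq_Rintegral do rewrite big_nil.
  by rewrite /Rintegral integral0.
rewrite big_cons -IHr -RintegralD//; last exact: integrable_sumR.
by apply: eq_Rintegral => x _; rewrite big_cons.
Qed.

Lemma integrable_ZlR (f : T -> R) (c : R) : mu.-integrable setT (EFin \o f) ->
  mu.-integrable setT (EFin \o (fun x => c * f x)).
Proof.
by move=> fi; apply: (@integrableZl _ _ _ mu setT measurableT c (fun x => (f x)%:E)).
Qed.

End RintegralSum.

Section BoundedIntegrals.
Context {R : realType} d (T : measurableType d) (P : probability T R).

Lemma bounded_integrable (f : T -> R) (M : R) : measurable_fun setT f ->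
  (forall x, `|f x| <= M) -> P.-integrable setT (EFin \o f).
Proof.
move=> mf fM; apply: measurable_bounded_integrable => //.
  by apply: (le_lt_trans (probability_le1 P measurableT)); exact: ltry.
exists M; split; first exact: num_real.
by move=> x Mx y _; exact: le_trans (fM y) (ltW Mx).
Qed.

Lemma Rintegral_EFin (f : T -> R) : P.-integrable setT (EFin \o f) ->
  (\int[P]_x (f x)%:E)%E = (\int[P]_x f x)%:E.
Proof. by move=> fi; rewrite /Rintegral fineK//; exact: integrable_fin_num. Qed.

Lemma Rintegral_indic (A : set T) : measurable A -> \int[P]_x \1_A x = fine (P A).
Proof. by move=> mA; rewrite /Rintegral integral_indic// setIT. Qed.

End BoundedIntegrals.

Lemma bounded_Fubini {R : realType} d1 d2 (T1 : measurableType d1) (T2 : measurableType d2)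
    (P1 : probability T1 R) (P2 : probability T2 R) (f : T1 * T2 -> R) (M : R) :
    measurable_fun setT f -> (forall x, `|f x| <= M) ->
  \int[P1]_x \int[P2]_y f (x, y) = \int[P2]_y \int[P1]_x f (x, y).
Proof.
move=> mf fM.
have fi : (P1 \x P2)%E.-integrable setT (EFin \o f).
  apply: measurable_bounded_integrable => //.
    by apply: (le_lt_trans (probability_le1 (P1 \x P2)%E measurableT)); exact: ltry.
  exists M; split; first exact: num_real.
  by move=> x Mx y _; exact: le_trans (fM y) (ltW Mx).
have := Fubini fi; rewrite /=.
have m1 x : measurable_fun setT (fun y => f (x, y)) by apply: measurableT_comp.
have m2 y : measurable_fun setT (fun x => f (x, y)) by apply: measurableT_comp.
under eq_integral do rewrite (Rintegral_EFin (bounded_integrable _ (m1 _) (fun y => fM (_, y)))).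
under [in RHS]eq_integral do rewrite (Rintegral_EFin (bounded_integrable _ (m2 _) (fun y => fM (y, _)))).
by move=> h; rewrite [LHS]/Rintegral h.
Qed.

(** * Boxes for independent Gaussian coordinates *)

Section GaussianBumps.
Context {R : realType}.
Notation leb := (@lebesgue_measure R).

(** The Fourier transform, as a function of [x - z], of the centered normal law
    of standard deviation [e^-1]. *)
Definition bump (z e x : R) : R := expR (- (e^-1 ^+ 2 * (x - z) ^+ 2 / 2)).

(** The integral of a bump against the standard normal law. *)
Definition bump_mean (z e : R) : R :=
  e / Num.sqrt (1 + e ^+ 2) * expR (- (z ^+ 2 / (2 * (1 + e ^+ 2)))).

Lemma measurable_bump z e : measurable_fun setT (bump z e).
Proof.
apply: continuous_measurable_fun => x; apply: continuous_comp; last exact: continuous_expR.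
apply: cvgN; apply: cvgM; last exact: cvg_cst.
apply: cvgM; first exact: cvg_cst.
apply: (@continuous_comp _ _ _ (fun x => x - z) (fun x => x ^+ 2)).
  by apply: cvgB; [exact: cvg_id|exact: cvg_cst].
exact: sqr_continuous.
Qed.

Lemma bump_ge0 z e x : 0 <= bump z e x. Proof. exact: expR_ge0. Qed.

Lemma bump_le1 z e x : bump z e x <= 1.
Proof.
by rewrite /bump -[leRHS]expR0 ler_expR oppr_le0 divr_ge0// mulr_ge0 ?sqr_ge0.
Qed.

Let lawid (m s : R) : s != 0 -> forall A : set (measurableTypeR R), measurable A ->
  normal_prob m s [set w | A w] = gaussian_law m s A.
Proof. by move=> s0 A mA; rewrite /gaussian_law (negbTE s0). Qed.

Lemma bump_fourier (th x z e : R) : e != 0 ->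
  \int[normal_prob 0 e^-1]_g cos (th + (x - z) * g) = cos th * bump z e x.
Proof.
move=> e0; have e1 := invr_neq0 e0.
have := @law_char R _ _ (normal_prob 0 e^-1) id 0 e^-1 (@measurable_id _ _ _) (lawid _ e1) th (x - z).
by under eq_Rintegral do rewrite subr0.
Qed.

(** Under the law whose Fourier transform is the bump, the factor
    [exp (- g^2 / 2)] stands for the characteristic function of a standard
    normal coordinate. *)
Lemma bump_tilt (th x e : R) : 0 < e ->
  \int[normal_prob 0 e^-1]_g (cos (th + x * g) * expR (- (g ^+ 2 / 2))) =
  cos th * bump_mean x e.
Proof.
move=> e0; have e1 : e^-1 != 0 by rewrite invr_neq0 ?gt_eqF.
pose f g := cos (th + x * g) * expR (- (g ^+ 2 / 2)).
have cf : continuous f.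
  move=> g; apply: cvgM; apply: continuous_comp.
  - apply: cvgD; first exact: cvg_cst.
    by apply: cvgM; [exact: cvg_cst|exact: cvg_id].
  - exact: continuous_cos.
  - by apply: cvgN; apply: cvgM; [exact: sqr_continuous|exact: cvg_cst].
  - exact: continuous_expR.
have mf : measurable_fun setT f by exact: continuous_measurable_fun.
rewrite (@Rintegral_law R _ _ (normal_prob 0 e^-1) id 0 e^-1 (@measurable_id _ _ _) (lawid _ e1) f)//.
rewrite (negbTE e1).
have e2 : 0 < 1 + e ^+ 2 by rewrite ltr_pwDl ?sqr_ge0.
set q := Num.sqrt (1 + e ^+ 2).
have q0 : 0 < q by rewrite sqrtr_gt0.
have q2 : q ^+ 2 = 1 + e ^+ 2 by rewrite sqr_sqrtr// ltW.
have q1 : q^-1 != 0 by rewrite invr_neq0 ?gt_eqF.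
have pg : 0 < Num.sqrt (pi *+ 2) :> R by rewrite sqrtr_gt0 mulrn_wgt0// pi_gt0.
have pdfE g : f g * normal_pdf 0 e^-1 g = (e / q) * (cos (th + x * (g - 0)) * normal_pdf 0 q^-1 g).
  rewrite /f !normal_pdfE// /normal_fun !subr0 !normal_peakE !normfV !ger0_norm ?ltW//.
  have -> : expR (- g ^+ 2 / (q^-1 ^+ 2 *+ 2)) = expR (- (g ^+ 2 / 2)) * expR (- g ^+ 2 / (e^-1 ^+ 2 *+ 2)).
    rewrite -expRD; congr expR; rewrite exprVn q2; field.
    by rewrite gt_eqF// gt_eqF.
  by field; rewrite !gt_eqF.
under eq_Rintegral do rewrite pdfE.
rewrite RintegralZl//; last first.
  have cc : continuous (fun g => cos (th + x * (g - 0))).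
    move=> g; apply: continuous_comp; last exact: continuous_cos.
    apply: cvgD; first exact: cvg_cst.
    apply: cvgM; first exact: cvg_cst.
    by apply: cvgB; [exact: cvg_id|exact: cvg_cst].
  apply: (@integrable_mul_normal_pdf R 0 q^-1 q1 (fun g => cos (th + x * (g - 0))) 1 ler01 cc) => g.
  by rewrite mul1r (le_trans (_ : _ <= 1))// ?ler_norml ?cos_geN1 ?cos_le1// lerDl sqr_ge0.
rewrite normal_char// /bump_mean mulrCA -/q; congr (_ * (_ * expR (- _))).
by rewrite exprVn q2; field; rewrite gt_eqF.
Qed.

End GaussianBumps.

Section GaussianCoordinates.
Context {R : realType} d (Om : measurableType d) (P : probability Om R).
Variables (k : nat) (Z : nat -> Om -> R).
Hypothesis mZ : forall i, measurable_fun setT (Z i).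
Hypothesis charZ : forall th (c : nat -> R),
  \int[P]_w cos (th + \sum_(0 <= i < k) c i * Z i w) =
  cos th * expR (- (\sum_(0 <= i < k) c i ^+ 2) / 2).

(** Each bump is a Fourier integral; Fubini moves the expectation inside, where
    the characteristic function is known, so that the coordinates are
    integrated out one at a time. *)
Lemma bump_product_char (z e : nat -> R) j th (c : nat -> R) :
    (j <= k)%N -> (forall i, 0 < e i) ->
  \int[P]_w (cos (th + \sum_(j <= i < k) c i * Z i w)
             * \prod_(0 <= i < j) bump (z i) (e i) (Z i w)) =
  cos th * expR (- (\sum_(j <= i < k) c i ^+ 2) / 2)
    * \prod_(0 <= i < j) bump_mean (z i) (e i).
Proof.
move=> jk e0; elim: j th c jk => [|j IHj] th c jk.
  rewrite big_geq// mulr1 -charZ; apply: eq_Rintegral => w _.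
  by rewrite big_geq// mulr1.
pose g := normal_prob 0 (e j)^-1.
pose F (x : Om * measurableTypeR R) := cos (th + \sum_(j.+1 <= i < k) c i * Z i x.1 + (Z j x.1 - z j) * x.2)
   * \prod_(0 <= i < j) bump (z i) (e i) (Z i x.1).
have msum : measurable_fun setT (fun x : Om * measurableTypeR R => \sum_(j.+1 <= i < k) c i * Z i x.1).
  apply: measurable_sum => i; apply: measurable_funM => //.
  exact: measurableT_comp.
have mprod : measurable_fun setT (fun x : Om * measurableTypeR R => \prod_(0 <= i < j) bump (z i) (e i) (Z i x.1)).
  apply: measurable_prod => i _.
  apply: (measurableT_comp (@measurable_bump R (z i) (e i))).
  exact: measurableT_comp.
have mF : measurable_fun setT F.
  apply: measurable_funM => //.
  apply: (measurableT_comp (continuous_measurable_fun (@continuous_cos R))).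
  apply: measurable_funD; first by apply: measurable_funD.
  apply: measurable_funM; last exact: measurable_snd.
  by apply: measurable_funB => //; exact: measurableT_comp.
have prod01 w : 0 <= \prod_(0 <= i < j) bump (z i) (e i) (Z i w) <= 1.
  rewrite prodr_ge0/=; last by move=> i _; exact: bump_ge0.
  by apply: prodr_ile1 => i _; rewrite bump_ge0 bump_le1.
have bF x : `|F x| <= 1.
  rewrite /F normrM; have /andP[p0 p1] := prod01 x.1; rewrite (ger0_norm p0).
  by rewrite mulr_ile1// ler_norml cos_geN1 cos_le1.
transitivity (\int[P]_w \int[g]_y F (w, y)).
  apply: eq_Rintegral => w _; rewrite /F /=.
  rewrite big_nat_recr//= mulrA mulrAC -bump_fourier ?gt_eqF// mulrC -RintegralZl//; last first.
    apply: (@bounded_integrable _ _ _ _ _ 1).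
      apply: (measurableT_comp (continuous_measurable_fun (@continuous_cos R))).
      apply: measurable_funD => //; apply: measurable_funM => //.
    by move=> y; rewrite ler_norml cos_geN1 cos_le1.
  by apply: eq_Rintegral => y _; rewrite mulrC.
rewrite (@bounded_Fubini _ _ _ _ _ P g F 1 mF bF).
pose B := \prod_(0 <= i < j) bump_mean (z i) (e i).
pose V := \sum_(j.+1 <= i < k) c i ^+ 2.
transitivity (\int[g]_y (expR (- V / 2) * B * (cos (th + - z j * y) * expR (- (y ^+ 2 / 2))))).
  apply: eq_Rintegral => y _.
  have := IHj (th - z j * y) (fun i => if i == j then y else c i) (ltnW jk).
  have e1 w : \sum_(j <= i < k) (if i == j then y else c i) * Z i w =
      y * Z j w + \sum_(j.+1 <= i < k) c i * Z i w.
    rewrite big_ltn// eqxx; congr (_ + _); apply: eq_big_nat => i /andP[ji _].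
    by rewrite gtn_eqF.
  have e2 : \sum_(j <= i < k) (if i == j then y else c i) ^+ 2 = y ^+ 2 + V.
    by rewrite big_ltn// eqxx; congr (_ + _); apply: eq_big_nat => i /andP[ji _]; rewrite gtn_eqF.
  rewrite e2.
  under eq_Rintegral do rewrite e1.
  rewrite -/B => h; transitivity (cos (th - z j * y) * expR (- (y ^+ 2 + V) / 2) * B).
    rewrite -h; apply: eq_Rintegral => w _; rewrite /F /=; congr (cos _ * _).
    by ring.
  rewrite -[_ + - z j * y]/(th + - z j * (y : R)) -[(y : R) ^+ 2]/((y : R) ^+ 2).
  have -> : th + - z j * (y : R) = th - z j * y by ring.
  have -> : - ((y : R) ^+ 2 + V) / 2 = - V / 2 + - ((y : R) ^+ 2 / 2) by field.
  by rewrite expRD; ring.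
rewrite RintegralZl//; last first.
  apply: (@bounded_integrable _ _ _ _ _ 1).
    apply: continuous_measurable_fun => y; apply: cvgM; apply: continuous_comp.
    - apply: cvgD; first exact: cvg_cst.
      by apply: cvgM; [exact: cvg_cst|exact: cvg_id].
    - exact: continuous_cos.
    - by apply: cvgN; apply: cvgM; [exact: sqr_continuous|exact: cvg_cst].
    - exact: continuous_expR.
  move=> y; rewrite normrM (ger0_norm (expR_ge0 _)) mulr_ile1 ?expR_ge0//.
    by rewrite ler_norml cos_geN1 cos_le1.
  by rewrite -expR0 ler_expR oppr_le0 divr_ge0 ?sqr_ge0.
rewrite bump_tilt// big_nat_recr//= -/B.
have -> : bump_mean (- z j) (e j) = bump_mean (z j) (e j) by rewrite /bump_mean sqrrN.
by rewrite -/V; ring.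
Qed.

(** Independence of uncorrelated jointly Gaussian variables, tested on bumps. *)
Lemma bump_product (z e : nat -> R) : (forall i, 0 < e i) ->
  \int[P]_w (\prod_(0 <= i < k) bump (z i) (e i) (Z i w)) =
  \prod_(0 <= i < k) bump_mean (z i) (e i).
Proof.
move=> e0; have := bump_product_char z 0 (fun=> 0) (leqnn k) e0.
rewrite !(big_geq (leqnn k)) oppr0 mul0r expR0 cos0 !mul1r => <-.
by apply: eq_Rintegral => w _; rewrite (big_geq (leqnn k)) addr0 cos0 mul1r.
Qed.

Lemma bump_mean_ge0 (z e : R) : 0 < e -> 0 <= bump_mean z e.
Proof. by move=> e0; rewrite /bump_mean mulr_ge0 ?expR_ge0// divr_ge0 ?sqrtr_ge0// ltW. Qed.

Lemma bump_mean_le (z e : R) : 0 < e -> bump_mean z e <= e.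
Proof.
move=> e0; rewrite /bump_mean.
have q1 : 1 <= Num.sqrt (1 + e ^+ 2) by rewrite -[leLHS]sqrtr1 ler_sqrt ?lerDl ?sqr_ge0// addr_ge0// sqr_ge0.
rewrite -[leRHS]mulr1 ler_pM ?expR_ge0 ?divr_ge0 ?sqrtr_ge0 ?(ltW e0)//.
  by rewrite ler_pdivrMr ?(lt_le_trans ltr01)// ler_peMr// ltW.
rewrite -[leRHS]expR0 ler_expR oppr_le0 divr_ge0 ?sqr_ge0// mulr_ge0// addr_ge0 ?sqr_ge0//.
Qed.

Lemma bump_mean_ge (z e : R) : 0 < e -> e <= 1 -> e / 2 * expR (- (z ^+ 2 / 2)) <= bump_mean z e.
Proof.
move=> e0 e1; rewrite /bump_mean.
have q0 : 0 < Num.sqrt (1 + e ^+ 2) by rewrite sqrtr_gt0 ltr_pwDl ?sqr_ge0.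
have q2 : Num.sqrt (1 + e ^+ 2) <= 2.
  rewrite -(ger0_norm (ler0n R 2)) -sqrtr_sqr ler_sqrt ?exprn_ge0//.
  by nra.
apply: ler_pM; rewrite ?expR_ge0 ?divr_ge0 ?(ltW e0)//.
  by rewrite ler_wpM2l ?(ltW e0)// lef_pV2 ?posrE.
rewrite ler_expR lerN2 ler_wpM2l ?sqr_ge0// lef_pV2 ?posrE ?mulr_gt0 ?ltr_pwDl ?sqr_ge0//.
by have := sqr_ge0 e; lra.
Qed.

Lemma expR_half_le2 : expR (1 / 2) <= 2 :> R.
Proof.
have := expR_ge1Dx (- (1 / 2) : R); rewrite expRN => h.
have e0 := expR_gt0 (1 / 2 : R).
by rewrite -[leLHS]invrK -[leRHS]invrK lef_pV2 ?posrE ?invr_gt0//; lra.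
Qed.

Let mbumps (z e : nat -> R) : measurable_fun setT (fun w => \prod_(0 <= i < k) bump (z i) (e i) (Z i w)).
Proof.
apply: measurable_prod => i _.
exact: (measurableT_comp (@measurable_bump R (z i) (e i))).
Qed.

Let bumps01 (z e : nat -> R) w : 0 <= \prod_(0 <= i < k) bump (z i) (e i) (Z i w) <= 1.
Proof.
rewrite prodr_ge0/=; last by move=> i _; exact: bump_ge0.
by apply: prodr_ile1 => i _; rewrite bump_ge0 bump_le1.
Qed.

Let ibumps (z e : nat -> R) : P.-integrable setT (EFin \o (fun w => \prod_(0 <= i < k) bump (z i) (e i) (Z i w))).
Proof.
apply: (@bounded_integrable _ _ _ _ _ 1) => // w.
by have /andP[b0 b1] := bumps01 z e w; rewrite ger0_norm.
Qed.

Lemma measurable_box (z : nat -> R) (dl : R) :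
  measurable [set w | forall i, (i < k)%N -> `|Z i w - z i| <= dl].
Proof.
rewrite (_ : mkset _ = \bigcap_(i in [set i | (i < k)%N]) [set w | `|Z i w - z i| <= dl]).
  apply: bigcap_measurableType => i _.
  rewrite -[X in measurable X]setTI.
  have mf : measurable_fun setT (fun w => `|Z i w - z i|).
    by apply: measurableT_comp => //; apply: measurable_funB.
  by have := mf measurableT _ (measurable_itv `]-oo, dl]); congr (measurable (_ `&` _));
     apply/seteqP; split => w; rewrite /= in_itv.
by apply/seteqP; split => w /= h i; exact: h.
Qed.

(** In each coordinate, the indicator of the box is at most [expR (1 / 2)] times
    a bump. *)
Lemma small_box (rho : R) : 0 < rho ->
  (P [set w | forall i, (i < k)%N -> `|Z i w| <= rho]%R <= ((2 * rho) ^+ k)%:E)%E.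
Proof.
move=> r0; set A := [set w | _].
have mA : measurable A.
  rewrite (_ : A = [set w | forall i, (i < k)%N -> `|Z i w - (fun=> 0) i| <= rho]).
    exact: measurable_box.
  by apply/seteqP; split => w h i ik; have := h i ik; rewrite subr0.
rewrite -[P A]fineK ?fin_num_measure// lee_fin -Rintegral_indic//.
apply: (@le_trans _ _ (\int[P]_w (expR (1 / 2) ^+ k * \prod_(0 <= i < k) bump 0 rho (Z i w)))).
  apply: le_Rintegral => //.
  - apply: (@bounded_integrable _ _ _ _ _ 1); first exact: measurable_indic.
    by move=> w; rewrite indicE; case: (_ \in _); rewrite ?normr0 ?normr1.
  - have := ibumps (fun=> 0) (fun=> rho).
    by apply: (@integrableZl _ _ _ P setT measurableT (expR (1 / 2) ^+ k) (fun w => (\prod_(0 <= i < k) bump 0 rho (Z i w))%:E)).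
  - move=> w _; rewrite indicE; have /andP[b0 _] := bumps01 (fun=> 0) (fun=> rho) w.
    have [|_] := boolP (w \in A); last by rewrite mulr_ge0 ?exprn_ge0 ?expR_ge0.
    rewrite inE => Aw.
    have -> : expR (1 / 2) ^+ k = \prod_(0 <= i < k) expR (1 / 2) :> R.
      by rewrite prodr_const_nat subn0.
    rewrite -big_split /= big_nat.
    apply: (big_ind (fun x => 1 <= x)) => [//|x y|i /andP[_ ik]]; first exact: mulr_ege1.
    rewrite /bump -expRD -[leLHS]expR0 ler_expR subr0.
    rewrite -mulrBl divr_ge0// subr_ge0 -exprMn -[_ * _]mulrC.
    rewrite -real_normK ?num_real// expr_le1// normrM normfV (ger0_norm (ltW r0)).
    by rewrite ler_pdivrMr// mul1r Aw.
have i0 : P.-integrable setT (EFin \o (fun w => \prod_(0 <= i < k) bump 0 rho (Z i w))).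
  exact: (ibumps (fun=> 0) (fun=> rho)).
rewrite RintegralZl//.
rewrite (bump_product (fun=> 0) (e := fun=> rho))// prodr_const_nat subn0 -exprMn.
rewrite lerXn2r ?nnegrE ?mulr_ge0 ?expR_ge0 ?bump_mean_ge0 ?(ltW r0)//.
by rewrite ler_pM ?expR_ge0 ?bump_mean_ge0 ?expR_half_le2 ?bump_mean_le.
Qed.

(** A product of bumps of width [e] around [z] is mostly carried by the box of
    half-width [dl], and where it is not, it is dominated by a small multiple of
    a product of bumps one of which has width [2 e]. *)
Lemma box_lower_bound (z : nat -> R) (dl e : R) : 0 < e -> e <= 1 ->
    \sum_(0 <= i < k) z i ^+ 2 <= k%:R -> 16 * k%:R * e ^+ 2 <= dl ^+ 2 -> 0 < dl ->
  ((1 / 2 * (e / 4) ^+ k)%:E <=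
    P [set w | forall i, (i < k)%N -> `|Z i w - z i| <= dl]%R)%E.
Proof.
move=> e0 e1 zk dle dl0; set A := [set w | _].
have mA : measurable A by exact: measurable_box.
rewrite -[P A]fineK ?fin_num_measure// lee_fin -Rintegral_indic//.
pose G w := \prod_(0 <= i < k) bump (z i) e (Z i w).
pose ee (j i : nat) := if i == j then 2 * e else e.
have ee0 j i : 0 < ee j i by rewrite /ee; case: ifP => _ //; rewrite mulr_gt0.
pose H j w := \prod_(0 <= i < k) bump (z i) (ee j i) (Z i w).
pose q := expR (- (3 / 8 * (dl / e) ^+ 2)).
pose B := \prod_(0 <= i < k) bump_mean (z i) e.
have zi i : (i < k)%N -> z i ^+ 2 <= k%:R.
  move=> ik; apply: le_trans zk; rewrite big_mkord (bigD1 (Ordinal ik))//= lerDl.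
  by apply: sumr_ge0 => j _; rewrite sqr_ge0.
have B_ge : (e / 4) ^+ k <= B.
  apply: (@le_trans _ _ (\prod_(0 <= i < k) (e / 2 * expR (- (z i ^+ 2 / 2))))); last first.
    rewrite /B; apply: ler_prod => i _; rewrite bump_mean_ge// andbT.
    by rewrite mulr_ge0 ?expR_ge0 ?divr_ge0 ?(ltW e0).
  rewrite big_split /= prodr_const_nat subn0.
  have -> : \prod_(0 <= i < k) expR (- (z i ^+ 2 / 2)) = expR (- (\sum_(0 <= i < k) z i ^+ 2) / 2).
    by rewrite -expR_sum; congr expR; rewrite -sumrN mulr_suml; apply: eq_bigr => i _; rewrite mulNr.
  have -> : e / 4 = e / 2 * (1 / 2) by field.
  rewrite exprMn ler_wpM2l ?exprn_ge0 ?divr_ge0 ?(ltW e0)//.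
  apply: (@le_trans _ _ (expR (- (k%:R * (1 / 2))))); last by rewrite ler_expR; lra.
  rewrite expRN expRM_natl -exprVn lerXn2r ?nnegrE ?invr_ge0 ?expR_ge0//.
  rewrite -[leRHS]mul1r ler_pdivlMr ?expR_gt0//.
  by have := expR_half_le2; lra.
have B0 : 0 <= B by apply: le_trans B_ge; rewrite exprn_ge0// divr_ge0 ?ltW.
have iG : P.-integrable setT (EFin \o G) by exact: (ibumps z (fun=> e)).
have iH j : P.-integrable setT (EFin \o H j) by exact: (ibumps z (ee j)).
have iqH j : P.-integrable setT (EFin \o (fun w => q * H j w)).
  apply: (@integrableZl _ _ _ P setT measurableT q (fun w => (H j w)%:E)).
  exact: iH.
have iS : P.-integrable setT (EFin \o (fun w => \sum_(0 <= j < k) q * H j w)).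
  exact: integrable_sumR.
have EH j : (j < k)%N -> \int[P]_w H j w <= 4 * expR (k%:R / 2) * B.
  move=> jk; rewrite /H bump_product; last exact: ee0.
  have sp (F : nat -> R) : \prod_(0 <= i < k) F i = F j * \prod_(i < k | i != j :> nat) F i.
    by rewrite big_mkord (bigD1 (Ordinal jk)).
  rewrite /B !sp /ee eqxx mulrA.
  have -> : \prod_(i < k | i != j :> nat) bump_mean (z i) (if i == j :> nat then 2 * e else e) =
     \prod_(i < k | i != j :> nat) bump_mean (z i) e.
    by apply: eq_bigr => i /negbTE ->.
  rewrite ler_wpM2r//.
    by apply: prodr_ge0 => i _; rewrite bump_mean_ge0.
  apply: (@le_trans _ _ (2 * e)); first by rewrite bump_mean_le ?mulr_gt0.
  have h := bump_mean_ge (z j) e0 e1.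
  apply: (le_trans _ (ler_wpM2l _ h)); last by rewrite mulr_ge0 ?expR_ge0.
  have -> : 4 * expR (k%:R / 2) * (e / 2 * expR (- (z j ^+ 2 / 2))) = 2 * e * (expR (k%:R / 2) * expR (- (z j ^+ 2 / 2))).
    by field.
  rewrite ler_peMr ?mulr_ge0 ?(ltW e0)// -expRD -[leLHS]expR0 ler_expR.
  by have := zi j jk; lra.
have qk : k%:R * (q * (4 * expR (k%:R / 2))) <= 1 / 2.
  have [->|k0] := posnP k; first by rewrite mul0r divr_ge0.
  have qe : q <= expR (- (6 * k%:R)).
    rewrite /q ler_expR lerN2 expr_div_n -ler_pdivrMl// ler_pdivlMr ?exprn_gt0//.
    by apply: le_trans dle; rewrite -mulrA; lra.
  apply: (@le_trans _ _ (k%:R * (expR (- (6 * k%:R)) * (4 * expR (k%:R / 2))))).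
    by rewrite ler_wpM2l// ler_wpM2r// mulr_ge0 ?expR_ge0.
  have -> : k%:R * (expR (- (6 * k%:R)) * (4 * expR (k%:R / 2))) =
     (4 * k%:R) * (expR (- (6 * k%:R)) * expR (k%:R / 2)) :> R by ring.
  rewrite -expRD.
  have -> : - (6 * k%:R) + k%:R / 2 = - (11 / 4 * k%:R + 11 / 4 * k%:R) :> R by field.
  rewrite expRN expRD ler_pdivrMr ?mulr_gt0 ?expR_gt0//.
  have := expR_ge1Dx (11 / 4 * k%:R : R) => h.
  have k1 : 1 <= k%:R :> R by rewrite ler1n.
  by nra.
apply: (@le_trans _ _ (\int[P]_w (G w - \sum_(0 <= j < k) q * H j w))).
  rewrite RintegralB// {1}/G bump_product//.
  have -> : \int[P]_w (\sum_(0 <= j < k) q * H j w) = \sum_(0 <= j < k) q * \int[P]_w H j w.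
    rewrite Rintegral_sum//; apply: eq_bigr => j _.
    by rewrite RintegralZl//; exact: iH.
  have : \sum_(0 <= j < k) q * \int[P]_w H j w <= \sum_(0 <= j < k) q * (4 * expR (k%:R / 2) * B).
    by apply: ler_sum_nat => j /andP[_ jk]; rewrite ler_wpM2l ?expR_ge0// EH.
  rewrite sumr_const_nat subn0 => h.
  have hE : q * (4 * expR (k%:R / 2) * B) *+ k = k%:R * (q * (4 * expR (k%:R / 2))) * B.
    by rewrite -[LHS]mulr_natl; ring.
  rewrite hE in h.
  by have := ler_wpM2r B0 qk; rewrite -/B; lra.
apply: le_Rintegral => //.
- exact: (integrableB measurableT iG iS).
- apply: (@bounded_integrable _ _ _ _ _ 1); first exact: measurable_indic.
  by move=> w; rewrite indicE; case: (_ \in _); rewrite ?normr0 ?normr1.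
- move=> w _; rewrite indicE.
  have H0 j : 0 <= q * H j w.
    by rewrite mulr_ge0 ?expR_ge0//; have /andP[] := bumps01 z (ee j) w.
  have [wA|] := boolP (w \in A).
    have /andP[_ G1] := bumps01 z (fun=> e) w.
    by rewrite lerBlDr (le_trans G1)// lerDl sumr_ge0.
  rewrite notin_setE /A /= => /existsNP[j /not_implyP[jk /negP]]; rewrite -ltNge => zj.
  rewrite subr_le0.
  apply: (@le_trans _ _ (q * H j w)); last first.
    by rewrite [leRHS]big_mkord (bigD1 (Ordinal jk))//= lerDl sumr_ge0.
  have sp (F : nat -> R) : \prod_(0 <= i < k) F i = F j * \prod_(i < k | i != j :> nat) F i.
    by rewrite big_mkord (bigD1 (Ordinal jk)).
  rewrite /G /H !sp /ee eqxx mulrA.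
  have -> : \prod_(i < k | i != j :> nat) bump (z i) (if i == j :> nat then 2 * e else e) (Z i w) =
     \prod_(i < k | i != j :> nat) bump (z i) e (Z i w).
    by apply: eq_bigr => i /negbTE ->.
  rewrite ler_wpM2r//; first by apply: prodr_ge0 => i _; exact: bump_ge0.
  rewrite /bump /q -expRD ler_expR.
  set x := Z j w - z j in zj *.
  have hx : dl ^+ 2 <= x ^+ 2 by rewrite -[leRHS]real_normK ?num_real// ler_pXn2r ?nnegrE// ltW.
  have : (dl / e) ^+ 2 <= (x / e) ^+ 2.
    by rewrite !expr_div_n ler_wpM2r// invr_ge0 sqr_ge0.
  have -> : e^-1 ^+ 2 * x ^+ 2 = (x / e) ^+ 2 by rewrite -exprMn mulrC.
  have -> : (2 * e)^-1 ^+ 2 * x ^+ 2 = (x / e) ^+ 2 / 4 by field; rewrite gt_eqF.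
  by lra.
Qed.

End GaussianCoordinates.

(** * Gaussian vectors with a covariance bounded below *)

Section PositiveDefinite.
Context {R : realType}.

Definition quad n (S : 'M[R]_n) (v : 'rV[R]_n) : R := (v *m S *m v^T) 0 0.
Definition sqn n (v : 'rV[R]_n) : R := (v *m v^T) 0 0.

Lemma sqnE n (v : 'rV[R]_n) : sqn v = \sum_i v 0 i ^+ 2.
Proof. by rewrite /sqn mxE; apply: eq_bigr => i _; rewrite mxE expr2. Qed.

Lemma sqn_ge0 n (v : 'rV[R]_n) : 0 <= sqn v.
Proof. by rewrite sqnE sumr_ge0// => i _; rewrite sqr_ge0. Qed.

(** Symmetric Gaussian elimination; taking a Schur complement keeps the lower
    bound on the quadratic form. *)
Lemma positive_definite_factor (lam : R) n (S : 'M[R]_n) : 0 < lam -> S^T = S ->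
    (forall v, lam * sqn v <= quad S v) ->
  exists B : 'M[R]_n, B *m S *m B^T = 1%:M.
Proof.
move=> lam0; elim: n S => [|n IHn] S Ssym Sge.
  by exists 1%:M; apply/matrixP => -[].
move: S Ssym Sge; rewrite -[n.+1]/(1 + n)%N => S Ssym Sge.
have [a [b [D SE]]] : exists (a : R) (b : 'M[R]_(1, n)) (D : 'M[R]_n),
    S = block_mx (a%:M : 'M[R]_1) b (b^T) D.
  exists (S 0 0), (@ursubmx _ 1 n 1 n S), (@drsubmx _ 1 n 1 n S).
  have e1 : @ulsubmx _ 1 n 1 n S = (S 0 0)%:M.
    by apply/matrixP => i j; rewrite !mxE !ord1 eqxx mulr1n; congr (S _ _); apply/val_inj.
  have e2 : @dlsubmx _ 1 n 1 n S = (@ursubmx _ 1 n 1 n S)^T.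
    by rewrite -{1}Ssym; apply/matrixP => i j; rewrite !mxE.
  by rewrite -[LHS](@submxK _ 1 n 1 n S) e1 e2.
have a0 : 0 < a.
  have := Sge (row_mx 1%:M 0 : 'M[R]_(1, 1 + n)).
  have -> : sqn (row_mx 1%:M 0 : 'M[R]_(1, 1 + n)) = 1.
    by rewrite /sqn tr_row_mx mul_row_col trmx1 trmx0 !mulmx1 mulmx0 addr0 mxE.
  rewrite /quad SE mul_row_block !mul1mx !mul0mx !addr0 tr_row_mx mul_row_col.
  rewrite trmx1 trmx0 mulmx1 mulmx0 addr0 mxE eqxx mulr1n mulr1.
  exact: lt_le_trans.
pose E : 'M[R]_(1 + n) := block_mx (1%:M : 'M[R]_1) 0 (- a^-1 *: b^T) 1%:M.
pose S' := D - a^-1 *: (b^T *m b).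
have aV : a * a^-1 = 1 by rewrite mulfV// gt_eqF.
have ESE : E *m S *m E^T = block_mx (a%:M : 'M[R]_1) 0 0 S'.
  rewrite SE /E mulmx_block tr_block_mx mulmx_block.
  rewrite !mul1mx !mul0mx !addr0 !trmx1 !trmx0 !mulmx1 !mulmx0 !addr0.
  have trE : (- a^-1 *: b^T)^T = - a^-1 *: b by rewrite linearZ /= trmxK.
  rewrite trE -!scalemxAl -!scalemxAr mul_mx_scalar mul_scalar_mx !scalerA.
  have -> : - a^-1 * a = -1 by rewrite mulNr mulVf ?gt_eqF.
  have z1 : -1 *: b + b = 0 by rewrite scaleN1r addNr.
  have z2 : -1 *: b^T + b^T = 0 by rewrite scaleN1r addNr.
  by rewrite z1 z2 mul0mx scaler0 add0r /S' scaleNr addrC.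
have S'sym : S'^T = S'.
  have Dsym : D^T = D.
    have : block_mx (a%:M : 'M[R]_1) b (b^T) D = (block_mx (a%:M : 'M[R]_1) b (b^T) D)^T by rewrite -SE Ssym.
    by rewrite tr_block_mx => /eq_block_mx[_ _ _ /esym].
  by rewrite /S' linearB /= linearZ /= trmx_mul trmxK Dsym.
have S'ge w : lam * sqn w <= quad S' w.
  pose v := (row_mx 0 w : 'M[R]_(1, 1 + n)) *m E.
  have -> : quad S' w = quad S v.
    rewrite /quad /v trmx_mul !mulmxA -(mulmxA _ E) -(mulmxA _ (E *m S)) ESE.
    rewrite mul_row_block tr_row_mx !mul0mx !add0r mulmx0 mul_row_col trmx0 mulmx0 add0r.
    by [].
  apply: (le_trans _ (Sge v)); rewrite ler_pM2l//.
  rewrite /v /E mul_row_block !mul0mx !add0r mulmx1 /sqn tr_row_mx mul_row_col [leRHS]mxE.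
  by rewrite lerDr -/(sqn _) sqn_ge0.
have [B' B'E] := IHn S' S'sym S'ge.
pose G : 'M[R]_(1 + n) := block_mx ((Num.sqrt a)^-1%:M : 'M[R]_1) 0 0 B'.
exists (G *m E).
rewrite trmx_mul !mulmxA -(mulmxA _ E) -(mulmxA _ (E *m S)) ESE /G.
rewrite mulmx_block tr_block_mx mulmx_block !mul0mx !mulmx0 !addr0 !trmx0 !mulmx0 !mul0mx !add0r !addr0 B'E.
rewrite tr_scalar_mx -!scalar_mxM.
rewrite (_ : (Num.sqrt a)^-1 * a * (Num.sqrt a)^-1 = 1) ?scalar_mx_block//.
by rewrite mulrAC -invfM -expr2 sqr_sqrtr ?ltW// mulVf// gt_eqF.
Qed.

(** [B] is an inverse square root of [S] up to an orthogonal factor, and [S] is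
    bounded below by [lam]. *)
Lemma factor_contracts (lam : R) n (S B : 'M[R]_n) (x : 'cV[R]_n) : 0 < lam ->
    (forall v, lam * sqn v <= quad S v) -> B *m S *m B^T = 1%:M ->
  sqn (B *m x)^T <= sqn x^T / lam.
Proof.
move=> lam0 Sge BSB; have [y yE] : exists y, y = B *m x by exists (B *m x).
rewrite -yE; pose v := y^T *m B.
have h1 : lam * sqn v <= sqn y^T.
  apply: (le_trans (Sge v)).
  by rewrite /quad /v trmx_mul !mulmxA -(mulmxA _ B) -(mulmxA _ (B *m S)) BSB mulmx1.
have h2 : sqn y^T = \sum_i v 0 i * x i 0.
  by rewrite /sqn trmxK {2}yE mulmxA -/v mxE.
have h3 : 2 * sqn y^T <= lam * sqn v + sqn x^T / lam.
  rewrite h2 !sqnE !mulr_sumr mulr_suml -big_split /=; apply: ler_sum => i _.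
  rewrite [x^T _ _]mxE -subr_ge0.
  have -> : lam * v 0 i ^+ 2 + x i 0 ^+ 2 / lam - 2 * (v 0 i * x i 0) =
    lam * (v 0 i - x i 0 / lam) ^+ 2 by field; rewrite gt_eqF.
  by rewrite mulr_ge0 ?sqr_ge0// ltW.
by lra.
Qed.

End PositiveDefinite.

Section GaussianVector.
Context {R : realType} d (Om : measurableType d) (P : probability Om R).
Variables (N : nat) (X : nat -> Om -> R) (S : 'M[R]_N) (lam : R).
Hypothesis mX : forall i, measurable_fun setT (X i).
Hypothesis lam0 : 0 < lam.
Hypothesis Ssym : S^T = S.
Hypothesis Sge : forall v, lam * sqn v <= quad S v.
Hypothesis charX : forall th (a : 'rV[R]_N),
  \int[P]_w cos (th + \sum_(i < N) a 0 i * X i w) = cos th * expR (- quad S a / 2).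

Let vec w : 'cV[R]_N := \col_i X i w.

Let Z (B : 'M[R]_N) (j : nat) (w : Om) : R :=
  oapp (fun j' : 'I_N => (B *m vec w) j' 0) 0 (insub j).

Let ZE B (j : 'I_N) w : Z B j w = (B *m vec w) j 0.
Proof. by rewrite /Z valK. Qed.

Let mZ B j : measurable_fun setT (Z B j).
Proof.
rewrite /Z; case: insubP => [j' _ _|_] /=; last exact: measurable_cst.
rewrite (_ : (fun w => _) = fun w => \sum_i B j' i * X i w).
  by apply: measurable_sum => i; apply: measurable_funM.
by apply/funext => w; rewrite mxE; apply: eq_bigr => i _; rewrite mxE.
Qed.

Let charZ B : B *m S *m B^T = 1%:M -> forall th (c : nat -> R),
  \int[P]_w cos (th + \sum_(0 <= i < N) c i * Z B i w) =
  cos th * expR (- (\sum_(0 <= i < N) c i ^+ 2) / 2).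
Proof.
move=> BSB th c; pose c' : 'rV[R]_N := \row_i c i.
have -> : \sum_(0 <= i < N) c i ^+ 2 = quad S (c' *m B).
  rewrite /quad trmx_mul !mulmxA -(mulmxA _ B) -(mulmxA _ (B *m S)) BSB mulmx1.
  by rewrite -/(sqn c') sqnE big_mkord; apply: eq_bigr => i _; rewrite mxE.
rewrite -charX; apply: eq_Rintegral => w _; congr (cos (_ + _)).
have -> : \sum_(i < N) (c' *m B) 0 i * X i w = (c' *m B *m vec w) 0 0.
  by rewrite [RHS]mxE; apply: eq_bigr => i _; rewrite [vec w _ _]mxE.
rewrite -mulmxA [RHS]mxE big_mkord; apply: eq_bigr => i _.
by rewrite ZE [c' _ _]mxE.
Qed.

(** The vector [B X] has independent standard coordinates, and on the
    event it lies, by [factor_contracts], in a box of half-width [sqrt (N / lam) e]. *)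
Lemma small_ball (e : R) : 0 < e -> (0 < N)%N ->
  (P [set w | forall i, (i < N)%N -> `|X i w| <= e]%R <=
   ((2 * (Num.sqrt (N%:R / lam) * e)) ^+ N)%:E)%E.
Proof.
move=> e0 N0; have [B BSB] := positive_definite_factor lam0 Ssym Sge.
set rho := Num.sqrt (N%:R / lam) * e.
have r0 : 0 < rho by rewrite mulr_gt0// sqrtr_gt0 divr_gt0// ltr0n.
apply: (le_trans _ (small_box (mZ B) (charZ BSB) r0)).
apply: le_measure; rewrite ?inE.
- rewrite (_ : mkset _ = [set w | forall i, (i < N)%N -> `|X i w - (fun=> 0) i| <= e]).
    exact: (@measurable_box R d Om N X mX (fun=> 0) e).
  by apply/seteqP; split => w h i iN; have := h i iN; rewrite subr0.
- rewrite (_ : mkset _ = [set w | forall i, (i < N)%N -> `|Z B i w - (fun=> 0) i| <= rho]).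
    exact: (@measurable_box R d Om N (Z B) (mZ B) (fun=> 0) rho).
  by apply/seteqP; split => w h i iN; have := h i iN; rewrite subr0.
move=> w /= Xe j jN.
rewrite (_ : j = Ordinal jN)// ZE.
have := factor_contracts (vec w) lam0 Sge BSB.
rewrite !sqnE => h.
rewrite -ler_sqr ?nnegrE ?(ltW r0)// real_normK ?num_real//.
have h1 : (B *m vec w) (Ordinal jN) 0 ^+ 2 <= \sum_i (B *m vec w)^T 0 i ^+ 2.
  rewrite (bigD1 (Ordinal jN))//= [X in _ <= X ^+ 2 + _]mxE lerDl sumr_ge0// => i _.
  by rewrite sqr_ge0.
apply: (le_trans h1); apply: (le_trans h).
rewrite /rho exprMn sqr_sqrtr ?divr_ge0 ?(ltW lam0)// mulrAC ler_wpM2r ?invr_ge0 ?(ltW lam0)//.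
rewrite mulr_natl -[X in _ *+ X](card_ord N) -sumr_const; apply: ler_sum => i _.
rewrite !mxE -real_normK ?num_real// ler_sqr ?nnegrE ?(ltW e0)//.
by apply: Xe; exact: ltn_ord.
Qed.

(** The box around [B v], for [v] the alternating vector of height [sqrt lam],
    is mapped by the inverse of [B] into the alternating orthant. *)
Lemma alternating_signs : lam <= 1 -> (0 < N)%N -> (forall i, S i i = 1) ->
  ((1 / 2 * (Num.sqrt lam / (32 * N%:R)) ^+ N)%:E <=
   P [set w | forall i, (i < N)%N -> 0 < (-1) ^+ i * X i w]%R)%E.
Proof.
move=> lam1 N0 Sd; have [B BSB] := positive_definite_factor lam0 Ssym Sge.
have N1 : 1 <= N%:R :> R by rewrite ler1n.
have Np : 0 < N%:R :> R by rewrite ltr0n.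
set eta := Num.sqrt lam.
have eta0 : 0 < eta by rewrite sqrtr_gt0.
have eta2 : eta ^+ 2 = lam by rewrite sqr_sqrtr// ltW.
have eta1 : eta <= 1 by rewrite -ler_sqr ?nnegrE ?(ltW eta0)// eta2 expr1n.
pose sN : R := Num.sqrt N%:R.
have sN0 : 0 < sN by rewrite sqrtr_gt0.
have sN2 : sN ^+ 2 = N%:R by rewrite sqr_sqrtr.
pose v : 'cV[R]_N := \col_i ((-1) ^+ i * eta).
pose z (j : nat) : R := oapp (fun j' : 'I_N => (B *m v) j' 0) 0 (insub j).
have zE (j : 'I_N) : z j = (B *m v) j 0 by rewrite /z valK.
(* The rows of [invmx B] are unit vectors, so that a box of half-width [dl]
   moves each coordinate of [X] by at most [sN * dl = eta / 2]. *)
pose dl := eta / (2 * sN).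
have dl0 : 0 < dl by rewrite divr_gt0 ?mulr_gt0.
pose e := eta / (8 * N%:R).
have e0 : 0 < e by rewrite divr_gt0 ?mulr_gt0.
have e1 : e <= 1 by rewrite ler_pdivrMr ?mulr_gt0// mul1r (le_trans eta1)//; lra.
have zN : \sum_(0 <= i < N) z i ^+ 2 <= N%:R.
  have := factor_contracts v lam0 Sge BSB; rewrite !sqnE.
  have -> : (\sum_i v^T 0 i ^+ 2) / lam = N%:R.
    rewrite mulr_suml.
    rewrite (eq_bigr (fun=> 1)) ?sumr_const ?card_ord// => i _.
    by rewrite !mxE exprMn sqrr_sign mul1r eta2 mulfV// gt_eqF.
  rewrite big_mkord; congr (_ <= _); apply: eq_bigr => i _.
  by rewrite zE [in LHS]mxE.
have dle : 16 * N%:R * e ^+ 2 <= dl ^+ 2.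
  rewrite /dl /e !expr_div_n !exprMn eta2 sN2 le_eqVlt; apply/orP; left; apply/eqP.
  by field; rewrite gt_eqF.
have := box_lower_bound (mZ B) (charZ BSB) e0 e1 zN dle dl0.
have -> : e / 4 = eta / (32 * N%:R) by rewrite /e; field; rewrite gt_eqF.
move=> /le_trans; apply.
apply: le_measure; rewrite ?inE.
- exact: (@measurable_box R d Om N (Z B) (mZ B) z dl).
- rewrite (_ : mkset _ = \bigcap_(i in [set i | (i < N)%N]) [set w | 0 < (-1) ^+ i * X i w]).
    apply: bigcap_measurableType => i _.
    rewrite -[X in measurable X]setTI.
    have mf : measurable_fun setT (fun w => (-1) ^+ i * X i w) by apply: measurable_funM.
    by have := mf measurableT _ (measurable_itv `]0, +oo[); congr (measurable (_ `&` _));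
      apply/seteqP; split => w; rewrite /= in_itv /= andbT.
  by apply/seteqP; split => w /= h i; exact: h.
move=> w /= box i iN.
have uB : B \in unitmx.
  by have := BSB; rewrite -mulmxA => /mulmx1_unit[].
pose L := invmx B.
have LL : L *m L^T = S.
  have : L *m (B *m S *m B^T) *m L^T = S.
    by rewrite !mulmxA mulVmx// mul1mx -mulmxA -trmx_mul mulVmx// trmx1 mulmx1.
  by rewrite BSB mulmx1.
have Lrow : \sum_j L (Ordinal iN) j ^+ 2 = 1.
  rewrite -(Sd (Ordinal iN)) -LL mxE; apply: eq_bigr => j _.
  by rewrite [L^T _ _]mxE expr2.
pose u : 'cV[R]_N := B *m vec w - B *m v.
have uE : L *m u = vec w - v by rewrite /u -mulmxBr mulKmx.
have ub j : u j 0 ^+ 2 <= dl ^+ 2.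
  have := box j (ltn_ord j); rewrite ZE zE => h.
  have -> : u j 0 = (B *m vec w) j 0 - (B *m v) j 0 by rewrite [LHS]mxE [X in _ + X]mxE.
  by rewrite -real_normK ?num_real// ler_sqr ?nnegrE ?(ltW dl0).
set x := X i w - (-1) ^+ i * eta.
have xE : x = \sum_j L (Ordinal iN) j * u j 0.
  have /matrixP/(_ (Ordinal iN) 0) := uE.
  rewrite [RHS]mxE [X in _ = X + _]mxE [X in _ = _ + X]mxE [X in _ = _ - X]mxE.
  by rewrite -/x => <-; rewrite mxE.
have half : `|x| <= eta / 2.
  have bnd s : s ^+ 2 = 1 -> s * x <= eta / 2.
    move=> s2; suff : 2 * (s * x) <= eta by lra.
    have -> : eta = (eta / 2) * (\sum_j L (Ordinal iN) j ^+ 2) + (2 / eta) * (\sum_(j < N) dl ^+ 2).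
      rewrite Lrow sumr_const card_ord -mulr_natl /dl expr_div_n exprMn sN2.
      by field; rewrite !gt_eqF.
    apply: (@le_trans _ _ ((eta / 2) * (\sum_j L (Ordinal iN) j ^+ 2) + (2 / eta) * (\sum_j u j 0 ^+ 2))); last first.
      by rewrite lerD2l ler_wpM2l ?divr_ge0 ?(ltW eta0)//; apply: ler_sum.
    rewrite xE !mulr_sumr -big_split /=; apply: ler_sum => j _.
    rewrite -subr_ge0.
    have -> : eta / 2 * L (Ordinal iN) j ^+ 2 + 2 / eta * u j 0 ^+ 2 - 2 * (s * (L (Ordinal iN) j * u j 0)) =
      eta / 2 * (L (Ordinal iN) j - 2 / eta * (s * u j 0)) ^+ 2 + 2 / eta * u j 0 ^+ 2 * (1 - s ^+ 2).
      by field; rewrite gt_eqF.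
    by rewrite s2 subrr mulr0 addr0 mulr_ge0 ?sqr_ge0// divr_ge0 ?(ltW eta0).
  have b1 := bnd 1 (expr1n _ _); have b2 := bnd (-1) (sqrr_sign _ 1).
  by rewrite ler_norml; apply/andP; split; lra.
have -> : X i w = x + (-1) ^+ i * eta by rewrite /x subrK.
rewrite mulrDr mulrA -expr2 sqrr_sign mul1r.
have : `|(-1) ^+ i * x| <= eta / 2 by rewrite normrM normrX normrN1 expr1n mul1r.
by rewrite ler_norml => /andP[h _]; lra.
Qed.

End GaussianVector.

(** * Linear combinations of values of the process *)

Section ProcessLaw.
Context {R : realType} d (Om : measurableType d) (P : probability Om R).
Variables (X : R -> {RV P >-> R}) (mu : probability (measurableTypeR R) R).
Hypothesis HX : smooth_stationary_gaussian X mu.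

Let gX : gaussian_process X. Proof. by case: HX. Qed.
Let cX : centered X. Proof. by case: HX. Qed.
Let sX : stationary X. Proof. by case: HX. Qed.
Let muX : spectral_measure_of X mu. Proof. by case: HX. Qed.

Lemma measurable_process t : measurable_fun setT (X t : Om -> R).
Proof. exact: measurable_funPT. Qed.

Lemma measurable_lincomb n (t a : 'I_n -> R) :
  measurable_fun setT (fun w => \sum_(i < n) a i * X (t i) w).
Proof.
by apply: measurable_sum => i; apply: measurable_funM => //; exact: measurable_process.
Qed.

Let lawX t : exists m s : R, forall A : set (measurableTypeR R), measurable A ->
  P [set w | A (X t w)] = gaussian_law m s A.
Proof.
have [m [s h]] := @gX 1%N (fun=> t) (fun=> 1).
exists m, s => A mA; rewrite -h//; congr (P _); apply/seteqP.
by split => w /=; rewrite big_ord1 mul1r.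
Qed.

Let iX1 t : P.-integrable setT (EFin \o X t).
Proof.
have [m [s h]] := lawX t.
have i1 := integrable_law_linear (measurable_process t) h.
have i2 : P.-integrable setT (EFin \o (fun=> m)).
  by apply: (@bounded_integrable _ _ _ P _ `|m|).
have := integrableD measurableT i1 i2.
by congr (P.-integrable _ _); apply/funext => w /=; rewrite -EFinD subrK.
Qed.

Let EX t : \int[P]_w X t w = 0.
Proof. by have := cX t; rewrite unlock /Rintegral => ->. Qed.

Lemma lincomb_law n (t a : 'I_n -> R) : exists s : R,
  forall A : set (measurableTypeR R), measurable A ->
  P [set w | A (\sum_(i < n) a i * X (t i) w)] = gaussian_law 0 s A.
Proof.
have [m [s h]] := gX t a; exists s.
suff m0 : m = 0 by move: h; rewrite m0.
have i1 := integrable_law_linear (measurable_lincomb t a) h.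
have := law_mean (measurable_lincomb t a) h.
have iY : P.-integrable setT (EFin \o (fun w => \sum_(i < n) a i * X (t i) w)).
  by apply: integrable_sumR => i; apply: integrable_ZlR.
have im : P.-integrable setT (EFin \o (fun=> m)).
  by apply: (@bounded_integrable _ _ _ P _ `|m|).
rewrite RintegralB// Rintegral_sum; last by move=> i; apply: integrable_ZlR.
rewrite big1; last by move=> i _; rewrite RintegralZl// EX mulr0.
rewrite sub0r => /eqP; rewrite oppr_eq0 => /eqP.
by rewrite /Rintegral integral_cst//= (probability_setT P) mule1.
Qed.

Lemma lincomb_sqr n (t a : 'I_n -> R) (s : R) :
  (forall A : set (measurableTypeR R), measurable A ->
  P [set w | A (\sum_(i < n) a i * X (t i) w)] = gaussian_law 0 s A) ->
  P.-integrable setT (EFin \o (fun w => (\sum_(i < n) a i * X (t i) w) ^+ 2)) /\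
  \int[P]_w ((\sum_(i < n) a i * X (t i) w) ^+ 2) = s ^+ 2.
Proof.
move=> h; split.
  have := integrable_law_sqr (measurable_lincomb t a) h.
  by congr (P.-integrable _ _); apply/funext => w /=; rewrite subr0.
rewrite -(law_variance (measurable_lincomb t a) h).
by apply: eq_Rintegral => w _; rewrite subr0.
Qed.

Let iX2 t : P.-integrable setT (EFin \o (fun w => X t w ^+ 2)).
Proof.
have [s h] := @lincomb_law 1%N (fun=> t) (fun=> 1).
have [+ _] := lincomb_sqr h.
by congr (P.-integrable _ _); apply/funext => w /=; rewrite big_ord1 mul1r.
Qed.

Let iXX s t : P.-integrable setT (EFin \o (fun w => X s w * X t w)).
Proof.
apply: (@le_integrable _ _ _ P setT measurableT _ (EFin \o (fun w => X s w ^+ 2 + X t w ^+ 2))).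
- by apply/measurable_EFinP/measurable_funM; exact: measurable_process.
- move=> w _ /=; rewrite lee_fin [leRHS]ger0_norm ?addr_ge0 ?sqr_ge0// ler_norml.
  have := sqr_ge0 (X s w + X t w); have := sqr_ge0 (X s w - X t w).
  by move=> h1 h2; apply/andP; split; nra.
- exact: (integrableD measurableT (iX2 s) (iX2 t)).
Qed.

Let shift_sum s t h (A : set (measurableTypeR R)) : measurable A ->
  P [set w | A (X (s + h) w + X (t + h) w)] = P [set w | A (X s w + X t w)].
Proof.
move=> mA.
pose A' : set (2.-tuple (measurableTypeR R)) :=
  [set u | A ((tnth u ord0 : R) + (tnth u (lift ord0 ord0) : R))].
have mA' : measurable A'.
  have mf : measurable_fun setT (fun u : 2.-tuple (measurableTypeR R) =>
      (tnth u ord0 : R) + (tnth u (lift ord0 ord0) : R)).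
    by apply: measurable_funD; exact: measurable_tnth.
  by have := mf measurableT _ mA; rewrite setTI.
have := sX [tuple s; t] h mA'.
congr (P _ = P _); apply/seteqP; split => w; rewrite /A' /= !tnth_mktuple //=.
Qed.

Let sum2 s t (c : 'I_2 -> R := fun=> 1) (u : 'I_2 -> R := fun i => if i == ord0 then s else t) w :
  \sum_(i < 2) c i * X (u i) w = X s w + X t w.
Proof. by rewrite !big_ord_recl big_ord0 /c /u /= !mul1r addr0. Qed.

Let shift_sqr s t h :
  \int[P]_w ((X (s + h) w + X (t + h) w) ^+ 2) = \int[P]_w ((X s w + X t w) ^+ 2).
Proof.
have [sg lw] := @lincomb_law 2%N (fun i => if i == ord0 then s else t) (fun=> 1).
have [_ h1] := lincomb_sqr lw.
have lw' : forall A : set (measurableTypeR R), measurable A ->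
  P [set w | A (\sum_(i < 2) 1 * X (if i == ord0 then s + h else t + h) w)] = gaussian_law 0 sg A.
  move=> A mA; rewrite -lw//.
  by under eq_set do rewrite sum2; under [in RHS]eq_set do rewrite sum2; exact: shift_sum.
have [_ h2] := @lincomb_sqr 2%N (fun i => if i == ord0 then s + h else t + h) (fun=> 1) sg lw'.
under eq_Rintegral do rewrite -sum2; rewrite h2 -h1.
by apply: eq_Rintegral => w _; rewrite sum2.
Qed.

Let prod_of_sqr s t : 4 * \int[P]_w (X s w * X t w) =
  2 * \int[P]_w ((X s w + X t w) ^+ 2) - 2^-1 * \int[P]_w ((X s w + X s w) ^+ 2)
    - 2^-1 * \int[P]_w ((X t w + X t w) ^+ 2).
Proof.
have sq u v : \int[P]_w ((X u w + X v w) ^+ 2) =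
   \int[P]_w (X u w ^+ 2) + 2 * \int[P]_w (X u w * X v w) + \int[P]_w (X v w ^+ 2).
  rewrite -RintegralZl// -!RintegralD//.
  - by apply: eq_Rintegral => w _; ring.
  - by have := integrableD measurableT (iX2 u) (integrable_ZlR 2 (iXX u v)).
  - exact: integrable_ZlR.
have xx u : \int[P]_w (X u w * X u w) = \int[P]_w (X u w ^+ 2).
  by apply: eq_Rintegral => w _; rewrite expr2.
by rewrite !sq !xx; field.
Qed.

(** Stationarity of the laws of [X s + X t] moves the covariance to the times
    [t - s] and [0], where the spectral measure gives it. *)
Lemma covariance_spectral s t :
  \int[P]_w (X s w * X t w) = \int[mu]_x cos ((t - s) * x).
Proof.
have -> : \int[P]_w (X s w * X t w) = \int[P]_w (X (t - s) w * X 0 w).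
  have four : (4 : R) != 0 by [].
  apply: (mulfI four); rewrite !prod_of_sqr.
  have -> : \int[P]_w ((X s w + X t w) ^+ 2) = \int[P]_w ((X t w + X s w) ^+ 2).
    by apply: eq_Rintegral => w _; rewrite addrC.
  have := shift_sqr (t - s) 0 s; rewrite subrK add0r => ->.
  have := shift_sqr (t - s) (t - s) s; rewrite subrK => ->.
  have := shift_sqr 0 0 s; rewrite add0r => ->.
  by ring.
have := muX (t - s); rewrite /complex_integral /expi /= => /eqP.
rewrite eq_complex /= => /andP[/eqP h _].
transitivity (\int[mu]_x cos (- ((t - s) * x))); last first.
  by apply: eq_Rintegral => x _; rewrite cosN.
by rewrite -h unlock.
Qed.

(** The integral against [mu] of the squared modulus of
    [\sum_j a_j e^(i t_j x)]. *)
Definition spectral_form n (t a : 'I_n -> R) : R :=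
  \int[mu]_x ((\sum_(i < n) a i * cos (t i * x)) ^+ 2
              + (\sum_(i < n) a i * sin (t i * x)) ^+ 2).

Lemma bounded_integrable_cos u : mu.-integrable setT (EFin \o (fun x : measurableTypeR R => cos (u * (x : R)))).
Proof.
apply: (@bounded_integrable _ _ _ mu _ 1).
  apply: continuous_measurable_fun => x; apply: continuous_comp; last exact: continuous_cos.
  by apply: cvgM; [exact: cvg_cst|exact: cvg_id].
by move=> x; rewrite ler_norml cos_geN1 cos_le1.
Qed.

Lemma spectral_form_double_sum n (t a : 'I_n -> R) :
  \sum_(i < n) \sum_(j < n) a i * a j * \int[mu]_x cos ((t j - t i) * x) = spectral_form t a.
Proof.
rewrite /spectral_form.
rewrite [RHS](_ : _ = \int[mu]_x (\sum_(i < n) \sum_(j < n) (a i * a j) * cos ((t j - t i) * x))).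
  rewrite Rintegral_sum; last first.
    by move=> i; apply: integrable_sumR => j; apply: integrable_ZlR; exact: bounded_integrable_cos.
  apply: eq_bigr => i _; rewrite Rintegral_sum; last first.
    by move=> j; apply: integrable_ZlR; exact: bounded_integrable_cos.
  by apply: eq_bigr => j _; rewrite RintegralZl//; exact: bounded_integrable_cos.
apply: eq_Rintegral => x _; rewrite !expr2 !mulr_suml -big_split /=; apply: eq_bigr => i _.
rewrite !mulr_sumr -big_split /=; apply: eq_bigr => j _.
by rewrite mulrBl cosB; ring.
Qed.

Lemma variance_spectral n (t a : 'I_n -> R) :
  \int[P]_w ((\sum_(i < n) a i * X (t i) w) ^+ 2) = spectral_form t a.
Proof.
rewrite -spectral_form_double_sum.
rewrite (_ : \int[P]_w _ = \int[P]_w (\sum_(i < n) \sum_(j < n) (a i * a j) * (X (t i) w * X (t j) w))).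
  rewrite Rintegral_sum; last first.
    by move=> i; apply: integrable_sumR => j; apply: integrable_ZlR.
  apply: eq_bigr => i _; rewrite Rintegral_sum; last by move=> j; apply: integrable_ZlR.
  by apply: eq_bigr => j _; rewrite RintegralZl// covariance_spectral.
apply: eq_Rintegral => w _; rewrite expr2 mulr_suml; apply: eq_bigr => i _.
by rewrite mulr_sumr; apply: eq_bigr => j _; ring.
Qed.

Lemma lincomb_char n (t a : 'I_n -> R) th :
  \int[P]_w cos (th + \sum_(i < n) a i * X (t i) w) =
  cos th * expR (- (spectral_form t a) / 2).
Proof.
have [s h] := lincomb_law t a; have [_ e] := lincomb_sqr h.
have := law_char (measurable_lincomb t a) h th 1.
rewrite expr1n mulr1 -e variance_spectral -mulNr => <-.
by apply: eq_Rintegral => w _; rewrite subr0 mul1r.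
Qed.

Lemma lincomb_tail n (t a : 'I_n -> R) (v sg : R) : 0 <= v -> 0 < sg ->
    spectral_form t a <= sg ^+ 2 ->
  (P [set w | v < `|\sum_(i < n) a i * X (t i) w|]%R
    <= (2 * expR (- (v / sg) ^+ 2 / 4))%:E)%E.
Proof.
move=> v0 sg0 hV; have [s h] := lincomb_law t a; have [_ e] := lincomb_sqr h.
have := law_tail h v0 sg0.
rewrite -e variance_spectral => /(_ hV).
by congr (P _ <= _)%E; apply/seteqP; split => w /=; rewrite subr0.
Qed.

End ProcessLaw.

(** * The absolutely continuous part and the support of a measure *)

Section AbsoluteContinuity.
Context d (T : measurableType d) (R : realType).
Variable nu : {measure set T -> \bar R}.
Hypothesis nufin : fin_num_fun nu.

(** A copy of [nu] that carries the structure of a finite measure. *)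
Definition fin_copy : set T -> \bar R := nu.

HB.instance Definition _ := Measure.on fin_copy.
HB.instance Definition _ := Measure_isFinite.Build _ _ _ fin_copy nufin.

(** For a finite measure, domination has an epsilon-delta form. *)
Lemma dominates_continuous (la : {measure set T -> \bar R}) (e : R) :
  nu `<< la -> 0 < e ->
  exists dl : R, 0 < dl /\
    forall A, measurable A -> (la A < dl%:E)%E -> (nu A < e%:E)%E.
Proof.
move=> nula e0; pose m := charge_of_finite_measure fin_copy.
have [P0 [N0 PN]] := Hahn_decomposition m.
have dom : m `<< la by [].
have [dl [dl0 H]] := charge_variation_continuous PN dom e0.
exists dl; split => // A mA lA; apply: le_lt_trans (H A mA lA).
apply: le_trans (abse_charge_variation PN mA).
exact: lee_abs.
Qed.

End AbsoluteContinuity.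

(** A point off the support has a null neighbourhood with rational end points,
    and there are countably many of these. *)
Lemma compact_support_null (R : realType)
    (mu : {measure set (measurableTypeR R) -> \bar R}) :
  compactly_supported mu ->
  exists A : R, 0 < A /\ mu (~` `[- A, A]%classic) = 0%E.
Proof.
move=> /compact_bounded[M0 [_ HM]].
pose A := Num.max 1 (M0 + 1).
have A0 : 0 < A by rewrite lt_max ltr01.
exists A; split => //.
have HA x : measure_support mu x -> `|x| <= A.
  by apply: HM; rewrite lt_max (_ : M0 < M0 + 1) ?orbT // ltrDl.
pose I (p : rat * rat) : set R := `]ratr p.1, ratr p.2[%classic.
have mI p : measurable (I p : set (measurableTypeR R)) by exact: measurable_itv.
pose G n : set (measurableTypeR R) := if unpickle n is Some p then
  (if mu (I p) == 0%E then I p else set0) else set0.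
have nG : mu.-negligible (\bigcup_n G n).
  apply: negligible_bigcup => k; rewrite /G; case: unpickle => [p|]; last exact: negligible_set0.
  case: eqP => [e|_]; last exact: negligible_set0.
  by exists (I p); split => //; exact: mI.
have mAc : measurable (~` `[- A, A]%classic : set (measurableTypeR R)).
  by apply: measurableC; exact: measurable_itv.
apply/(negligibleP mu mAc).
apply: negligibleS nG => x /= xA.
have nx : ~ measure_support mu x.
  by move=> /HA; rewrite ler_norml => h; apply: xA; rewrite /= in_itv.
have [U [oU Ux U0]] : exists U : set R, [/\ open U, U x & ~ (0 < mu U)%E].
  apply: contrapT => H; apply: nx => U oU Ux; apply: contrapT => h.
  by apply: H; exists U.
have [r /= r0 rU] : exists2 r : R, 0 < r & ball x r `<=` U.
  by have /nbhs_ballP[r r0 rU] := open_nbhs_nbhs (conj oU Ux); exists r.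
have /rat_in_itvoo[q1] : x - r < x by rewrite ltrBlDr ltrDl.
rewrite in_itv /= => /andP[q1l q1r].
have /rat_in_itvoo[q2] : x < x + r by rewrite ltrDl.
rewrite in_itv /= => /andP[q2l q2r].
have Gq : G (pickle (q1, q2)) = if mu (I (q1, q2)) == 0%E then I (q1, q2) else set0.
  by rewrite /G pickleK.
have subG k : G k `<=` \bigcup_n G n by exact: bigcup_sup.
apply: (subG (pickle (q1, q2))).
rewrite Gq.
have IU : I (q1, q2) `<=` U.
  move=> y; rewrite /I /= in_itv /= => /andP[y1 y2]; apply: rU.
  by rewrite /ball /= ltr_norml; apply/andP; split; lra.
have mU : measurable (U : set (measurableTypeR R)) by exact: open_measurable.
have -> : mu (I (q1, q2)) = 0%E.
  apply/eqP; rewrite eq_le measure_ge0 andbT leNgt; apply/negP => h; apply: U0.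
  by apply: lt_le_trans h _; apply: le_measure => //; rewrite inE.
by rewrite eqxx /I /= in_itv /= q1r.
Qed.

(** Greedy choice: a point close to the infimum of the set uses up an interval of
    length [s] and an error that can be made arbitrarily small. *)
Lemma separated_points (R : realType) (s : R) (n : nat) :
  0 < s -> forall (E : set (measurableTypeR R)) (A : R), measurable E ->
  (forall x, E x -> A <= x) ->
  ((n%:R * s)%:E < lebesgue_measure E)%E ->
  exists x : nat -> R, (forall i, (i <= n)%N -> E (x i)) /\
    (forall i j, (i <= j)%N -> (j <= n)%N -> (j - i)%:R * s <= x j - x i).
Proof.
move=> s0; elim: n => [|n IH] E A mE EA lE.
  have [x Ex] : E !=set0.
    apply/set0P/eqP => E0; move: lE; rewrite E0 measure0 mul0r ltxx //.
  exists (fun _ => x); split => // i j ij; rewrite leqn0 => /eqP j0.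
  by move: ij; rewrite j0 leqn0 => /eqP ->; rewrite subnn mul0r subrr.
have E0 : E !=set0.
  apply/set0P/eqP => E0; move: lE; rewrite E0 measure0 lte_fin => h.
  by move: (lt_le_trans h (ltW (mulr_gt0 (ltr0Sn R n) s0))); rewrite ltxx.
have hinf : has_inf E by split => //; exists A => x /EA.
have [dl [dl0 Hdl]] : exists dl : R, 0 < dl /\
    ((n.+1%:R * s + dl)%:E < lebesgue_measure E)%E.
  case: (lebesgue_measure E) lE => [r||] //; last first.
    by exists 1; split => //; rewrite ltry.
  rewrite lte_fin => h; exists ((r - n.+1%:R * s)/2); split.
    by rewrite divr_gt0 // subr_gt0.
  by rewrite lte_fin; lra.
have [x0 Ex0 x0lt] := inf_adherent dl0 hinf.
pose E1 : set (measurableTypeR R) := E `&` `[x0 + s, +oo[%classic.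
have mE1 : measurable E1 by apply: measurableI => //; exact: measurable_itv.
have lE1 : ((n%:R * s)%:E < lebesgue_measure E1)%E.
  have sub : E `<=` E1 `|` `[inf E, x0 + s]%classic.
    move=> y Ey; have [h|h] := leP (x0 + s) y.
      by left; split => //=; rewrite in_itv /= h.
    right; rewrite /= in_itv /= (ltW h) andbT.
    by apply: inf_lbound => //; case: hinf.
  have mI : measurable (`[inf E, x0 + s]%classic : set (measurableTypeR R)).
    exact: measurable_itv.
  have h1 : (lebesgue_measure E <= lebesgue_measure E1 + (x0 + s - inf E)%:E)%E.
    apply: le_trans (@le_measure _ _ _ lebesgue_measure _ _ _ _ sub) _; rewrite ?inE //.
      exact: measurableU.
    apply: le_trans (measureU2 _ _ _) _ => //.
    rewrite [X in (_ + X <= _)%E]lebesgue_measure_itv /= lte_fin.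
    have -> : inf E < x0 + s.
      apply: (@le_lt_trans _ _ x0); last by rewrite ltrDl.
      by apply: inf_lbound => //; case: hinf.
    by rewrite -EFinD.
  have := lt_le_trans Hdl h1.
  case: (lebesgue_measure E1) => [r||] //.
  - rewrite -EFinD !lte_fin -natr1 mulrDl mul1r; lra.
  - by move=> _ /=; exact: ltry.
have [|x [Hx1 Hx2]] := IH E1 A mE1 _ lE1; first by move=> y [/EA].
exists (fun i => if i is i'.+1 then x i' else x0); split.
  by case=> // i; rewrite ltnS => /Hx1[].
case=> [|i] [|j] //.
- by rewrite subnn mul0r subrr.
- move=> _; rewrite ltnS => jn; have := Hx2 0%N j (leq0n j) jn.
  have [_] := Hx1 0%N (leq0n n); rewrite /= in_itv /= andbT => h1.
  rewrite !subn0 -natr1 mulrDl mul1r; lra.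
- rewrite !ltnS subSS => ij jn; exact: Hx2.
Qed.

(** * Coefficients of a polynomial from its values at separated points *)

Lemma prod_dist_fact n i : (i <= n)%N ->
  (\prod_(j < n.+1 | j != i :> nat) ((i - j) + (j - i)) = i`! * (n - i)`!)%N.
Proof.
have H m : (\prod_(j < m) (m - j) = m`!)%N.
  elim: m => [|m IH]; first by rewrite big_ord0.
  by rewrite big_ord_recl /= subn0 factS; congr (_ * _)%N; rewrite -IH; apply: eq_bigr.
elim: n => [|n IH].
  by rewrite leqn0 => /eqP ->; rewrite big_mkcond big_ord_recl big_ord0.
rewrite leq_eqVlt => /orP[/eqP ->|].
  rewrite big_mkcond big_ord_recr /= eqxx muln1 subnn fact0 muln1 -(H n.+1).
  apply: eq_bigr => j _; rewrite neq_ltn ltn_ord /=.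
  by rewrite (_ : (j - n.+1 = 0)%N) ?addn0 //; apply/eqP; rewrite subn_eq0 ltnW // ltn_ord.
rewrite ltnS => le_in; rewrite big_mkcond big_ord_recr /= -big_mkcond IH //.
rewrite gtn_eqF ?ltnS //= -mulnA; congr (_ * _)%N.
rewrite (_ : (i - n.+1 = 0)%N) ?add0n; last by apply/eqP; rewrite subn_eq0 ltnW.
by rewrite subSn // factS mulnC.
Qed.

Lemma fact_split_ge n i : (i <= n)%N -> (n`! <= 2 ^ n * (i`! * (n - i)`!))%N.
Proof.
move=> le_in; rewrite -(bin_fact le_in) leq_mul2r; apply/orP; right.
rewrite -[2%N]/(1 + 1)%N expnDn (bigD1 (Ordinal (n:=n.+1) (m:=i) le_in)) //=.
by rewrite !exp1n !muln1 leq_addr.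
Qed.

Section Interpolation.
Variable F : numFieldType.
Implicit Types (p : {poly F}) (z : nat -> F).

(** The difference of the two sides has more roots than its degree allows. *)
Lemma lagrange_interpolation n z p : (size p <= n.+1)%N ->
  (forall i j, (i <= n)%N -> (j <= n)%N -> i != j -> z i != z j) ->
  p = \sum_(i < n.+1) (p.[z i] / \prod_(j < n.+1 | j != i) (z i - z j)) *:
        \prod_(j < n.+1 | j != i) ('X - (z j)%:P).
Proof.
move=> sp zinj; apply/eqP; rewrite -subr_eq0; apply/eqP.
set L := (X in p - X); pose rs := [seq z i | i <- iota 0 n.+1].
apply: (@roots_geq_poly_eq0 _ _ rs).
- rewrite all_map; apply/allP => i; rewrite mem_iota add0n ltnS => /andP[_ le_in] /=.
  rewrite /root hornerD hornerN /L horner_sum subr_eq0; apply/eqP.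
  have ii : (i < n.+1)%N by [].
  rewrite (bigD1 (Ordinal ii)) //= [X in _ = _ + X]big1 ?addr0 => [|k ki].
    rewrite hornerZ horner_prod; under [X in _ * X]eq_bigr do rewrite hornerXsubC.
    rewrite divfK //; apply/prodf_neq0 => j ji; rewrite subr_eq0.
    by apply: zinj => //; [rewrite -ltnS|rewrite eq_sym].
  rewrite hornerZ horner_prod [X in _ * X](bigD1 (Ordinal ii)) 1?eq_sym //=.
  by rewrite hornerXsubC subrr mul0r mulr0.
- rewrite map_inj_in_uniq ?iota_uniq // => i j.
  rewrite !mem_iota !add0n !ltnS => ni nj zij; apply/eqP/negPn/negP => ij.
  by have := zinj i j ni nj ij; rewrite zij eqxx.
- rewrite size_map size_iota (leq_trans (size_polyD _ _)) // geq_max sp size_polyN.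
  rewrite (leq_trans (size_sum _ _ _)) //; apply/bigmax_leqP => i _.
  rewrite (leq_trans (size_scale_leq _ _)) //.
  rewrite (eq_bigl (fun j => j \in predC1 i)) // -big_enum size_prod_XsubC.
  by rewrite -cardE cardC1 card_ord.
Qed.

(** Multiplication by ['X - w] at most doubles the largest coefficient. *)
Lemma coef_prod_XsubC_le (I : Type) (r : seq I) (A : pred I) (w : I -> F) k :
  (forall i, `|w i| <= 1) ->
  `|(\prod_(i <- r | A i) ('X - (w i)%:P))`_k| <= 2 ^+ size r.
Proof.
move=> w1; elim: r k => [|i r IH] k.
  by rewrite big_nil coef1; case: eqP => _; rewrite ?normr1 ?normr0 ?expr0.
have two1 : 2 ^+ size r <= 2 ^+ (size r).+1 :> F by rewrite ler_weXn2l // ler1n.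
rewrite big_cons; case: (A i); last exact: le_trans (IH k) two1.
rewrite mulrBl coefB coefXM coefCM exprS mulr_natl mulr2n.
apply: le_trans (ler_normB _ _) _; apply: lerD.
  by case: eqP => _ //; rewrite normr0 exprn_ge0.
by rewrite normrM; apply: le_trans (ler_wpM2r _ (w1 i)) _; rewrite ?mul1r.
Qed.

(** In the Lagrange form, spacing by [c] makes the product of the distances from
    the [i]-th node at least [c^n i! (n - i)!], hence at least
    [c^n n! / 2^n]. *)
Lemma coef_le_of_values n z p (c M : F) k : (size p <= n.+1)%N -> 0 < c ->
  (forall i, `|z i| <= 1) ->
  (forall i j, (i <= n)%N -> (j <= n)%N -> c * ((i - j) + (j - i))%:R <= `|z i - z j|) ->
  (forall i, (i <= n)%N -> `|p.[z i]| <= M) ->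
  `|p`_k| <= n.+1%:R * (M * (2 ^+ n / (c ^+ n * n`!%:R)) * 2 ^+ n.+1).
Proof.
move=> sp c0 z1 zc pM.
have M0 : 0 <= M by apply: le_trans (pM 0%N (leq0n _)).
have dist0 i j : i != j -> (0 < (i - j) + (j - i))%N.
  by rewrite neq_ltn addn_gt0 !subn_gt0 orbC.
have zinj i j : (i <= n)%N -> (j <= n)%N -> i != j -> z i != z j.
  move=> ni nj ij; rewrite -subr_eq0 -normr_gt0; apply: lt_le_trans (zc _ _ ni nj).
  by rewrite mulr_gt0 // ltr0n dist0.
have /= -> := congr1 (fun q : {poly F} => q`_k) (lagrange_interpolation sp zinj).
rewrite coef_sum.
apply: le_trans (ler_norm_sum _ _ _) _.
rewrite mulr_natl -[X in _ *+ X](card_ord n.+1) -sumr_const; apply: ler_sum => i _.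
have le_in : (i <= n)%N by rewrite -ltnS.
rewrite coefZ normrM; apply: ler_pM => //; last first.
  have sz : size (index_enum 'I_n.+1) = n.+1 by rewrite -[RHS](card_ord n.+1) cardT enumT.
  by have := @coef_prod_XsubC_le 'I_n.+1 (index_enum 'I_n.+1) (fun j => j != i) (fun j => z j) k (fun j => z1 j); rewrite sz.
rewrite normrM normfV; apply: ler_pM => //; rewrite ?invr_ge0 //; first exact: pM.
have fac0 m : 0 < m`!%:R :> F by rewrite ltr0n fact_gt0.
have -> : 2 ^+ n / (c ^+ n * n`!%:R) = (c ^+ n * (n`!%:R / 2 ^+ n))^-1.
  by rewrite !invfM invrK; field; rewrite ?expf_neq0 ?gt_eqF ?exprn_gt0 ?ltr0n // fact_gt0.
rewrite lef_pV2 ?posrE; first last.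
- by rewrite mulr_gt0 ?exprn_gt0 // divr_gt0 // exprn_gt0.
- rewrite normr_gt0; apply/prodf_neq0 => j ji; rewrite subr_eq0.
  by apply: zinj => //; [rewrite -ltnS|rewrite eq_sym].
rewrite normr_prod.
have := @ler_prod _ _ (index_enum 'I_n.+1) (fun j => j != i)
  (fun j : 'I_n.+1 => c * ((i - j) + (j - i))%:R) (fun j => `|z i - z j|).
move=> H; apply: le_trans (H _); last first.
  by move=> j _; rewrite mulr_ge0 ?ler0n ?(ltW c0) //= zc // -ltnS.
rewrite big_split /= prodr_const cardC1 card_ord /=.
rewrite ler_pM2l ?exprn_gt0 // -natr_prod prod_dist_fact //.
rewrite ler_pdivrMr ?exprn_gt0 // -natrX -natrM ler_nat mulnC.
exact: fact_split_ge.
Qed.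

End Interpolation.

(** * The spectral form on a grid *)

Section TrigonometricEnergy.
Context {R : realType}.

(** The chord has length [2 |sin ((a - b) / 2)|], and the sine has slope at least
    [cos (1 / 2)] on [[0, 1 / 2]]. *)
Lemma chord_lower_bound (a b : R) : `|a - b| <= 1 ->
  cos (1/2) ^+ 2 * (a - b) ^+ 2 <= (cos a - cos b) ^+ 2 + (sin a - sin b) ^+ 2.
Proof.
wlog ba : a b / b <= a.
  move=> H; have [h|h] := leP b a; first exact: H.
  by rewrite distrC => /(H _ _ (ltW h)); rewrite -opprB sqrrN -(opprB (cos a)) sqrrN -(opprB (sin a)) sqrrN.
rewrite ger0_norm ?subr_ge0 // => ab1.
pose u := (a - b) / 2.
have u0 : 0 <= u by rewrite divr_ge0 // subr_ge0.
have u1 : u <= 1/2 by rewrite /u; lra.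
have [c /andP[c0 c1] e] : exists2 c : R, 0 <= c <= u & sin u = cos c * u.
  have [|c] := @MVT_segment R sin cos 0 u u0.
  - by apply: continuous_subspaceT; exact: continuous_sin.
  by rewrite in_itv /= => cu; rewrite sin0 !subr0 => e; exists c.
have pi2 := pi_ge2 R.
have cc : cos (1/2) <= cos c.
  rewrite leNgt ltr_cos ?in_itv /= -?leNgt; [|apply/andP; split; lra..].
  exact: le_trans c1 u1.
have k0 : 0 <= cos (1/2 : R).
  by apply: cos_ge0_pihalf; apply/andP; split; lra.
have -> : (cos a - cos b) ^+ 2 + (sin a - sin b) ^+ 2 = 4 * sin u ^+ 2.
  have -> : 4 * sin u ^+ 2 = 2 * (1 - cos (a - b)).
    rewrite (_ : a - b = u *+ 2); last by rewrite -mulr_natr /u divfK.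
    by rewrite cos_mulr2n mulr2n; move: (cos2Dsin2 u); rewrite !expr2; lra.
  rewrite cosB; move: (cos2Dsin2 a) (cos2Dsin2 b) => ha hb.
  rewrite !expr2 in ha hb *; lra.
have -> : cos (1 / 2) ^+ 2 * (a - b) ^+ 2 = 4 * (cos (1/2) * u) ^+ 2 by rewrite /u; field.
have kc : cos (1/2) * u <= sin u by rewrite e; exact: ler_wpM2r.
have m0 : 0 <= cos (1/2) * u by exact: mulr_ge0.
by rewrite ler_pM2l // ler_sqr ?nnegrE // (le_trans m0 kc).
Qed.

Definition trig_energy n (t a : 'I_n -> R) (x : R) :=
  (\sum_(i < n) a i * cos (t i * x)) ^+ 2 + (\sum_(i < n) a i * sin (t i * x)) ^+ 2.

Lemma trig_energy_ge0 n (t a : 'I_n -> R) x : 0 <= trig_energy t a x.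
Proof. by rewrite addr_ge0 ?sqr_ge0. Qed.

Lemma trig_energy_le n (t a : 'I_n -> R) x :
  trig_energy t a x <= 2 * (\sum_(i < n) `|a i|) ^+ 2.
Proof.
have H (f : R -> R) : (forall y, `|f y| <= 1) ->
    (\sum_(i < n) a i * f (t i * x)) ^+ 2 <= (\sum_(i < n) `|a i|) ^+ 2.
  move=> f1; rewrite -[leLHS]real_normK ?num_real // ler_sqr ?nnegrE ?sumr_ge0 //.
  apply: le_trans (ler_norm_sum _ _ _) _; apply: ler_sum => i _.
  by rewrite normrM ler_piMr.
rewrite mulr_natl mulr2n; apply: lerD; apply: H => y.
- by rewrite ler_norml cos_geN1 cos_le1.
- by rewrite ler_norml sin_geN1 sin_le1.
Qed.

Lemma measurable_trig_energy n (t a : 'I_n -> R) :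
  measurable_fun setT (trig_energy t a : measurableTypeR R -> R).
Proof.
have H (f : R -> R) : continuous f ->
    measurable_fun setT (fun x : measurableTypeR R => (\sum_(i < n) a i * f (t i * x)) ^+ 2).
  move=> cf; apply: measurable_funX; apply: measurable_sum => i.
  apply: measurable_funM => //; apply: continuous_measurable_fun => x.
  apply: continuous_comp; last exact: cf.
  by apply: cvgM; [exact: cvg_cst|exact: cvg_id].
by apply: measurable_funD; apply: H; [exact: continuous_cos|exact: continuous_sin].
Qed.

(** On a grid of mesh [h] the exponential sum is a polynomial in [e^(i h x)],
    which is interpolated at the points [e^(i h x_i)] of the unit circle. *)
Lemma trig_coef_le n (a : 'I_n.+1 -> R) (h s A M2 : R) (x : nat -> R) :
  0 < h -> 0 < s -> h * (2 * A) <= 1 ->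
  (forall i, (i <= n)%N -> `|x i| <= A) ->
  (forall i j, (i <= j)%N -> (j <= n)%N -> (j - i)%:R * s <= x j - x i) ->
  (forall i, (i <= n)%N -> trig_energy (fun j => j%:R * h) a (x i) <= M2) ->
  forall k, `|a k| <= n.+1%:R * (Num.sqrt M2 *
    (2 ^+ n / ((cos (1/2) * (h * s)) ^+ n * n`!%:R)) * 2 ^+ n.+1).
Proof.
move=> h0 s0 hA xA xs gM k; set c := cos (1/2) * (h * s).
pose toC (y : R) : R[i] := y%:C%C.
pose z (i : nat) : R[i] := if (i <= n)%N then expi (h * x i) else 0.
pose p : {poly R[i]} := \poly_(j < n.+1) toC (oapp a 0 (insub j)).
have pi2 := pi_ge2 R.
have k0 : 0 < cos (1/2 : R) by apply: cos_gt0_pihalf; apply/andP; split; lra.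
have c0 : 0 < c by rewrite !mulr_gt0.
have toCM (u v : R) : toC (u * v) = toC u * toC v by rewrite /toC rmorphM.
have toCX (u : R) m : toC (u ^+ m) = toC u ^+ m by rewrite /toC rmorphXn.
have toCn m : toC m%:R = m%:R by rewrite /toC rmorph_nat.
have toCV (u : R) : toC (u^-1) = (toC u)^-1 by rewrite /toC fmorphV.
have expiX (y : R) m : expi y ^+ m = expi (m%:R * y).
  elim: m => [|m IH]; first by rewrite expr0 mul0r /expi cos0 sin0.
  rewrite exprS IH -natr1 mulrDl mul1r /expi cosD sinD.
  by apply/eqP; rewrite eq_complex /=; apply/andP; split; apply/eqP; ring.
have pz i : (i <= n)%N -> `|p.[z i]| <= toC (Num.sqrt M2).
  move=> le_in; rewrite horner_poly normc_def /toC lecR ler_wsqrtr //.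
  apply: le_trans (gM i le_in); rewrite /trig_energy /z le_in.
  have e : \sum_(j < n.+1) toC (oapp a 0 (insub (j : nat))) * expi (h * x i) ^+ j =
      Complex (\sum_(j < n.+1) a j * cos (j%:R * h * x i)) (\sum_(j < n.+1) a j * sin (j%:R * h * x i)).
    elim/big_rec3: _ => [//|j y1 y2 y3 _ ->].
    rewrite valK /= expiX mulrA /expi /toC.
    by apply/eqP; rewrite eq_complex /=; apply/andP; split; apply/eqP; ring.
  by rewrite e.
have := @coef_le_of_values R[i] n z p (toC c) (toC (Num.sqrt M2)) k (size_poly _ _).
rewrite coef_poly ltn_ord valK /= -!toCX -!toCn -!toCX -!toCM -toCV -!toCM.
have lecT (u v : R) : (toC u <= toC v) = (u <= v) by exact: lecR.
have c0' : 0 < toC c by rewrite [_ < _]ltcR.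
have -> : `|toC (a k)| = toC `|a k|.
  by rewrite normc_def /= expr0n addr0 sqrtr_sqr.
move=> /(_ c0'); rewrite lecT; apply => //.
- move=> i; rewrite /z; case: ifP => _; last by rewrite normr0.
  by rewrite normc_def /= cos2Dsin2 sqrtr1.
- move=> i j; wlog ij : i j / (i <= j)%N.
    move=> H; case: (leqP i j) => ij; first exact: H.
    by move=> ni nj; rewrite distrC addnC; apply: H => //; exact: ltnW.
  move=> ni nj; rewrite (eqP (_ : i - j == 0)%N) ?subn_eq0 // add0n.
  have sx := xs i j ij nj.
  have xx : 0 <= x j - x i by apply: le_trans sx; rewrite mulr_ge0 // ltW.
  rewrite /z ni nj distrC normc_def -toCn -toCM /toC lecR.
  rewrite -[leLHS]ger0_norm; last by rewrite mulr_ge0 // ltW.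
  rewrite -sqrtr_sqr ler_wsqrtr //=.
  have xi := xA i ni; have xj := xA j nj.
  have h1 : `|h * x j - h * x i| <= 1.
    rewrite -mulrBr normrM gtr0_norm //; apply: le_trans hA; rewrite ler_pM2l //.
    by apply: le_trans (ler_normB _ _) _; lra.
  apply: le_trans (chord_lower_bound h1).
  rewrite -mulrBr -exprMn ler_sqr ?nnegrE ?mulr_ge0 // ?(ltW k0) ?(ltW h0) ?(ltW s0) //.
  rewrite /c -!mulrA ler_pM2l // ler_pM2l // mulrC.
  exact: sx.
Qed.

End TrigonometricEnergy.

Section SpectralBounds.
Context {R : realType} (mu : probability (measurableTypeR R) R).

Lemma integrable_trig_energy n (t a : 'I_n -> R) :
  mu.-integrable setT (EFin \o (trig_energy t a : measurableTypeR R -> R)).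
Proof.
apply: (@bounded_integrable _ _ _ mu _ (2 * (\sum_(i < n) `|a i|) ^+ 2)).
  exact: measurable_trig_energy.
by move=> x; rewrite ger0_norm ?trig_energy_ge0 ?trig_energy_le.
Qed.

Lemma spectral_form_energy n (t a : 'I_n -> R) :
  spectral_form mu t a = \int[mu]_x trig_energy t a x.
Proof. by []. Qed.

Lemma integrable_indic_scale (c : R) (B : set (measurableTypeR R)) : measurable B ->
  mu.-integrable setT (EFin \o (fun x => c * \1_B x)).
Proof.
move=> mB; apply: (@bounded_integrable _ _ _ mu _ `|c|).
  by apply: measurable_funM => //; exact: measurable_indic.
by move=> x; rewrite normrM ler_piMr // indicE ger0_norm ?ler0n // lern1 leq_b1.
Qed.

Lemma spectral_form_le (A M : R) n (t a : 'I_n -> R) :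
  mu (~` `[- A, A]%classic) = 0%E ->
  (forall x, `|x| <= A -> trig_energy t a x <= M) -> 0 <= M ->
  spectral_form mu t a <= M.
Proof.
move=> muA gM M0; rewrite spectral_form_energy.
set B := ~` _ in muA; have mB : measurable (B : set (measurableTypeR R)).
  by apply: measurableC; exact: measurable_itv.
pose L := 2 * (\sum_(i < n) `|a i|) ^+ 2.
have iM : mu.-integrable setT (EFin \o (fun=> M : R)).
  by apply: (@bounded_integrable _ _ _ mu _ `|M|).
have iL := integrable_indic_scale L mB.
apply: (@le_trans _ _ (\int[mu]_x (M + L * \1_B x))).
  apply: le_Rintegral => //; first exact: integrable_trig_energy.
    have := integrableD measurableT iM iL.
    by congr (mu.-integrable _ _); apply/funext => w.
  move=> x _; rewrite indicE; case: (boolP (x \in B)) => xB.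
    by rewrite mulr1; apply: ler_wpDl => //; exact: trig_energy_le.
  rewrite mulr0 addr0 gM //; move: xB; rewrite notin_setE /B /= => /contrapT.
  by rewrite in_itv /= ler_norml.
rewrite RintegralD // RintegralZl //; last first.
  have := integrable_indic_scale 1 mB.
  by congr (mu.-integrable _ _); apply/funext => w /=; rewrite mul1r.
rewrite Rintegral_indic // muA mulr0 addr0.
by rewrite /Rintegral integral_cst //= probability_setT mule1.
Qed.

Lemma chebyshev_energy (M : R) n (t a : 'I_n -> R) : 0 <= M ->
  M * fine (mu [set x | M <= trig_energy t a x]) <= spectral_form mu t a.
Proof.
move=> M0; rewrite spectral_form_energy; set B := [set x | _].
have mB : measurable (B : set (measurableTypeR R)).
  rewrite (_ : B = trig_energy t a @^-1` `[M, +oo[%classic).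
    by rewrite -[X in measurable X]setTI; apply: measurable_trig_energy => //; exact: measurable_itv.
  by apply/seteqP; split => x; rewrite /B /= in_itv /= andbT.
rewrite -Rintegral_indic // -RintegralZl //; last first.
  have := integrable_indic_scale 1 mB.
  by congr (mu.-integrable _ _); apply/funext => w /=; rewrite mul1r.
apply: le_Rintegral => //; [exact: integrable_indic_scale|exact: integrable_trig_energy|].
move=> x _; rewrite indicE; case: (boolP (x \in B)) => xB.
  by rewrite mulr1; move: xB; rewrite inE.
by rewrite mulr0 trig_energy_ge0.
Qed.

End SpectralBounds.

(** With a separation proportional to [1 / n.+1], the factors [n^n] and [n!]
    cancel up to [e^n]: interpolation loses only an exponential factor. *)
Lemma interpolation_constant (R : realType) (n : nat) (c : R) : 0 < c ->
  n.+1%:R * (n.+1%:R * (2 ^+ n / ((c / (2 * n.+1%:R)) ^+ n * n`!%:R)) * 2 ^+ n.+1) ^+ 2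
    <= (2 * expR 1) ^+ 2 * (32 * expR 1 / c) ^+ (2 * n).
Proof.
move=> c0; set e := expR 1.
have e0 : 0 < e by exact: expR_gt0.
have N0 : 0 < n.+1%:R :> R by [].
have F0 : 0 < n`!%:R :> R by rewrite ltr0n fact_gt0.
have N2 : n.+1%:R <= 2 ^+ n :> R by rewrite -natrX ler_nat ltn_expl.
have Ne : n.+1%:R ^+ n / n`!%:R <= e ^+ n.+1.
  have := @series_exp_coeff_le R n.+1%:R n.+1 (ler0n _ _).
  rewrite /series /= big_nat_recr //= => h.
  rewrite /e -expRM_natl mulr1; apply: le_trans h; rewrite lerDr.
  by apply: sumr_ge0 => i _; rewrite /exp_coeff divr_ge0 ?exprn_ge0.
set q := n.+1%:R * _ * _.
have -> : q = 2 * ((8 / c) ^+ n * n.+1%:R) * (n.+1%:R ^+ n / n`!%:R).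
  rewrite /q (_ : 8 = 2 * (2 * 2) :> R); last by ring.
  rewrite !expr_div_n !exprMn exprS; field.
  by rewrite !gt_eqF // ?exprn_gt0 //= ?mulr_gt0 ?exprn_gt0.
have q0 : 0 <= 2 * ((8 / c) ^+ n * n.+1%:R) * (n.+1%:R ^+ n / n`!%:R).
  by rewrite !mulr_ge0 ?exprn_ge0 ?divr_ge0 ?invr_ge0 ?exprn_ge0 // ltW.
have qle : 2 * ((8 / c) ^+ n * n.+1%:R) * (n.+1%:R ^+ n / n`!%:R) <=
    2 * e * (16 * e / c) ^+ n.
  rewrite (_ : 2 * e * _ = 2 * ((8 / c) ^+ n * 2 ^+ n) * e ^+ n.+1).
    apply: ler_pM => //.
    - by rewrite !mulr_ge0 ?exprn_ge0 ?divr_ge0 // ltW.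
    - by rewrite ler_pM2l // ler_pM2l // exprn_gt0 // divr_gt0.
  rewrite -exprMn exprS (_ : 16 * e / c = 8 / c * 2 * e); last by field; rewrite gt_eqF.
  by rewrite [(8 / c * 2 * e) ^+ n]exprMn; move: ((8 / c * 2) ^+ n) => y; ring.
apply: (@le_trans _ _ (2 ^+ n * (2 * e * (16 * e / c) ^+ n) ^+ 2)).
  apply: ler_pM => //; first exact: sqr_ge0.
  by rewrite ler_sqr ?nnegrE //; exact: le_trans q0 qle.
rewrite exprMn mulrCA ler_pM2l ?exprn_gt0 ?mulr_gt0 //.
rewrite -exprM mulnC exprM exprM -exprMn.
have y0 : 0 <= 16 * e / c by rewrite divr_ge0 ?mulr_ge0 // ltW.
apply: lerXn2r; rewrite ?nnegrE ?sqr_ge0 //; first by rewrite mulr_ge0 ?sqr_ge0.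
rewrite (_ : 32 * e / c = 2 * (16 * e / c)); last by field; rewrite gt_eqF.
by rewrite [leRHS]exprMn ler_wpM2r ?sqr_ge0 // expr2; lra.
Qed.

(** If the form were smaller, the energy would be below a level [M2] on a set
    carrying half of the absolutely continuous mass. That set has Lebesgue
    measure at least [dl], so it contains [n.+1] points at mutual distance
    proportional to [dl / n], and interpolation at these points contradicts
    the size of the coefficients. *)
Lemma spectral_form_lower (R : realType) (mu : probability (measurableTypeR R) R) :
  compactly_supported mu -> has_ac_part mu ->
  exists K : R, 1 <= K /\ forall h, 0 < h -> h <= K^-1 ->
    forall n (a : 'I_n.+1 -> R),
    K^-1 * (h / K) ^+ (2 * n) * (\sum_(i < n.+1) a i ^+ 2) <=
    spectral_form mu (fun i => i%:R * h) a.
Proof.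
move=> cmu [nu [sg [muE nuleb _ nu0]]].
have [A [A0 muA]] := compact_support_null cmu.
have nule B : measurable B -> (nu B <= mu B)%E by move=> mB; rewrite muE // leeDl.
have nufin : fin_num_fun nu.
  move=> B mB; rewrite ge0_fin_numE //; apply: le_lt_trans (nule _ mB) _.
  by apply: le_lt_trans (probability_le1 mu mB) _; rewrite ltry.
pose m := fine (nu setT).
have mE : nu setT = m%:E by rewrite fineK // nufin.
have m0 : 0 < m.
  by rewrite lt_neqAle fine_ge0 // andbT eq_sym -eqe -mE.
have m20 : 0 < m / 2 by rewrite divr_gt0.
have [dl [dl0 Hdl]] := dominates_continuous nufin nuleb m20.
pose kp := cos (1/2 : R); have pi2 := pi_ge2 R.
have kp0 : 0 < kp by apply: cos_gt0_pihalf; apply/andP; split; lra.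
pose e := expR (1 : R); have e0 : 0 < e by exact: expR_gt0.
pose K := 1 + 2 * A + 4 * (2 * e) ^+ 2 / m + 32 * e / (kp * dl).
have K3 : 0 < 4 * (2 * e) ^+ 2 / m by rewrite divr_gt0 // mulr_gt0 // exprn_gt0 // mulr_gt0.
have K4 : 0 < 32 * e / (kp * dl) by rewrite divr_gt0 ?mulr_gt0.
have K1 : 1 <= K by rewrite /K; lra.
have K0 : 0 < K by apply: lt_le_trans K1.
exists K; split => // h h0 hK n a.
set S := \sum_(i < _) _; pose V := spectral_form mu (fun i : 'I_n.+1 => i%:R * h) a.
have S0 : 0 <= S by apply: sumr_ge0 => i _; exact: sqr_ge0.
have [->|Sn0] := eqVneq S 0.
  rewrite mulr0 spectral_form_energy; apply: Rintegral_ge0 => x _.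
  exact: trig_energy_ge0.
have Sp : 0 < S by rewrite lt_neqAle eq_sym Sn0.
pose s := dl / (2 * n.+1%:R); have s0 : 0 < s by rewrite divr_gt0 // mulr_gt0.
pose Q := n.+1%:R * (2 ^+ n / ((kp * (h * s)) ^+ n * n`!%:R)) * 2 ^+ n.+1.
have F0 : 0 < n`!%:R :> R by rewrite ltr0n fact_gt0.
have Q0 : 0 < Q by rewrite !mulr_gt0 // ?invr_gt0 ?mulr_gt0 ?exprn_gt0 // ?mulr_gt0.
pose L := n.+1%:R * Q ^+ 2; have L0 : 0 < L by rewrite mulr_gt0 // exprn_gt0.
have hA : h * (2 * A) <= 1.
  apply: (@le_trans _ _ (K^-1 * (2 * A))); first by rewrite ler_wpM2r // mulr_ge0 // ltW.
  by rewrite mulrC ler_pdivrMr // mul1r /K; lra.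
have key : m * S / (4 * L) <= V.
  rewrite leNgt; apply/negP => VS.
  (* At this level the interpolation estimate reads [S <= S / 2]. *)
  pose M2 := S / (2 * L).
  have M20 : 0 < M2 by rewrite divr_gt0 // mulr_gt0.
  pose g : R -> R := trig_energy (fun i : 'I_n.+1 => i%:R * h) a.
  pose B : set (measurableTypeR R) := [set x | M2 <= g x].
  have mB : measurable B.
    rewrite (_ : B = g @^-1` `[M2, +oo[%classic).
      rewrite -[X in measurable X]setTI.
      by apply: (measurable_trig_energy (R:=R)) => //; exact: measurable_itv.
    by apply/seteqP; split => x; rewrite /B /= in_itv /= andbT.
  have muB : (mu B < (m / 2)%:E)%E.
    rewrite -[mu B]fineK ?fin_num_measure // lte_fin.
    have := @chebyshev_energy R mu M2 n.+1 (fun i => i%:R * h) a (ltW M20).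
    rewrite -[leRHS]/V => /le_lt_trans /(_ VS).
    rewrite [X in _ < X](_ : _ = M2 * (m / 2)); last by rewrite /M2; field; rewrite gt_eqF.
    by rewrite ltr_pM2l.
  pose E : set (measurableTypeR R) := `[- A, A]%classic `\` B.
  have mE' : measurable E by apply: measurableD => //; exact: measurable_itv.
  have mI : measurable (`[- A, A]%classic : set (measurableTypeR R)) by exact: measurable_itv.
  have nuE : ((m / 2)%:E <= nu E)%E.
    have h1 : (nu setT <= nu E + mu B)%E.
      have sub : [set: measurableTypeR R] `<=` E `|` (~` `[- A, A]%classic `|` B).
        move=> x _; case: (pselect (B x)) => Bx; first by right; right.
        by case: (pselect (`[- A, A]%classic x)) => Ix; [left|right; left].
      apply: le_trans (@le_measure _ _ _ nu _ _ _ _ sub) _; rewrite ?inE //.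
        by apply: measurableU => //; apply: measurableU => //; exact: measurableC.
      apply: le_trans (measureU2 _ _ _) _ => //.
        by apply: measurableU => //; exact: measurableC.
      apply: leeD => //; apply: le_trans (measureU2 _ _ _) _ => //; first exact: measurableC.
      rewrite -[leRHS]add0e; apply: leeD; last exact: nule.
      by rewrite -muA; apply: nule; exact: measurableC.
    move: h1; rewrite mE -[nu E]fineK ?nufin // -[mu B]fineK ?fin_num_measure //.
    move: muB; rewrite -[mu B]fineK ?fin_num_measure // lte_fin -EFinD !lee_fin; lra.
  have lE : (dl%:E <= lebesgue_measure E)%E.
    by rewrite leNgt; apply/negP => /(Hdl _ mE'); rewrite ltNge nuE.
  have [||x [xE xs]] := @separated_points R s n s0 E (- A) mE'.
  - by move=> y [/=]; rewrite in_itv /= => /andP[].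
  - apply: lt_le_trans lE; rewrite lte_fin /s mulrA ltr_pdivrMr ?mulr_gt0 //.
    by rewrite mulrC ltr_pM2l // -natrM ltr_nat mul2n -addnn addSn ltnS leq_addr.
  have xA i : (i <= n)%N -> `|x i| <= A.
    by move=> /xE[/=]; rewrite in_itv /= ler_norml.
  have gx i : (i <= n)%N -> g (x i) <= M2.
    by move=> /xE[_] /=; rewrite /B /= => /negP; rewrite -ltNge => /ltW.
  have ak := trig_coef_le h0 s0 hA xA xs gx.
  have akQ k : a k ^+ 2 <= M2 * Q ^+ 2.
    have M2E : M2 = Num.sqrt M2 ^+ 2 by rewrite sqr_sqrtr // ltW.
    have r0 : 0 <= Num.sqrt M2 * Q by rewrite mulr_ge0 ?sqrtr_ge0 // ltW.
    rewrite [leRHS](_ : _ = (Num.sqrt M2 * Q) ^+ 2); last by rewrite [RHS]exprMn -M2E.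
    rewrite -[leLHS]real_normK ?num_real // ler_sqr ?nnegrE //.
    by apply: le_trans (ak k) _; rewrite /Q le_eqVlt; apply/orP; left; apply/eqP; ring.
  have : S <= S / 2.
    apply: le_trans (_ : \sum_(i < n.+1) M2 * Q ^+ 2 <= _).
      by apply: ler_sum => i _; exact: akQ.
    rewrite sumr_const card_ord -mulr_natl /M2 /L le_eqVlt; apply/orP; left.
    by apply/eqP; field; rewrite !gt_eqF.
  lra.
apply: le_trans key; rewrite [leRHS]mulrAC ler_pM2r //.
have Lle : L <= (2 * e) ^+ 2 * (32 * e / (kp * (h * dl))) ^+ (2 * n).
  have := @interpolation_constant R n (kp * (h * dl)).
  rewrite (_ : kp * (h * dl) / (2 * n.+1%:R) = kp * (h * s)); last by rewrite /s !mulrA.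
  by apply; rewrite !mulr_gt0.
have L40 : 0 < 4 * L by exact: mulr_gt0.
rewrite ler_pdivlMr //.
have hK0 : 0 < (h / K) ^+ (2 * n) by rewrite exprn_gt0 // divr_gt0.
apply: le_trans (_ : K^-1 * (h / K) ^+ (2 * n) * (4 * ((2 * e) ^+ 2 * (K / h) ^+ (2 * n))) <= _).
  rewrite ler_pM2l ?mulr_gt0 ?invr_gt0 // ler_pM2l //; apply: le_trans Lle _.
  rewrite ler_pM2l ?exprn_gt0 ?mulr_gt0 // lerXn2r ?nnegrE //.
  - by rewrite divr_ge0 ?mulr_ge0 ?ltW.
  - by rewrite divr_ge0 ?ltW.
  rewrite (_ : 32 * e / (kp * (h * dl)) = (32 * e / (kp * dl)) / h); last first.
    by field; rewrite !gt_eqF.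
  by rewrite ler_pM2r ?invr_gt0 // /K; lra.
rewrite (_ : _ * _ * _ = K^-1 * (4 * (2 * e) ^+ 2) * ((h / K) ^+ (2 * n) * (K / h) ^+ (2 * n))); last by ring.
rewrite -exprMn (_ : h / K * (K / h) = 1) ?expr1n ?mulr1; last by field; rewrite !gt_eqF.
rewrite ler_pdivrMl // -ler_pdivrMr // /K; lra.
Qed.

(** * Measurability of the number of zeros *)

Lemma counting_geP (T : choiceType) (R : realType) (A : set T) (n : nat) :
  ((n%:R : R)%:E <= counting A)%E <->
  exists s : seq T, [/\ uniq s, size s = n & {in s, forall y, A y}].
Proof.
rewrite /counting; case: asboolP => [fA|infA].
- rewrite lee_fin ler_nat; split => [le_n|[s [us <- sA]]].
    exists (take n (finmap.enum_fset (fset_set A))); split.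
    + by rewrite take_uniq // finmap.fset_uniq.
    + by rewrite size_take_min; apply/minn_idPl.
    + by move=> y /mem_take; rewrite in_fset_set // inE.
  by apply: uniq_leq_size => // y ys; rewrite in_fset_set // inE; exact: sA.
- split=> _; last by rewrite leey.
  have [B BA nB] := infinite_set_fset n infA.
  exists (take n (finmap.enum_fset B)); split.
  + by rewrite take_uniq // finmap.fset_uniq.
  + by rewrite size_take_min; apply/minn_idPl.
  + by move=> y /mem_take yB; apply: BA.
Qed.

Lemma path_lt_last (R : realType) (u : R) (s : seq R) : path <%R u s ->
  {in u :: s, forall v, v <= last u s}.
Proof.
elim: s u => [|y s IH] u /=; first by move=> _ v; rewrite inE => /eqP ->.
move=> /andP[uy ys] v; rewrite in_cons => /orP[/eqP ->|]; last exact: IH.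
by apply: le_trans (ltW uy) _; apply: IH => //; rewrite mem_head.
Qed.

Section ZeroEvents.
Context {R : realType} d (Om : measurableType d) (X : R -> Om -> R).
Hypothesis mX : forall t, measurable_fun setT (X t).
Hypothesis cX : forall w, continuous (fun t => X t w).

(** By compactness, a continuous path vanishes on [[a, b]] if and only if it
    takes arbitrarily small values at rationals clamped to [[a, b]]; the
    clamping covers the case [a = b]. *)
Lemma measurable_has_zero (a b : R) :
  measurable [set w | exists y, a <= y <= b /\ X y w = 0].
Proof.
have [ab|ba] := leP a b; last first.
  rewrite (_ : [set w | _] = set0) //; apply/seteqP; split => // w [y [/andP[h1 h2] _]].
  by move: (le_lt_trans (le_trans h1 h2) ba); rewrite ltxx.
pose cl (q : rat) : R := Num.max a (Num.min b (ratr q)).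
have clab q : a <= cl q <= b.
  by rewrite /cl le_max lexx /= ge_max ab ge_min lexx.
rewrite (_ : [set w | _] =
  \bigcap_(m : nat) \bigcup_(q : rat) [set w | `|X (cl q) w| < m.+1%:R^-1]).
  apply: bigcap_measurableType => m _; apply: bigcupT_measurable_rat => q.
  rewrite (_ : [set w | _] = (fun w => `|X (cl q) w|) @^-1` `]-oo, (m.+1%:R^-1)[%classic).
    rewrite -[X in measurable X]setTI.
    have : measurable_fun setT (fun w => `|X (cl q) w|) by apply: measurableT_comp.
    by move=> /(_ measurableT); apply; exact: measurable_itv.
  by apply/seteqP; split => w; rewrite /= in_itv.
apply/seteqP; split => [w [y [yab Xy]] m _|w H] /=.
- have m0 : 0 < m.+1%:R^-1 :> R by rewrite invr_gt0.
  have := @cX w y => /cvgrPdist_lt /(_ _ m0) /nbhs_ballP[e /= e0 He].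
  have /rat_in_itvoo[q] : y - e < y + e by lra.
  rewrite in_itv /= => /andP[q1 q2]; exists q => //.
  have : ball y e (cl q).
    rewrite /ball /=; case/andP: yab => ay yb.
    rewrite ltr_norml /cl; apply/andP; split.
      rewrite ltrBrDl addrC -ltrBrDl opprK gt_max gt_min.
      by apply/andP; split; [lra|apply/orP; right; lra].
    by rewrite ltrBlDl -ltrBlDr lt_max lt_min; apply/orP; right; apply/andP; split; lra.
  by move=> /He; rewrite Xy sub0r normrN.
- have cN : {within `[a, b], continuous (fun t => `|X t w|)}.
    apply: continuous_subspaceT => t.
    by apply: continuous_comp; [exact: cX|exact: norm_continuous].
  have [c cab cmin] := EVT_min ab cN.
  exists c; split; first by move: cab; rewrite in_itv.
  apply/normr0_eq0/eqP; rewrite eq_le normr_ge0 andbT leNgt; apply/negP => c0.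
  have [m mc] : exists m : nat, m.+1%:R^-1 < `|X c w|.
    exists (Num.truncn (`|X c w|^-1)).
    by rewrite invf_plt ?posrE // truncnS_gt.
  have [q _ /= Hq] := H m Logic.I.
  have := cmin (cl q); rewrite in_itv /= clab => /(_ isT) h.
  by move: (lt_trans (le_lt_trans h Hq) mc); rewrite ltxx.
Qed.

(** Induction on [n]: two rationals separate the last zero from the others. *)
Lemma measurable_zeros_ge (n : nat) (b : R) :
  measurable [set w | exists s : seq R, [/\ uniq s, size s = n &
    {in s, forall y, 0 <= y <= b /\ X y w = 0}]].
Proof.
suff H : measurable [set w | exists s : seq R, [/\ sorted <%R s, size s = n &
    {in s, forall y, 0 <= y <= b /\ X y w = 0}]].
  rewrite (_ : [set w | _] = [set w | exists s : seq R, [/\ sorted <%R s, size s = n &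
    {in s, forall y, 0 <= y <= b /\ X y w = 0}]]) //.
  apply/seteqP; split => w [s [us sn sz]].
    exists (sort <=%R s); split; [by rewrite sort_lt_sorted|by rewrite size_sort|].
    by move=> y; rewrite mem_sort; exact: sz.
  by exists s; split => //; exact: lt_sorted_uniq us.
elim: n b => [|n IH] b.
  rewrite (_ : [set w | _] = setT) //; apply/seteqP; split => // w _.
  by exists [::]; split => // y; rewrite in_nil.
rewrite (_ : [set w | _] = \bigcup_(q1 : rat) \bigcup_(q2 : rat)
   (if (n == 0%N) || (q1 < q2) then
    ([set w | exists s : seq R, [/\ sorted <%R s, size s = n &
      {in s, forall y, 0 <= y <= Num.min b (ratr q1) /\ X y w = 0}]] `&`
    [set w | exists y, (if n == 0%N then 0 else Num.max 0 (ratr q2)) <= y <= b /\ X y w = 0])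
    else set0)).
  apply: bigcupT_measurable_rat => q1; apply: bigcupT_measurable_rat => q2.
  case: ifP => // _; apply: measurableI; first exact: IH.
  exact: measurable_has_zero.
apply/seteqP; split => [w [s [ss sn sz]]|w [q1 _ [q2 _]]].
- case/lastP: s ss sn sz => // s y ss; rewrite size_rcons => -[sn] sz.
  have [y0b Xy] : 0 <= y <= b /\ X y w = 0 by apply: sz; rewrite mem_rcons mem_head.
  have [n0|n0] := eqVneq n 0%N.
    exists 0 => //; exists 0 => //=; split; last by exists y.
    have s0 : s = [::] by apply/nilP; rewrite /nilp sn n0.
    by exists s; rewrite s0 n0; split => // z; rewrite in_nil.
  case: s ss sn sz => [|u s] ss sn sz; first by move: n0; rewrite -sn.
  move: (ss); rewrite /= rcons_path => /andP[us zy]; have sz' := path_lt_last us.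
  have /rat_in_itvoo[q1] := zy; rewrite in_itv /= => /andP[zq1 q1y].
  have /rat_in_itvoo[q2] := q1y; rewrite in_itv /= => /andP[q12 q2y].
  exists q1 => //; exists q2 => //; rewrite -(ltr_rat R) q12 /=; split.
  + exists (u :: s); split => // v vs; have [/andP[v0 vb] Xv] : 0 <= v <= b /\ X v w = 0.
      by apply: sz; rewrite mem_rcons in_cons vs orbT.
    by split => //; rewrite v0 le_min vb /= (le_trans (sz' _ vs)) // ltW.
  + exists y; split => //; case/andP: y0b => y0 yb.
    by rewrite yb ge_max y0 ltW.
- case: ifP => // nq /= [[s [ss sn sz]] [y [/andP[qy yb] Xy]]].
  exists (rcons s y); split; rewrite ?size_rcons ?sn //.
  + case: s ss sn sz => // u s ss sn sz.
    have n0 : n == 0%N = false by rewrite -sn.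
    move: nq qy; rewrite n0 /= => q12 qy.
    rewrite rcons_path; apply/andP; split => //.
    have := sz _ (mem_last u s) => -[/andP[_]]; rewrite le_min => /andP[_ l1] _.
    apply: le_lt_trans l1 _; apply: lt_le_trans qy.
    by rewrite lt_max ltr_rat q12 orbT.
  + move=> u; rewrite mem_rcons in_cons => /orP[/eqP ->|us].
      split => //; rewrite yb andbT; apply: le_trans qy.
      by case: ifP => // _; rewrite le_max lexx.
    have [/andP[u0 ub] Xu] := sz u us; split => //; rewrite u0.
    by move: ub; rewrite le_min => /andP[].
Qed.

End ZeroEvents.

(** * Newton coefficients and grid values of the process *)

(** The rationals of the interval, enumerated without repetition since the nodes
    of a divided difference have to be distinct. *)
Lemma dense_sequence (R : realType) (T : R) : 1 <= T ->
  exists tau : nat -> R, [/\ injective tau, forall i, 0 <= tau i <= T &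
    forall y e : R, 0 <= y <= T -> 0 < e -> exists i, `|y - tau i| < e].
Proof.
move=> T1; have T0 : 0 < T by apply: lt_le_trans T1.
pose D : set R := [set y | 0 <= y <= T] `&` range (@ratr R).
have Dcount : countable D.
  apply: (@sub_countable _ _ D [set: rat]) => //.
  by apply: card_le_trans (card_image_le (@ratr R) _); apply: subset_card_le => y [].
have Dinf : ([set: nat] #<= D)%card.
  pose f (n : nat) : R := ratr (n.+1%:R^-1).
  have finj : set_inj [set: nat] f.
    move=> m n _ _ /fmorph_inj /invr_inj /eqP; rewrite eqr_nat => /eqP[].
    by move=> ->.
  rewrite -(card_le_eql (inj_card_eq finj)); apply: subset_card_le => _ [n _ <-].
  split; last by exists (n.+1%:R^-1).
  have -> : f n = n.+1%:R^-1 by rewrite /f fmorphV /= ratr_nat.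
  rewrite /= invr_ge0 ler0n /=.
  by apply: le_trans T1; rewrite invf_le1 // ler1n.
have /card_set_bijP[tau [tD tinj tsurj]] : ([set: nat] #= D)%card.
  by rewrite card_eq_le Dinf.
exists tau; split.
- by move=> i j ij; apply: tinj; rewrite ?inE.
- by move=> i; have [] := tD i Logic.I.
- move=> y e /andP[y0 yT] e0.
  have /rat_in_itvoo[q] : Num.max 0 (y - e) < Num.min T (y + e).
    by rewrite lt_min !gt_max T0 /=; apply/andP; split; lra.
  rewrite in_itv /= gt_max lt_min => /andP[/andP[q0 q1] /andP[q2 q3]].
  have [|i _ ti] := tsurj (ratr q).
    by split; [rewrite /= (ltW q0) (ltW q2)|exists q].
  by exists i; rewrite ti ltr_norml; apply/andP; split; lra.
Qed.

Section ProcessEvents.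
Context {R : realType} d (Om : measurableType d) (P : probability Om R).
Variables (X : R -> {RV P >-> R}) (mu : probability (measurableTypeR R) R).
Hypothesis HX : smooth_stationary_gaussian X mu.

Lemma continuous_paths w : continuous (fun t => X t w).
Proof.
case: HX => _ _ _ _ sm t.
have := sm w 0%N t; rewrite derive1n0 => h.
exact/differentiable_continuous/derivable1_diffP.
Qed.

(** A Newton coefficient is a linear combination of values of the process, whose
    spectral form integrates the squares of divided differences of cosines
    and sines. *)
Lemma newton_coef_tail (A T : R) tau j u : 0 < A ->
  mu (~` `[- A, A]%classic) = 0%E -> 0 <= T -> injective tau ->
  (forall i, 0 <= tau i <= T) -> 0 <= u ->
  (P [set w | (u * (2 * (A ^+ j / j`!%:R * expR (A * T))) <
       `|newton_coef tau (fun t => X t w) j|)%R] <= (2 * expR (- u ^+ 2 / 4))%:E)%E.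
Proof.
move=> A0 muA T0 tinj trange u0.
set s := A ^+ j / j`!%:R * expR (A * T).
have s0 : 0 < s by rewrite mulr_gt0 ?expR_gt0 // divr_gt0 ?exprn_gt0 // ltr0n fact_gt0.
pose nodes := mkseq tau j.+1.
pose a (i : 'I_j.+1) : R := (\prod_(z <- nodes | z != tau i) (tau i - z))^-1.
have lin f : newton_coef tau f j = \sum_(i < j.+1) a i * f (tau i).
  rewrite /newton_coef /divdiff big_map -[in LHS]/(index_iota 0 j.+1) big_mkord.
  by apply: eq_bigr => i _; rewrite mulrC.
have nodesP : {in nodes, forall y : R, 0 <= y <= T} by apply/allP; rewrite all_map; apply/allP => i _; exact: trange.
have nodesU : uniq nodes by rewrite mkseq_uniq.
have nodesS : size nodes = j.+1 by rewrite size_mkseq.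
have form : spectral_form mu (fun i : 'I_j.+1 => tau i) a <= (2 * s) ^+ 2.
  apply: (spectral_form_le muA) => [x xA|]; last exact: sqr_ge0.
  have H (g : R) : `|g| <= `|x| ^+ j / j`!%:R * expR (`|x| * T) -> g ^+ 2 <= s ^+ 2.
    move=> h; rewrite -[leLHS]real_normK ?num_real // ler_sqr ?nnegrE ?(ltW s0) //.
    apply: le_trans h _; apply: ler_pM; rewrite ?divr_ge0 ?exprn_ge0 ?expR_ge0 //.
      by rewrite ler_pM2r ?invr_gt0 ?ltr0n ?fact_gt0 // lerXn2r ?nnegrE // ltW.
    by rewrite ler_expR ler_wpM2r.
  apply: (@le_trans _ _ (s ^+ 2 + s ^+ 2)).
    apply: lerD; apply: H.
      by rewrite -(lin (fun y => cos (y * x))); exact: divdiff_cos.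
    by rewrite -(lin (fun y => sin (y * x))); exact: divdiff_sin.
  rewrite [leRHS](_ : _ = 4 * s ^+ 2); last by rewrite [LHS]exprMn -natrX.
  by move: (sqr_ge0 s); move: (s ^+ 2) => y; lra.
have s20 : 0 < 2 * s by rewrite mulr_gt0.
have := lincomb_tail HX (mulr_ge0 u0 (ltW s20)) s20 form.
rewrite mulfK ?gt_eqF //; apply: le_trans; rewrite le_eqVlt; apply/orP; left; apply/eqP.
by congr (P _); apply/seteqP; split => w /=; rewrite lin.
Qed.

Section Grid.
Variables (K h : R) (m : nat).
Hypotheses (K1 : 1 <= K) (h0 : 0 < h).
Hypothesis lower : forall a : 'I_m.+1 -> R,
  K^-1 * (h / K) ^+ (2 * m) * (\sum_(i < m.+1) a i ^+ 2) <=
    spectral_form mu (fun i => i%:R * h) a.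

Let S : 'M[R]_m.+1 :=
  \matrix_(i < m.+1, j < m.+1) \int[mu]_x cos ((j%:R * h - i%:R * h) * x).
Let lam := K^-1 * (h / K) ^+ (2 * m).

Let quadS v : quad S v = spectral_form mu (fun i : 'I_m.+1 => i%:R * h) (v 0).
Proof.
rewrite -spectral_form_double_sum /quad mxE exchange_big /=; apply: eq_bigr => j _.
rewrite !mxE mulr_suml; apply: eq_bigr => i _; rewrite !mxE; ring.
Qed.

Let symS : S^T = S.
Proof.
by apply/matrixP => i j; rewrite !mxE; apply: eq_Rintegral => x _; rewrite -[LHS]cosN; congr cos; ring.
Qed.

Let lam0 : 0 < lam.
Proof. by have K0 := lt_le_trans ltr01 K1; rewrite mulr_gt0 ?exprn_gt0 ?divr_gt0 ?invr_gt0. Qed.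

Let Sge (v : 'rV_m.+1) : lam * sqn v <= quad S v.
Proof. by rewrite quadS sqnE; exact: lower. Qed.

Let charX th (v : 'rV_m.+1) : \int[P]_w cos (th + \sum_(i < m.+1) v 0 i * X (i%:R * h) w) =
  cos th * expR (- quad S v / 2).
Proof. by rewrite quadS (lincomb_char HX (fun i : 'I_m.+1 => i%:R * h)). Qed.

Lemma grid_small_ball e : 0 < e ->
  (P [set w | forall i, (i < m.+1)%N -> (`|X (i%:R * h) w| <= e)%R] <=
    ((2 * (Num.sqrt (m.+1%:R / lam) * e)) ^+ m.+1)%:E)%E.
Proof.
move=> e0; apply: (small_ball (X := fun i => X (i%:R * h)) _ lam0 symS Sge charX e0) => //.
Qed.

Lemma grid_alternating : lam <= 1 ->
  ((1 / 2 * (Num.sqrt lam / (32 * m.+1%:R)) ^+ m.+1)%:E <=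
   P [set w | forall i, (i < m.+1)%N -> (0 < (-1) ^+ i * X (i%:R * h) w)%R])%E.
Proof.
move=> lam1; apply: (alternating_signs (X := fun i => X (i%:R * h)) _ lam0 symS Sge charX) => //.
move=> i; rewrite mxE subrr.
rewrite (_ : \int[mu]_x _ = \int[mu]_x 1); last by apply: eq_Rintegral => x _; rewrite mul0r cos0.
by rewrite /Rintegral integral_cst //= probability_setT mule1.
Qed.

End Grid.

End ProcessEvents.

(** * Probability of many zeros: union bound *)

Lemma union_bound_half d (T : measurableType d) (R : realType)
    (P : probability T R) (F : nat -> set T) (e : R) : 0 <= e ->
  (forall i, measurable (F i)) ->
  (forall i, (P (F i) <= (e / (2 ^ i.+1)%:R)%:E)%E) ->
  (P (\bigcup_i F i) <= e%:E)%E.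
Proof.
move=> e0 mF PF.
apply: le_trans (generalized_Boole_inequality P mF _) _.
  exact: bigcupT_measurable.
apply: (@le_trans _ _ (\sum_(0 <= i <oo) (0%E + (e / (2 ^ i.+1)%:R)%:E))%E).
  by apply: lee_nneseries => [i _ _|i _]; [exact: measure_ge0|rewrite add0e; exact: PF].
apply: le_trans (epsilon_trick _ _ _) _ => //.
by rewrite (@eseries0 _ _ _ _) // add0e.
Qed.

Lemma expR_tail_geometric (R : realType) (y : R) i : 1 <= y ->
  expR (- (y * 4 ^+ i)) <= expR (- y) / 2 ^+ i.
Proof.
move=> y1; have h2 : (2 : R) <= expR 1 by have := expR_ge1Dx (1 : R); lra.
have h4 : i.+1%:R <= 4 ^+ i :> R.
  by rewrite -natrX ler_nat; exact: ltn_expl.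
apply: (@le_trans _ _ (expR (- y) * expR (- i%:R))).
  rewrite -expRD ler_expR -opprD lerN2.
  apply: le_trans (_ : y * i.+1%:R <= _); last by rewrite ler_pM2l //; lra.
  by rewrite -natr1 mulrDr mulr1 addrC lerD2r ler_peMl.
rewrite ler_pM2l ?expR_gt0 // expRN lef_pV2 ?posrE ?expR_gt0 ?exprn_gt0 //.
by rewrite -[i%:R]mulr1 expRM_natl lerXn2r ?nnegrE ?expR_ge0.
Qed.

Section ManyZeros.
Context {R : realType} d (Om : measurableType d) (P : probability Om R).
Variables (X : R -> {RV P >-> R}) (mu : probability (measurableTypeR R) R).
Hypothesis HX : smooth_stationary_gaussian X mu.

Lemma measurable_newton_coef tau j :
  measurable_fun setT (fun w => newton_coef tau (fun t => X t w) j).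
Proof.
rewrite /newton_coef /divdiff; apply: measurable_sum => y.
by apply: measurable_funM => //; exact: measurable_process.
Qed.

Definition zeros_ge n (T : R) : set Om := [set w | exists s : seq R,
  [/\ uniq s, size s = n & {in s, forall y, 0 <= y <= T /\ X y w = 0}]].

Lemma measurable_zeros_event n T : measurable (zeros_ge n T).
Proof.
apply: (@measurable_zeros_ge R d Om (fun t => X t : Om -> R)) => [t|w].
  exact: measurable_process.
exact: continuous_paths HX w.
Qed.

Lemma zero_count_geE n T :
  [set w | (n%:R%:E <= zero_count X T w)%E] = zeros_ge n T.
Proof. by apply/seteqP; split => w /= /counting_geP. Qed.

(** Unless a Newton coefficient of order [j >= n] exceeds [u 2^j] times the bound
    on its standard deviation, [n] zeros make the process small on all of
    [[0, T]], in particular on the grid. The factor [2^j] makes the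
    probabilities of the exceptional events summable and only doubles the
    growth rate [A] of the coefficients. *)
Lemma zeros_union_bound (A K h T u : R) (m n : nat) : 0 < A ->
  mu (~` `[- A, A]%classic) = 0%E -> 1 <= K -> 0 < h -> 1 <= T ->
  (forall a : 'I_m.+1 -> R,
    K^-1 * (h / K) ^+ (2 * m) * (\sum_(i < m.+1) a i ^+ 2) <=
    spectral_form mu (fun i => i%:R * h) a) ->
  m%:R * h <= T -> 1 <= u -> (0 < n)%N ->
  (P (zeros_ge n T) <=
    ((2 * (Num.sqrt (m.+1%:R / (K^-1 * (h / K) ^+ (2 * m))) *
      (2 * u * expR (A * T) * (T ^+ n * ((2 * A) ^+ n / n`!%:R * expR (2 * A * T))))))
     ^+ m.+1 + 4 * expR (- (u ^+ 2 * 4 ^+ n / 4)))%:E)%E.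
Proof.
move=> A0 muA K1 h0 T1 lower hT u1 n0; set e := 2 * u * _ * _.
have T0 : 0 < T by apply: lt_le_trans T1.
have u0 : 0 < u by apply: lt_le_trans u1.
have e0 : 0 < e.
  by rewrite !mulr_gt0 ?expR_gt0 ?exprn_gt0 ?mulr_gt0 ?invr_gt0 ?ltr0n ?fact_gt0.
have [tau [tinj trange tdense]] := dense_sequence T1.
pose v j : R := u * 2 ^+ j * (2 * (A ^+ j / j`!%:R * expR (A * T))).
pose F i : set Om := [set w | v (n + i)%N < `|newton_coef tau (fun t => X t w) (n + i)|].
have mF i : measurable (F i).
  rewrite (_ : F i = (fun w => `|newton_coef tau (fun t => X t w) (n + i)|) @^-1` `]v (n + i)%N, +oo[%classic).
    rewrite -[Y in measurable Y]setTI.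
    have : measurable_fun setT (fun w => `|newton_coef tau (fun t => X t w) (n + i)|).
      by apply: measurableT_comp => //; exact: measurable_newton_coef.
    by move=> /(_ measurableT); apply; exact: measurable_itv.
  by apply/seteqP; split => w; rewrite /F /= in_itv /= andbT.
pose y := u ^+ 2 * 4 ^+ n / 4.
have y1 : 1 <= y.
  have -> : y = u ^+ 2 * 4 ^+ n.-1 
    by rewrite /y (_ : 4 ^+ n = 4 * 4 ^+ n.-1 :> R); [field|rewrite -exprS prednK].
  by rewrite mulr_ege1 ?exprn_ege1 // ler1n.
have PF i : (P (F i) <= (4 * expR (- y) / (2 ^ i.+1)%:R)%:E)%E.
  have ui : 0 <= u * 2 ^+ (n + i) by rewrite mulr_ge0 ?exprn_ge0 // ltW.
  apply: le_trans (newton_coef_tail HX (n + i) A0 muA (ltW T0) tinj trange ui) _.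
  have p4 : (2 ^+ (n + i)) ^+ 2 = 4 ^+ n * 4 ^+ i :> R.
    by rewrite -exprM mulnC exprM -exprD expr2 -natrM.
  rewrite lee_fin [X in expR X](_ : _ = - (y * 4 ^+ i)); last first.
    by rewrite [X in - X]exprMn p4 /y; field.
  rewrite natrX exprS.
  rewrite [leRHS](_ : _ = 2 * (expR (- y) / 2 ^+ i)); last first.
    by field; rewrite expf_neq0.
  by rewrite ler_pM2l //; exact: expR_tail_geometric.
pose G : set Om := [set w | forall i, (i < m.+1)%N -> `|X (i%:R * h) w| <= e].
have mG : measurable G.
  have := @measurable_box R d Om m.+1 (fun i => X (i%:R * h)) (fun i => measurable_process X (i%:R * h)) (fun=> 0) e.
  congr (measurable _); apply/seteqP; split => w H i im; have := H i im; rewrite subr0 //.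
have sub : zeros_ge n T `<=` G `|` \bigcup_i F i.
  move=> w [s [us sn sz]]; case: (pselect ((\bigcup_i F i) w)) => Fw; [by right|left].
  move=> i im.
  have iT : 0 <= i%:R * h <= T.
    rewrite mulr_ge0 ?(ltW h0) //=; apply: le_trans hT.
    by rewrite ler_pM2r // ler_nat -ltnS.
  apply: (@small_of_zeros R tau (fun t => X t w) T (2 * A) (2 * u * expR (A * T)) n s) => //.
  - exact: continuous_paths HX w.
  - by rewrite mulr_ge0 // ltW.
  - by rewrite !mulr_ge0 ?expR_ge0 // ltW.
  - move=> j nj; rewrite leNgt; apply/negP => h1; apply: Fw.
    exists (j - n)%N => //; rewrite /F /= subnKC //.
    apply: le_lt_trans h1; rewrite /v exprMn le_eqVlt; apply/orP; left; apply/eqP; ring.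
have mU : measurable (\bigcup_i F i) by exact: bigcupT_measurable.
apply: le_trans (@le_measure _ _ _ P _ _ _ _ sub) _; rewrite ?inE //.
- exact: measurable_zeros_event.
- exact: measurableU.
apply: le_trans (measureU2 _ _ _) _ => //.
rewrite EFinD; apply: leeD.
- exact: (grid_small_ball HX K1 h0 lower e0).
- by apply: union_bound_half => //; rewrite mulr_ge0 ?expR_ge0.
Qed.

End ManyZeros.

(** * Probability of many zeros: upper bound *)

Section UpperTail.
Context {R : realType}.

Lemma exprn_fact_le (n : nat) : n%:R ^+ n / n`!%:R <= expR 1 ^+ n :> R.
Proof.
have := @series_exp_coeff_le R n%:R n.+1 (ler0n _ _).
rewrite /series /= big_nat_recr //= => h.
rewrite -expRM_natl mulr1; apply: le_trans h; rewrite lerDr.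
by apply: sumr_ge0 => i _; rewrite /exp_coeff divr_ge0 ?exprn_ge0.
Qed.

Lemma sqrt_inverse_gap (K h : R) (m : nat) : 1 <= K -> 0 < h ->
  Num.sqrt (m.+1%:R / (K^-1 * (h / K) ^+ (2 * m))) = Num.sqrt (m.+1%:R * K) * (K / h) ^+ m.
Proof.
move=> K1 h0; have K0 := lt_le_trans ltr01 K1.
have -> : m.+1%:R / (K^-1 * (h / K) ^+ (2 * m)) = m.+1%:R * K * ((K / h) ^+ m) ^+ 2.
  rewrite -exprM (mulnC m) invfM invrK -exprVn invf_div; ring.
by rewrite sqrtrM ?mulr_ge0 ?(ltW K0) // sqrtr_sqr ger0_norm // exprn_ge0 // divr_ge0 // ltW.
Qed.

(** With [k = m.+1], the grid contributes [r^k], the threshold [r^(4 k)] and the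
    zeros [r^(- n) <= r^(- 8 k)], each up to a factor exponential in [k] that
    a large [r] absorbs. *)
Lemma small_ball_rate (A K T : R) (m n : nat) (r := n%:R / T) : 0 < A -> 1 <= K -> 1 <= T ->
  (8 * m.+1 <= n)%N -> (n <= 16 * m.+1)%N ->
  8 * K ^+ 2 * ((1 + 2 * A) * expR (1 + 3 * A)) ^+ 16 <= r ->
  2 * (Num.sqrt (m.+1%:R / (K^-1 * (T / m.+1%:R / K) ^+ (2 * m))) *
      (2 * r ^+ (4 * m.+1) * expR (A * T) * (T ^+ n * ((2 * A) ^+ n / n`!%:R * expR (2 * A * T)))))
    <= (r ^+ (2 * m.+1))^-1.
Proof.
move=> A0 K1 T1 kn nk rD; set k := m.+1 in kn nk *.
set D0 := (1 + 2 * A) * expR (1 + 3 * A) in rD.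
have K0 : 0 < K by apply: lt_le_trans K1.
have T0 : 0 < T by apply: lt_le_trans T1.
have k0 : 0 < k%:R :> R by [].
have n0 : (0 < n)%N by apply: leq_trans kn.
have n0R : 0 < n%:R :> R by rewrite ltr0n.
have e11 : 1 <= expR (1 + 3 * A) by have := expR_ge1Dx (1 + 3 * A); lra.
have D01 : 1 <= D0 by rewrite mulr_ege1 //; lra.
have KK1 : 1 <= K ^+ 2 by rewrite exprn_ege1.
have D1 : 1 <= 8 * K ^+ 2 * D0 ^+ 16.
  by rewrite !mulr_ege1 ?exprn_ege1 //; lra.
have r1 : 1 <= r by apply: le_trans rD.
have r0 : 0 < r by apply: lt_le_trans r1.
have Tn : T <= n%:R by move: r1; rewrite /r ler_pdivlMr // mul1r.
have s1 : Num.sqrt (k%:R / (K^-1 * (T / k%:R / K) ^+ (2 * m))) <= (2 * K ^+ 2) ^+ k * r ^+ k.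
  rewrite sqrt_inverse_gap ?divr_gt0 //.
  have kK1 : 1 <= k%:R * K by rewrite mulr_ege1 // ler1n.
  have h1 : Num.sqrt (k%:R * K) <= 2 ^+ k * K ^+ k.
    apply: (@le_trans _ _ (k%:R * K)).
      rewrite -[leRHS]ger0_norm; last by rewrite mulr_ge0 // ltW.
      by rewrite -sqrtr_sqr ler_wsqrtr // expr2 ler_peMl // (le_trans ler01).
    apply: ler_pM; rewrite ?ler0n ?(ltW K0) //.
      by rewrite -natrX ler_nat ltnW // ltn_expl.
    by rewrite -[leLHS]expr1 ler_weXn2l.
  have h2 : (K / (T / k%:R)) ^+ m <= K ^+ k * r ^+ k.
    apply: (@le_trans _ _ ((K * r) ^+ m)).
      have h3 : K / (T / k%:R) <= K * r.
        rewrite ler_pM2l // invf_div /r ler_pM2r ?invr_gt0 // ler_nat.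
        by apply: leq_trans kn; rewrite leq_pmull.
      have h4 : 0 < K / (T / k%:R) by rewrite !divr_gt0.
      have h5 : 0 < K * r by rewrite mulr_gt0.
      by apply: lerXn2r h3; rewrite nnegrE ltW.
    by rewrite -exprMn ler_weXn2l // mulr_ege1.
  rewrite [leRHS](_ : _ = (2 ^+ k * K ^+ k) * (K ^+ k * r ^+ k)); last first.
    by rewrite expr2 !exprMn; ring.
  by apply: ler_pM; rewrite ?sqrtr_ge0 ?exprn_ge0 ?divr_ge0 ?(ltW K0) ?(ltW T0) ?(ltW k0).
have s2 : expR (A * T) * (T ^+ n * ((2 * A) ^+ n / n`!%:R * expR (2 * A * T))) <= D0 ^+ n * (r ^+ n)^-1.
  have -> : expR (A * T) * (T ^+ n * ((2 * A) ^+ n / n`!%:R * expR (2 * A * T))) =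
      ((2 * A) ^+ n * expR (3 * A * T)) * (n%:R ^+ n / n`!%:R) * (r ^+ n)^-1.
    rewrite (_ : 3 * A * T = A * T + 2 * A * T); last by ring.
    rewrite expRD /r expr_div_n; field.
    by rewrite !gt_eqF ?exprn_gt0 // ltr0n fact_gt0.
  rewrite ler_pM2r ?invr_gt0 ?exprn_gt0 //.
  apply: (@le_trans _ _ ((1 + 2 * A) ^+ n * expR (3 * A) ^+ n * expR 1 ^+ n)).
    apply: ler_pM; [by rewrite mulr_ge0 ?expR_ge0 ?exprn_ge0 ?mulr_ge0 // ltW|by rewrite divr_ge0 ?exprn_ge0| |exact: exprn_fact_le].
    apply: ler_pM; rewrite ?expR_ge0 ?exprn_ge0 ?mulr_ge0 ?(ltW A0) //.
      by apply: lerXn2r; rewrite ?nnegrE; lra.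
    by rewrite -expRM_natl ler_expR mulrC ler_pM2r // mulr_gt0.
  by rewrite -!exprMn /D0 expRD mulrA mulrAC.
apply: (@le_trans _ _ (4 ^+ k * ((2 * K ^+ 2) ^+ k * r ^+ k) * r ^+ (4 * k) * (D0 ^+ (16 * k) * (r ^+ (8 * k))^-1))).
  rewrite [leLHS](_ : _ = 4 * Num.sqrt (k%:R / (K^-1 * (T / k%:R / K) ^+ (2 * m))) * r ^+ (4 * k) *
    (expR (A * T) * (T ^+ n * ((2 * A) ^+ n / n`!%:R * expR (2 * A * T))))); last by ring.
  apply: ler_pM.
  - by rewrite !mulr_ge0 ?sqrtr_ge0 ?exprn_ge0 // ltW.
  - by rewrite !mulr_ge0 ?expR_ge0 ?exprn_ge0 ?mulr_ge0 ?invr_ge0 ?(ltW A0) ?(ltW T0).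
  - rewrite ler_pM2r ?exprn_gt0 //; apply: ler_pM; rewrite ?sqrtr_ge0 //.
    by rewrite -[leLHS]expr1 ler_weXn2l // ler1n.
  - apply: le_trans s2 _; apply: ler_pM; rewrite ?invr_ge0 ?exprn_ge0 ?(ltW r0) ?(le_trans ler01 D01) //.
      by rewrite ler_weXn2l.
    by rewrite lef_pV2 ?posrE ?exprn_gt0 // ler_weXn2l.
have -> : 4 ^+ k * ((2 * K ^+ 2) ^+ k * r ^+ k) * r ^+ (4 * k) * (D0 ^+ (16 * k) * (r ^+ (8 * k))^-1) =
    ((8 * K ^+ 2 * D0 ^+ 16) / r) ^+ k * (r ^+ (2 * k))^-1.
  rewrite [D0 ^+ (16 * k)]exprM (_ : 8 * K ^+ 2 = 4 * (2 * K ^+ 2)); last by ring.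
  move: r0; move: (2 * K ^+ 2) (D0 ^+ 16) (r) => a b y y0.
  rewrite !exprMn exprVn (_ : (8 * k = k + (4 * k + (2 * k + k)))%N); last by ring.
  rewrite !exprD; field.
  by rewrite !gt_eqF ?exprn_gt0.
rewrite ler_piMl ?invr_ge0 ?exprn_ge0 ?(ltW r0) // exprn_ile1 //.
  by rewrite divr_ge0 ?(le_trans ler01 D1) ?(ltW r0).
by rewrite ler_pdivrMr // mul1r.
Qed.

(** With [k = n %/ 8] grid points and the threshold [u = r^(4 k)], where
    [r = n / T], both terms of the union bound are of order at most
    [exp (- n^2 ln r / 128)]. *)
Lemma upper_tail (mu : probability (measurableTypeR R) R) :
  compactly_supported mu -> has_ac_part mu ->
  exists C c : R, [/\ 1 < C, 0 < c &
    forall (d : measure_display) (Om : measurableType d) (P : probability Om R)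
      (X : R -> {RV P >-> R}), smooth_stationary_gaussian X mu ->
    forall (T : R) (n : nat), 1 <= T -> C * T <= n%:R ->
      (P (zeros_ge X n T) <= (expR (- (c * n%:R ^+ 2 * ln (n%:R / T))))%:E)%E].
Proof.
move=> cmu acmu; have [A [A0 muA]] := compact_support_null cmu.
have [K [K1 HK]] := spectral_form_lower cmu acmu.
have [D [DE D0]] : exists D : R, D = 8 * K ^+ 2 * ((1 + 2 * A) * expR (1 + 3 * A)) ^+ 16 /\ 0 <= D.
  exists (8 * K ^+ 2 * ((1 + 2 * A) * expR (1 + 3 * A)) ^+ 16); split => //.
  by rewrite !mulr_ge0 ?exprn_ge0 ?mulr_ge0 ?expR_ge0 //; lra.
have K0 : 0 < K by apply: lt_le_trans K1.
(* [16 * K] makes the mesh at most [K^-1], [D] is the constant of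
   [small_ball_rate], and [64] absorbs the numerical factors. *)
pose C := 64 + 16 * K + D; have C64 : 64 <= C by rewrite /C; lra.
exists C, (256^-1); split; [by apply: lt_le_trans C64; rewrite ltr1n|by rewrite invr_gt0|].
move=> d Om P X HX T n T1 CT.
have T0 : 0 < T by apply: lt_le_trans T1.
pose r := n%:R / T; have rC : C <= r by rewrite ler_pdivlMr.
have nC : C <= n%:R.
  by apply: le_trans CT; rewrite ler_peMr //; exact: le_trans C64.
have n64 : (64 <= n)%N by rewrite -(ler_nat R); exact: le_trans C64 nC.
have [m mE] : exists m, (n %/ 8 = m.+1)%N.
  by exists (n %/ 8).-1; rewrite prednK // divn_gt0 // (leq_trans _ n64).
have kn : (8 * m.+1 <= n)%N by rewrite -mE mulnC leq_divM.
have nk : (n <= 16 * m.+1)%N.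
  have : (n < (n %/ 8).+1 * 8)%N by rewrite ltn_ceil.
  rewrite mE => /ltnW h; apply: leq_trans h _; rewrite mulnC -[16%N]/(8 * 2)%N -mulnA.
  by rewrite leq_mul2l /= mul2n -addnn addSn ltnS leq_addl.
have r64 : 64 <= r by exact: le_trans C64 rC.
have r0 : 0 < r by lra.
have r1 : 1 <= r by lra.
pose k : R := m.+1%:R; have k0 : 0 < k by [].
have h0 : 0 < T / k by rewrite divr_gt0.
have hK : T / k <= K^-1.
  rewrite ler_pdivrMr // mulrC ler_pdivlMr //.
  have : n%:R <= 16 * k by rewrite -natrM ler_nat.
  have : 16 * K * T <= n%:R by apply: le_trans CT; rewrite ler_pM2r // /C; lra.
  lra.
have hT : m%:R * (T / k) <= T.
  by rewrite mulrCA ler_piMr ?(ltW T0) // ler_pdivrMr // mul1r ler_nat.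
have u1 : 1 <= r ^+ (4 * m.+1) by rewrite exprn_ege1.
have n0 : (0 < n)%N by apply: leq_trans n64.
apply: le_trans (zeros_union_bound HX A0 muA K1 h0 T1 (HK _ h0 hK m) hT u1 n0) _.
rewrite lee_fin.
have rD : D <= r by move: rC; rewrite /C; lra.
rewrite DE in rD.
have rate := small_ball_rate A0 K1 T1 kn nk rD.
have lnr0 : 0 <= ln r by rewrite ln_ge0.
have lnr : ln r <= r by have := @ln_sublinear R r r0 => /ltW.
set L := n%:R ^+ 2 * ln r / 128.
have b1 : (2 * (Num.sqrt (m.+1%:R / (K^-1 * (T / m.+1%:R / K) ^+ (2 * m))) *
      (2 * r ^+ (4 * m.+1) * expR (A * T) * (T ^+ n * ((2 * A) ^+ n / n`!%:R * expR (2 * A * T)))))) ^+ m.+1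
    <= expR (- L).
  apply: (@le_trans _ _ ((r ^+ (2 * m.+1))^-1 ^+ m.+1)).
    apply: lerXn2r rate; rewrite nnegrE ?invr_ge0 ?exprn_ge0 ?(ltW r0) //.
    rewrite !mulr_ge0 ?sqrtr_ge0 ?expR_ge0 ?exprn_ge0 ?mulr_ge0 ?invr_ge0 ?(ltW A0) ?(ltW r0) ?(ltW T0) //.
  rewrite -{1}[r]lnK ?posrE // -expRM_natl -expRN -expRM_natl ler_expR mulrN lerN2.
  rewrite /L natrM -/k.
  have kn2 : n%:R <= 16 * k by rewrite -natrM ler_nat.
  have kn3 : n%:R ^+ 2 <= 256 * k ^+ 2.
    rewrite (_ : 256 * _ = (16 * k) ^+ 2); last by ring.
    by rewrite ler_sqr ?nnegrE // mulr_ge0.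
  rewrite (_ : k * (2 * k * ln r) = 256 * k ^+ 2 * ln r / 128); last by field.
  by rewrite ler_pM2r // ler_wpM2r.
have b2 : 4 * expR (- ((r ^+ (4 * m.+1)) ^+ 2 * 4 ^+ n / 4)) <= 4 * expR (- L).
  rewrite ler_pM2l // ler_expR lerN2 /L.
  have h1 : ln r <= (r ^+ (4 * m.+1)) ^+ 2.
    by apply: le_trans lnr _; rewrite -exprM -[leLHS]expr1 ler_weXn2l.
  have h2 : n%:R ^+ 2 <= 4 ^+ n :> R.
    rewrite -!natrX ler_nat (_ : 4 = 2 ^ 2)%N // -expnM mulnC expnM leq_exp2r //.
    by rewrite ltnW // ltn_expl.
  apply: (@le_trans _ _ (4 ^+ n * (r ^+ (4 * m.+1)) ^+ 2 / 128)).
    by rewrite ler_pM2r // ler_pM ?sqr_ge0.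
  rewrite mulrC [leRHS]mulrC [in leRHS]mulrA [leRHS]mulrC.
  rewrite [X in _ <= X](_ : _ = 4^-1 * (4 ^+ n * (r ^+ (4 * m.+1)) ^+ 2)); last by ring.
  by apply: ler_wpM2r; [rewrite mulr_ge0 ?exprn_ge0 ?(ltW r0)|lra].
apply: le_trans (lerD b1 b2) _.
rewrite (_ : 256^-1 * n%:R ^+ 2 * ln (n%:R / T) = L / 2); last by rewrite /L /r; field.
have L2 : ln r <= L / 2.
  rewrite /L (_ : _ / 128 / 2 = n%:R ^+ 2 / 256 * ln r); last by field.
  rewrite ler_peMl // ler_pdivlMr // mul1r -natrX ler_nat.
  by rewrite (_ : 256 = 16 ^ 2)%N // leq_exp2r //; exact: leq_trans n64.
have e5 : 5 <= expR (L / 2).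
  by apply: le_trans (_ : r <= _); [lra|rewrite -{1}[r]lnK ?posrE // ler_expR].
rewrite [leLHS](_ : _ = 5 * expR (- (L / 2)) * expR (- (L / 2))); last first.
  by rewrite -mulrA -expRD (_ : - (L / 2) + - (L / 2) = - L); [ring|field].
rewrite ler_piMl ?expR_ge0 // expRN -ler_pdivlMr ?invr_gt0 ?expR_gt0 // invrK mul1r //.
Qed.

End UpperTail.

(** * Probability of many zeros: lower bound *)

Section LowerTail.
Context {R : realType}.

Lemma zeros_of_alternating_signs (f : R -> R) (h : R) (n : nat) : 0 < h -> continuous f ->
  (forall i, (i < n.+1)%N -> 0 < (-1) ^+ i * f (i%:R * h)) ->
  exists s : seq R, [/\ uniq s, size s = n & {in s, forall y, 0 <= y <= n%:R * h /\ f y = 0}].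
Proof.
move=> h0 cf Hf.
have /choice[z zP] : forall i, exists y, (i < n)%N ->
    [/\ i%:R * h < y, y < i.+1%:R * h & f y = 0].
  move=> i; case: (ltnP i n) => [le_in|]; last by exists 0.
  have f1 := Hf i (ltnW le_in); have f2 := Hf i.+1 le_in.
  have ii : i%:R * h <= i.+1%:R * h by rewrite ler_pM2r // ler_nat.
  have fin k : (k < n.+1)%N -> f (k%:R * h) != 0.
    by move=> /Hf; apply: contraTneq => ->; rewrite mulr0 ltxx.
  have [|y] := @IVT R f _ _ 0 ii (continuous_subspaceT cf).
    rewrite exprS mulN1r mulNr oppr_gt0 in f2.
    have [e|e] : (-1) ^+ i = 1 :> R \/ (-1) ^+ i = -1 :> R.
      by rewrite -signr_odd; case: (odd i); [right|left].
    - rewrite e !mul1r in f1 f2; rewrite ge_min le_max (ltW f1) (ltW f2) orbT //.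
    - rewrite e !mulN1r oppr_gt0 in f1; rewrite e mulN1r oppr_lt0 in f2.
      by rewrite ge_min le_max (ltW f1) (ltW f2) orbT.
  rewrite in_itv /= => /andP[y1 y2] fy; exists y => _; split => //.
  - by rewrite lt_neqAle y1 andbT; apply: contraNneq (fin i (ltnW le_in)) => ->; rewrite fy.
  - by rewrite lt_neqAle y2 andbT; apply: contraNneq (fin i.+1 le_in) => <-; rewrite fy.
have zmono i j : (i < j)%N -> (j < n)%N -> z i < z j.
  move=> ij jn; have [_ h1 _] := zP i (ltn_trans ij jn); have [h2 _ _] := zP j jn.
  by apply: lt_trans h1 _; apply: le_lt_trans h2; rewrite ler_pM2r // ler_nat.
exists (mkseq z n); split; [|exact: size_mkseq|].
- rewrite map_inj_in_uniq ?iota_uniq // => i j; rewrite !mem_iota !add0n /= => ni nj zij.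
  by case: (ltngtP i j) => // ij; [have := zmono _ _ ij nj|have := zmono _ _ ij ni]; rewrite zij ltxx.
- move=> y ys; have ni : (index y (mkseq z n) < n)%N by rewrite -[X in (_ < X)%N](size_mkseq z) index_mem.
  have := nth_index 0 ys; rewrite nth_mkseq // => <-; move: (index _ _) ni => i ni.
  have [h1 h2 h3] := zP i ni.
  split => //; rewrite (ltW (le_lt_trans _ h1)) ?mulr_ge0 ?(ltW h0) //=.
  by apply: le_trans (ltW h2) _; rewrite ler_pM2r // ler_nat.
Qed.

(** The square root is about [(K r)^(- n)], and its power [n.+1] produces the
    exponent quadratic in [n]; all constants are absorbed by further powers
    of [r]. *)
Lemma alternating_rate (K r : R) (n : nat) : 1 <= K -> 64 * K ^+ 2 <= r -> (0 < n)%N ->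
  expR (- (6 * n%:R ^+ 2 * ln r)) <=
    1 / 2 * (Num.sqrt (K^-1 * (r^-1 / K) ^+ (2 * n)) / (32 * n.+1%:R)) ^+ n.+1.
Proof.
move=> K1 rK n0; have K0 : 0 < K by apply: lt_le_trans K1.
have KK1 : 1 <= K ^+ 2 by rewrite exprn_ege1.
have r64 : 64 <= r by apply: le_trans rK; rewrite ler_peMr.
have r0 : 0 < r by apply: lt_le_trans r64.
have r1 : 1 <= r by apply: le_trans r64; rewrite ler1n.
have base : (r ^+ (2 * n))^-1 <= Num.sqrt (K^-1 * (r^-1 / K) ^+ (2 * n)) / (32 * n.+1%:R).
  rewrite [(r^-1 / K) ^+ (2 * n)](_ : _ = ((r^-1 / K) ^+ n) ^+ 2); last by rewrite -exprM mulnC.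
  rewrite sqrtrM ?invr_ge0 ?(ltW K0) // sqrtr_sqr ger0_norm; last first.
    by rewrite exprn_ge0 // divr_ge0 ?invr_ge0 // ltW.
  apply: (@le_trans _ _ (K^-1 * (r^-1 / K) ^+ n / (32 * n.+1%:R))); last first.
    rewrite ler_pM2r ?invr_gt0 ?mulr_gt0 // ler_pM2r ?exprn_gt0 ?divr_gt0 ?invr_gt0 //.
    rewrite -[leLHS]ger0_norm ?invr_ge0 ?(ltW K0) // -sqrtr_sqr ler_wsqrtr //.
    by rewrite expr2 ler_piMr ?invr_ge0 ?(ltW K0) // invf_le1.
  rewrite [leRHS](_ : _ = (K * (r * K) ^+ n * (32 * n.+1%:R))^-1); last first.
    by rewrite !invfM -exprVn !invfM.
  rewrite lef_pV2 ?posrE ?mulr_gt0 ?exprn_gt0 ?mulr_gt0 //.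
  apply: (@le_trans _ _ (K ^+ n * (r * K) ^+ n * 64 ^+ n)).
    apply: ler_pM; rewrite ?mulr_ge0 ?exprn_ge0 ?mulr_ge0 ?(ltW K0) ?(ltW r0) //.
      rewrite ler_pM2r ?exprn_gt0 ?mulr_gt0 //.
      by rewrite -[leLHS]expr1 ler_weXn2l.
    rewrite (_ : 64 = 32 * 2 :> R); last by rewrite -natrM.
    rewrite exprMn; apply: ler_pM => //.
      by rewrite -[leLHS]expr1 ler_weXn2l // ler1n.
    by rewrite -natrX ler_nat ltn_expl.
  rewrite -!exprMn exprM; apply: lerXn2r; rewrite ?nnegrE ?mulr_ge0 ?sqr_ge0 ?(ltW K0) ?(ltW r0) //.
  rewrite (_ : K * (r * K) * 64 = 64 * K ^+ 2 * r); last by ring.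
  by rewrite expr2 ler_pM2r.
have half : (r ^+ (2 * n))^-1 <= 1 / 2.
  rewrite mul1r lef_pV2 ?posrE ?exprn_gt0 //.
  apply: (@le_trans _ _ r); first by apply: le_trans r64; rewrite ler_nat.
  by rewrite -[leLHS]expr1 ler_weXn2l // muln_gt0.
apply: (@le_trans _ _ ((r ^+ (2 * n))^-1 * (r ^+ (2 * n))^-1 ^+ n.+1)); last first.
  apply: ler_pM => //; rewrite ?exprn_ge0 ?invr_ge0 ?exprn_ge0 ?(ltW r0) //.
  by apply: lerXn2r base; rewrite nnegrE ?divr_ge0 ?sqrtr_ge0 ?mulr_ge0 // invr_ge0 exprn_ge0 // ltW.
rewrite -exprS exprVn -exprM -{2}[r]lnK ?posrE // -expRM_natl -expRN ler_expR lerN2.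
rewrite -natrX -natrM; apply: ler_wpM2r; first by rewrite ln_ge0.
rewrite ler_nat expnSr expn1 -mulnA (_ : 6 = 2 * 3)%N // -mulnA leq_mul2l /= mulnCA leq_mul2l.
apply/orP; right; case: (n) n0 => // k _.
by rewrite mulnS -[k.+3]/(3 + k)%N leq_add2l leq_pmull.
Qed.

(** Alternating signs at the [n.+1] points [i T / n] force [n] zeros. *)
Lemma lower_tail (mu : probability (measurableTypeR R) R) :
  compactly_supported mu -> has_ac_part mu ->
  exists C c : R, [/\ 1 < C, 0 < c &
    forall (d : measure_display) (Om : measurableType d) (P : probability Om R)
      (X : R -> {RV P >-> R}), smooth_stationary_gaussian X mu ->
    forall (T : R) (n : nat), 1 <= T -> C * T <= n%:R ->
      ((expR (- (c * n%:R ^+ 2 * ln (n%:R / T))))%:E <= P (zeros_ge X n T))%E].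
Proof.
move=> cmu acmu; have [K [K1 HK]] := spectral_form_lower cmu acmu.
have K0 : 0 < K by apply: lt_le_trans K1.
have KK1 : 1 <= K ^+ 2 by rewrite exprn_ege1.
have C64 : 64 <= 64 * K ^+ 2 by rewrite ler_peMr.
exists (64 * K ^+ 2), 6; split => //; first by apply: lt_le_trans C64; rewrite ltr1n.
move=> d Om P X HX T n T1 CT.
have T0 : 0 < T by apply: lt_le_trans T1.
have rK : 64 * K ^+ 2 <= n%:R / T by rewrite ler_pdivlMr.
have r0 : 0 < n%:R / T by apply: lt_le_trans rK; rewrite mulr_gt0 // exprn_gt0.
have n0 : 0 < n%:R :> R by move: r0; rewrite pmulr_lgt0 ?invr_gt0.
have h0 : 0 < T / n%:R by rewrite divr_gt0.
have hE : T / n%:R = (n%:R / T)^-1 by rewrite invf_div.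
have rKK : K <= n%:R / T.
  apply: le_trans rK; rewrite expr2 mulrA ler_peMl ?(ltW K0) // mulr_ege1 // ler1n //.
have hK : T / n%:R <= K^-1 by rewrite hE lef_pV2.
apply: le_trans (_ : (1 / 2 * (Num.sqrt (K^-1 * (T / n%:R / K) ^+ (2 * n)) / (32 * n.+1%:R)) ^+ n.+1)%:E <= _)%E.
  by rewrite lee_fin hE; apply: alternating_rate => //; rewrite -(ltr0n R).
apply: le_trans (grid_alternating HX K1 h0 (HK _ h0 hK n) _) _.
  have hk0 : 0 <= T / n%:R / K by rewrite ltW // !divr_gt0.
  have hk1 : T / n%:R / K <= 1.
    rewrite ler_pdivrMr // mul1r; apply: le_trans hK _.
    by apply: le_trans (_ : 1 <= K); rewrite ?invf_le1.
  by rewrite mulr_ile1 ?invr_ge0 ?(ltW K0) ?exprn_ge0 ?exprn_ile1 // invf_le1.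
apply: le_measure; rewrite ?inE; [|exact: measurable_zeros_event HX n T|].
- rewrite (_ : [set w | _] = \bigcap_(i in [set i | (i < n.+1)%N]) [set w | 0 < (-1) ^+ i * X (i%:R * (T / n%:R)) w]).
    apply: bigcap_measurableType => i _.
    rewrite (_ : [set w | _] = (fun w => (-1) ^+ i * X (i%:R * (T / n%:R)) w) @^-1` `]0, +oo[%classic).
      rewrite -[Y in measurable Y]setTI.
      have : measurable_fun setT (fun w => (-1) ^+ i * X (i%:R * (T / n%:R)) w).
        by apply: measurable_funM => //; exact: measurable_process.
      by move=> /(_ measurableT); apply; exact: measurable_itv.
    by apply/seteqP; split => w; rewrite /= in_itv /= andbT.
  by apply/seteqP; split => w H i; exact: H.
- move=> w Hw; rewrite /zeros_ge /=.
  have cf : continuous (fun t => X t w) by exact: continuous_paths HX w.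
  have [s [us sn sz]] := zeros_of_alternating_signs h0 cf Hw.
  by exists s; split => // y /sz; rewrite mulrC divfK ?gt_eqF.
Qed.

End LowerTail.

(** * Moments of the number of zeros *)

Section Moments.
Context {R : realType}.
Implicit Types N : \bar R.

Lemma telescoped_powers (k m : nat) : (0 < m)%N ->
  (\sum_(0 <= i < k) (i.+1 ^ m - i ^ m) = k ^ m)%N.
Proof.
move=> m0; rewrite (telescope_sumn _ _ (f := fun i => i ^ m)%N) ?exp0n ?subn0 // => x y xy.
by rewrite leq_exp2r.
Qed.

(** Decomposition into the layers [i < N]; for infinite [N] every layer counts at
    least [1] and the series diverges. *)
Lemma natural_or_infinite_power N (m : nat) : (0 < m)%N ->
  (N = +oo%E \/ exists k : nat, N = k%:R%:E) ->
  (N ^+ m = \sum_(0 <= i <oo) ((i.+1 ^ m - i ^ m)%N%:R * ((i.+1%:R : R)%:E <= N)%E%:R)%:E)%E.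
Proof.
move=> m0 [->|[k ->]].
- transitivity (+oo%E : \bar R).
    by case: m m0 => // m _; elim: m => // m IH; rewrite expeS IH mulyy.
  apply/esym/eqyP => r r0.
  apply: (@le_trans _ _ (\sum_(0 <= i < (Num.truncn r).+1) ((i.+1 ^ m - i ^ m)%N%:R * ((i.+1%:R : R)%:E <= +oo)%E%:R)%:E)%E).
    rewrite sumEFin lee_fin; apply: (@le_trans _ _ ((Num.truncn r).+1%:R)).
      by rewrite ltW // truncnS_gt.
    rewrite (eq_bigr (fun i => (i.+1 ^ m - i ^ m)%N%:R)); last first.
      by move=> i _; rewrite leey mulr1.
    rewrite -natr_sum telescoped_powers // ler_nat.
    by case: (m) m0 => // q _; rewrite expnS leq_pmulr // expn_gt0.
  apply: nneseries_lim_ge => i _ _.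
  by rewrite lee_fin mulr_ge0.
- rewrite -EFin_expe -natrX -(telescoped_powers k m0); apply/esym.
  apply: lim_near_cst => //; exists k => // n /= kn.
  rewrite sumEFin natr_sum; congr (_%:E).
  rewrite (big_cat_nat (leq0n k) kn) /= [X in _ + X]big_nat_cond [X in _ + X]big1 ?addr0; last first.
    by move=> i /andP[/andP[ki _] _]; rewrite lee_fin ler_nat leqNgt ltnS ki mulr0.
  apply: eq_big_nat => i /andP[_ ik].
  by rewrite lee_fin ler_nat ik mulr1.
Qed.

Lemma counting_natural_or_infinite (T : choiceType) (A : set T) :
  (counting A : \bar R) = +oo%E \/ exists k : nat, (counting A : \bar R) = k%:R%:E.
Proof. by rewrite /counting; case: asboolP => _; [right; eexists|left]. Qed.

(** From [x / s <= exp (x / s)] one gets [x^m <= s^m exp (s x)], and half of the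
    Gaussian exponent absorbs [s x]. *)
Lemma power_gaussian_le (x s c : R) (m : nat) : 0 < s -> 0 <= x -> 0 < c ->
  s ^+ 2 = m%:R -> 2 * s <= c * x ->
  x ^+ m * expR (- (c * x ^+ 2)) <= s ^+ m * expR (- (c * x ^+ 2 / 2)).
Proof.
move=> s0 x0 c0 sm sx.
have h1 : x ^+ m <= s ^+ m * expR (s * x).
  apply: (@le_trans _ _ (s ^+ m * expR (x / s) ^+ m)).
    rewrite -exprMn; apply: lerXn2r; rewrite ?nnegrE ?mulr_ge0 ?expR_ge0 ?(ltW s0) //.
    apply: (@le_trans _ _ (s * (1 + x / s))); last by rewrite ler_pM2l // expR_ge1Dx.
    by rewrite mulrDr mulr1 mulrCA divff ?gt_eqF // mulr1 lerDr ltW.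
  by rewrite -expRM_natl -sm (_ : s ^+ 2 * (x / s) = s * x) //; field; rewrite gt_eqF.
apply: le_trans (ler_wpM2r (expR_ge0 _) h1) _.
rewrite -[leLHS]mulrA -expRD ler_pM2l ?exprn_gt0 // ler_expR.
have : 2 * s * x <= c * x * x by rewrite ler_wpM2r.
by rewrite expr2; lra.
Qed.

(** The layers below [a] contribute at most [a^m]; those above are dominated by
    [a^m] times a geometric series. *)
Lemma moment_of_tail d (Om : measurableType d) (P : probability Om R)
    (X : R -> {RV P >-> R}) (mu : probability (measurableTypeR R) R) (T c s : R) (a m : nat) :
  smooth_stationary_gaussian X mu -> (0 < m)%N -> 0 < c -> 0 < s -> s ^+ 2 = m%:R ->
  2 * s <= c * a%:R -> 2 <= c * a%:R -> s <= a%:R ->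
  (forall k, (a <= k)%N -> (P (zeros_ge X k T) <= (expR (- (c * k%:R ^+ 2)))%:E)%E) ->
  (\int[P]_w (zero_count X T w ^+ m) <= (2 * a%:R ^+ m)%:E)%E.
Proof.
move=> HX m0 c0 s0 sm sa a2 sa1 tail.
pose wt (i : nat) : R := (i.+1 ^ m - i ^ m)%N%:R.
have E w : (zero_count X T w ^+ m = \sum_(0 <= i <oo) (wt i)%:E * (\1_(zeros_ge X i.+1 T) w)%:E)%E.
  rewrite (natural_or_infinite_power m0 (counting_natural_or_infinite _)).
  apply: eq_eseriesr => i _; rewrite -EFinM; congr (_ * _)%:E.
  by rewrite -zero_count_geE indicE; congr (_%:R); congr nat_of_bool; apply/idP/idP; rewrite inE.
have mE k : measurable (zeros_ge X k T) by exact: measurable_zeros_event HX k T.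
have mI i : measurable_fun setT (fun w => (\1_(zeros_ge X i.+1 T) w : R)%:E).
  by apply/measurable_EFinP; exact: measurable_indic.
rewrite (eq_integral (fun w => \sum_(0 <= i <oo) (wt i)%:E * (\1_(zeros_ge X i.+1 T) w)%:E)%E); last by move=> w _; exact: E.
rewrite integral_nneseries //; last 2 first.
- by move=> i; apply: emeasurable_funM => //; exact: measurable_cst.
- by move=> i w _; rewrite -EFinM lee_fin mulr_ge0 // ler0n.
have -> : (\sum_(0 <= i <oo) \int[P]_w ((wt i)%:E * (\1_(zeros_ge X i.+1 T) w)%:E) =
    \sum_(0 <= i <oo) ((wt i)%:E * P (zeros_ge X i.+1 T)))%E.
  apply: eq_eseriesr => i _; rewrite ge0_integralZl //; last by rewrite lee_fin ler0n.
  by rewrite integral_indic // setIT.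
have pos i : (0 <= (wt i)%:E * P (zeros_ge X i.+1 T))%E.
  by rewrite mule_ge0 // lee_fin ler0n.
rewrite (nneseries_split 0 a) // add0n mulr_natl mulr2n EFinD; apply: leeD.
- apply: (@le_trans _ _ (\sum_(0 <= i < a) (wt i)%:E)%E).
    apply: lee_sum => i _; rewrite -[leRHS]mule1; apply: lee_pmul => //; rewrite ?lee_fin //.
    exact: probability_le1.
  by rewrite sumEFin /wt -natr_sum telescoped_powers // natrX.
- rewrite -nneseries_addn //.
  apply: (@le_trans _ _ (\sum_(0 <= j <oo) (0%E + (a%:R ^+ m / (2 ^ j.+1)%:R)%:E))%E); last first.
    apply: le_trans (epsilon_trick _ _ _) _ => //; rewrite ?exprn_ge0 //.
    by rewrite (@eseries0 _ _ _ _) // add0e.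
  apply: lee_nneseries => [j _ _|j _]; first exact: pos.
  rewrite add0e; set x : R := (j + a).+1%:R.
  have ax : a%:R <= x by rewrite ler_nat ltnW // ltnS leq_addl.
  have x0 : 0 <= x by rewrite ler0n.
  have sx : 2 * s <= c * x by apply: le_trans sa _; rewrite ler_pM2l.
  apply: (@le_trans _ _ (x ^+ m * expR (- (c * x ^+ 2)))%:E).
    rewrite EFinM; apply: lee_pmul => //; rewrite ?lee_fin ?ler0n //.
      by rewrite /wt /x -natrX ler_nat leq_subr.
    by apply: tail; rewrite ltnW // ltnS leq_addl.
  rewrite lee_fin; apply: le_trans (power_gaussian_le s0 x0 c0 sm sx) _.
  apply: ler_pM; rewrite ?exprn_ge0 ?expR_ge0 ?(ltW s0) //.
    by apply: lerXn2r sa1; rewrite nnegrE // ltW.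
  have -> : (2 ^ j.+1)%:R^-1 = 2^-1 ^+ j.+1 :> R by rewrite natrX exprVn.
  apply: (@le_trans _ _ (expR (- 1) ^+ j.+1)).
    rewrite -expRM_natl ler_expR mulrN1 lerN2.
    have h1 : j.+1%:R <= x by rewrite ler_nat ltnS leq_addr.
    have h2 : 2 * x <= c * x * x.
      by rewrite ler_wpM2r //; apply: le_trans a2 _; rewrite ler_pM2l.
    by rewrite expr2; lra.
  apply: lerXn2r; rewrite ?nnegrE ?expR_ge0 ?invr_ge0 //.
  by rewrite expRN lef_pV2 ?posrE ?expR_gt0 //; have := expR_ge1Dx (1 : R); lra.
Qed.

Lemma root_of_moment (I : \bar R) (a : R) (m : nat) : (0 < m)%N -> 0 <= a ->
  (0 <= I)%E -> (I <= (2 * a ^+ m)%:E)%E -> (poweR I m%:R^-1 <= (2 * a)%:E)%E.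
Proof.
move=> m0 a0 I0 Ia.
have h : (I <= ((2 * a) ^+ m)%:E)%E.
  apply: le_trans Ia _; rewrite lee_fin exprMn ler_wpM2r ?exprn_ge0 //.
  by rewrite -[leLHS]expr1 ler_weXn2l // ler1n.
have a20 : 0 <= 2 * a by rewrite mulr_ge0.
apply: le_trans (gt0_ler_poweR _ _ _ h) _.
- by rewrite invr_ge0.
- by rewrite in_itv /= I0 leey.
- by rewrite in_itv /= lee_fin exprn_ge0 // leey.
rewrite poweR_EFin -powR_mulrn // -powRrM mulfV ?pnatr_eq0 ?gt_eqF // powRr1 //.
Qed.

(** For [k >= C T], [upper_tail] gives the Gaussian tail [exp (- c k^2)]; the
    moment is then split at a level of order [max T (sqrt m)]. *)
Lemma moment_growth (mu : probability (measurableTypeR R) R) :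
  compactly_supported mu -> has_ac_part mu ->
  exists c : R, 0 < c /\
    forall (d : measure_display) (Om : measurableType d) (P : probability Om R)
      (X : R -> {RV P >-> R}), smooth_stationary_gaussian X mu ->
    forall (T : R) (m : nat), 1 <= T -> (1 <= m)%N ->
      (poweR (\int[P]_w (zero_count X T w ^+ m)) (m%:R^-1)
         <= (c * Num.max T (Num.sqrt m%:R))%:E)%E.
Proof.
move=> cmu acmu; have [C [c0 [C1 c00 tail]]] := upper_tail cmu acmu.
have lnC : 0 < ln C by rewrite ln_gt0.
have C0 : 0 < C by apply: lt_trans C1.
pose c := c0 * ln C; have cp : 0 < c by rewrite mulr_gt0.
(* [C] puts the levels beyond [a] in the range of the tail bound, and [2 / c]
   makes the Gaussian factor dominate the power there. *)
pose B := C + 2 / c + 1.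
have ic : 0 < 2 / c by rewrite divr_gt0.
have B1 : 1 <= B by rewrite /B; lra.
exists (4 * B); split; first by rewrite mulr_gt0 //; lra.
move=> d Om P X HX T m T1 m1.
have T0 : 0 < T by apply: lt_le_trans T1.
have m0R : 0 < m%:R :> R by rewrite ltr0n.
set s := Num.sqrt m%:R; have s0 : 0 < s by rewrite sqrtr_gt0.
have sm : s ^+ 2 = m%:R by rewrite sqr_sqrtr // ltW.
set M := Num.max T s.
have TM : T <= M by rewrite le_max lexx.
have sM : s <= M by rewrite le_max lexx orbT.
have M1 : 1 <= M by apply: le_trans TM.
pose a := (Num.truncn (B * M)).+1.
have BMa : B * M <= a%:R by rewrite ltW // truncnS_gt.
have BM1 : 1 <= B * M by rewrite mulr_ege1.
have aBM : a%:R <= 2 * (B * M).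
  have : (Num.truncn (B * M))%:R <= B * M by rewrite truncn_le //; lra.
  by rewrite /a -natr1; lra.
have CMa : C * M <= a%:R.
  apply: le_trans BMa; rewrite ler_pM2r; last lra.
  by rewrite /B; lra.
have cMa : 2 * M <= c * a%:R.
  rewrite -ler_pdivrMl // mulrA mulrC; apply: le_trans BMa; rewrite mulrC ler_pM2r; last lra.
  by rewrite mulrC /B; lra.
have Ma : M <= a%:R by apply: le_trans BMa; rewrite ler_peMl //; lra.
apply: le_trans (root_of_moment (a := a%:R) m1 (ler0n _ _) _ _) _.
- apply: integral_ge0 => w _.
  by rewrite expe_ge0 // /zero_count; exact: measure_ge0.
- apply: (moment_of_tail HX m1 cp s0 sm).
  + lra.
  + lra.
  + exact: le_trans Ma.
  + move=> k ak; have akR : a%:R <= k%:R :> R by rewrite ler_nat.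
    have CTk : C * T <= k%:R.
      by apply: le_trans akR; apply: le_trans CMa; rewrite ler_pM2l.
    apply: le_trans (tail d Om P X HX T k T1 CTk) _.
    rewrite lee_fin ler_expR lerN2 /c mulrAC ler_wpM2l ?mulr_ge0 ?sqr_ge0 ?(ltW c00) //.
    by rewrite ler_ln ?posrE ?divr_gt0 // ?ler_pdivlMr //; apply: lt_le_trans CTk; rewrite mulr_gt0.
- by rewrite lee_fin -mulrA; lra.
Qed.

End Moments.

(** * Logarithms of probabilities *)

Lemma lne_expR (R : realType) (x : R) : lne (expR x)%:E = x%:E.
Proof. by rewrite lne_EFin ?expR_gt0 // expRK. Qed.

Lemma oppe_lne_ge (R : realType) (p : \bar R) (x : R) : (0 <= p)%E ->
  (p <= (expR (- x))%:E)%E -> (x%:E <= - lne p)%E.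
Proof.
move=> p0 px; rewrite leeNr -EFinN -lne_expR lee_lne //.
- by rewrite in_itv /= p0 leey.
- by rewrite in_itv /= lee_fin expR_ge0 leey.
Qed.

Lemma oppe_lne_le (R : realType) (p : \bar R) (x : R) :
  ((expR (- x))%:E <= p)%E -> (- lne p <= x%:E)%E.
Proof.
move=> px; rewrite leeNl -EFinN -lne_expR lee_lne //.
- by rewrite in_itv /= lee_fin expR_ge0 leey.
- by rewrite in_itv /= leey andbT (le_trans _ px) // lee_fin expR_ge0.
Qed.

Theorem mainTheorem3 (R : realType) (mu : probability (measurableTypeR R) R)
    (mu_supp : compactly_supported mu) (mu_sym : symmetric_measure mu)
    (mu_ac : has_ac_part mu) :
  (exists C c1 c2 : R, [/\ 1 < C, 0 < c1, c1 <= c2 &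
     forall (d : measure_display) (Omega : measurableType d)
         (P : probability Omega R) (X : R -> {RV P >-> R}),
       smooth_stationary_gaussian X mu ->
       forall (T : R) (n : nat), 1 <= T -> C * T <= n%:R ->
         ((c1 * n%:R ^+ 2 * ln (n%:R / T))%:E
            <= - lne (P [set w | n%:R%:E <= zero_count X T w]))%E /\
         (- lne (P [set w | n%:R%:E <= zero_count X T w])
            <= (c2 * n%:R ^+ 2 * ln (n%:R / T))%:E)%E])
  /\
  (exists c : R, 0 < c /\
     forall (d : measure_display) (Omega : measurableType d)
         (P : probability Omega R) (X : R -> {RV P >-> R}),
       smooth_stationary_gaussian X mu ->
       forall (T : R) (m : nat), 1 <= T -> (1 <= m)%N ->
         (poweR (\int[P]_w (zero_count X T w ^+ m)) (m%:R^-1)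
            <= (c * Num.max T (Num.sqrt m%:R))%:E)%E).
Proof.
split; last exact: moment_growth mu_supp mu_ac.
have [Ca [ca [Ca1 ca0 upper]]] := upper_tail mu_supp mu_ac.
have [Cb [cb [Cb1 cb0 lower]]] := lower_tail mu_supp mu_ac.
exists (Num.max Ca Cb), ca, (Num.max ca cb); split => //.
- by rewrite lt_max Ca1.
- by rewrite le_max lexx.
move=> d Om P X HX T n T1 CT.
have T0 : 0 < T by apply: lt_le_trans T1.
have CaT : Ca * T <= n%:R.
  by apply: le_trans CT; rewrite ler_pM2r // le_max lexx.
have CbT : Cb * T <= n%:R.
  by apply: le_trans CT; rewrite ler_pM2r // le_max lexx orbT.
have ln0 : 0 <= ln (n%:R / T).
  rewrite ln_ge0 // ler_pdivlMr //; apply: le_trans CaT; rewrite ler_pM2r //.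
  exact: ltW.
rewrite zero_count_geE; split.
- by apply: oppe_lne_ge; [exact: measure_ge0|exact: upper].
- apply: oppe_lne_le; apply: le_trans (lower d Om P X HX T n T1 CbT).
  rewrite lee_fin ler_expR lerN2 -!mulrA ler_wpM2r ?mulr_ge0 ?sqr_ge0 //.
  by rewrite le_max lexx orbT.
Qed.
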